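(* Let $J$ be a Grothendieck topology on $\mathrm{commalg}_{\mathbb{C}}$ and let $K$ be a Grothendieck topology on the poset category $\mathbb{N}^{\times}_+$. Suppose that $K$ is of finite type. Suppose further that at least one of the following holds: (1) $J$ is finer than the étale topology; or (2) $J$ is finer than the Zariski topology and $K$ is stable under multiplication. Then the collection of $J_K$-covering sieves defines a Grothendieck topology on $\mathrm{Azumaya}_{\mathbb{C}}$.
   Context: All algebras are associative, unital, finitely generated $\mathbb{C}$-algebras. An Azumaya algebra $A$ over a commutative ring $C$ is a $C$-algebra that is a faithful finitely generated projective $C$-module such that $A\otimes_C A^{op}\to \mathrm{End}_C(A)$, $a\otimes b\mapsto (r\mapsto arb)$, is an isomorphism; then the center $Z(A)$ is $C$. It is of constant degree $n$ if it has constant rank $n^2$ over $C$. Categories. $\mathrm{commalg}_{\mathbb{C}}$ is the category of commutative finitely presented $\mathbb{C}$-algebras. $\mathrm{Azumaya}_{\mathbb{C}}$ is the category whose objects are all Azumaya algebras $A$ whose center is in $\mathrm{commalg}_{\mathbb{C}}$ and whose morphisms are the center-preserving $\mathbb{C}$-algebra morphisms $f:A\to A'$, i.e. $f(Z(A))\subseteq Z(A')$. $\mathbb{N}^{\times}_+$ is the poset category with objects the positive integers and a (unique) morphism $n\to m$ iff $n\mid m$. Sieves and topologies (dual convention, used for all three categories). A sieve on an object $A$ is a collection $S$ of morphisms with source $A$, closed under post-composition with arbitrary morphisms. A Grothendieck topology $J$ assigns to each object $A$ a collection $J(A)$ of sieves on $A$ (''$J$-covering sieves'') such that: (GT1) the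 sieve of all morphisms from $A$ is in $J(A)$; (GT2) if $S\in J(A)$ and $h:A\to B$ is a morphism, then $h^{-1}(S)=\{g:B\to D \mid g\circ h\in S\}\in J(B)$; (GT3) if $S\in J(A)$ and $R$ is a sieve on $A$ with $h^{-1}(R)\in J(B)$ for all $h:A\to B$ in $S$, then $R\in J(A)$. A family $\{A\to A_i\}$ is a cover if the sieve it generates by post-composition is in $J(A)$. $J$ is finer than $J'$ if every $J'$-covering sieve is $J$-covering (equality allowed). Zariski topology on $\mathrm{commalg}_{\mathbb{C}}$: generated by the covers $\{C\to C[c_i^{-1}]\}_{i\in I}$ with $\sum_i c_iC=C$. Étale topology on $\mathrm{commalg}_{\mathbb{C}}$: generated by the covers $\{C\to C[c_i^{-1}]\to D_i\}_{i\in I}$ with $\sum_i c_iC=C$ and each $\mathrm{Spec}(D_i)\to\mathrm{Spec}(C[c_i^{-1}])$ an étale surjection. A Grothendieck topology $K$ on $\mathbb{N}^{\times}_+$ is of finite type if every $K$-covering sieve contains a finitely generated $K$-covering sieve. It is stable under multiplication if whenever $\{n\to n_r\}_r$ is in $K(n)$ and $k$ is a positive integer, $\{nk\to n_rk\}_r$ is a cover of $nk$ for $K$. $J_K$-covering sieves. Let $A$ be an Azumaya algebra with center $C$, $L$ a sieve on $A$ in $\mathrm{Azumaya}_{\mathbb{C}}$, and $f:C\to D$ a morphism in $\mathrm{commalg}_{\mathbb{C}}$. A number $m\in\mathbb{N}_+$ is represented on $f$ if $L$ contains a morphism of the form $A\to A\otimes_C D\to B$, where the first map is the canonical one and the second is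 a $D$-algebra morphism to an Azumaya algebra $B$ with center $D$ and of constant degree $m$. The morphism $f$ is centrally covered (with respect to $K$ and $L$) if $A\otimes_C D$ is of constant degree $n$ for some $n$, and the numbers represented on $f$ form a $K$-covering sieve on $n$. Let $\pi_K(L)$ be the set of all centrally covered $f:C\to D$. The sieve $L$ is a $J_K$-covering sieve if $\pi_K(L)$ is a $J$-covering sieve on $C$. *)

(* Defs.v *)
From HB Require Import structures.
From mathcomp Require Import all_boot all_order all_algebra.
From mathcomp Require Import generic_quotient mpoly boolp.

Set Implicit Arguments.
Unset Strict Implicit.
Unset Printing Implicit Defensive.

Import GRing.Theory.
Local Open Scope ring_scope.
Local Open Scope quotient_scope.

(* The zero ring is an object of both categories of algebras (localizations may *)
(* vanish), so rings are pzRingType / comPzRingType.  Since MathComp's algType *)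
(* is nontrivial, algebras are rings with a central structure map.             *)

Record category := Category {
  obj :> Type;
  hom : obj -> obj -> Type;
  idc : forall A, hom A A;
  comp : forall A B D, hom B D -> hom A B -> hom A D;
  comp1c : forall A B (f : hom A B), comp (idc B) f = f;
  compc1 : forall A B (f : hom A B), comp f (idc A) = f;
  compcA : forall A B D E (h : hom D E) (g : hom B D) (f : hom A B),
    comp h (comp g f) = comp (comp h g) f }.

(* Sieves consist of morphisms with a fixed source: this is the dual of the    *)
(* usual convention.                                                           *)
Section Sieves.
Variable X : category.

Record sieve (A : X) := Sieve {
  in_sieve :> forall B : X, hom A B -> Prop;
  sieve_closed : forall (B D : X) (h : hom B D) (f : hom A B),
    in_sieve f -> in_sieve (comp h f) }.

Definition max_sieve (A : X) : sieve A :=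
  @Sieve A (fun _ _ => True) (fun _ _ _ _ _ => I).

Lemma pullback_closed (A B : X) (h : hom A B) (S : sieve A) (D E : X)
    (u : hom D E) (g : hom B D) :
  S D (comp g h) -> S E (comp (comp u g) h).
Proof. by move=> Sg; rewrite -compcA; apply: sieve_closed. Qed.

Definition pullback (A B : X) (h : hom A B) (S : sieve A) : sieve B :=
  @Sieve B (fun D g => S D (comp g h)) (@pullback_closed A B h S).

Lemma family_closed (A : X) (I : Type) (B : I -> X) (f : forall i, hom A (B i))
    (D E : X) (u : hom D E) (g : hom A D) :
  (exists (i : I) (h : hom (B i) D), g = comp h (f i)) ->
  (exists (i : I) (h : hom (B i) E), comp u g = comp h (f i)).
Proof. by move=> [i [h ->]]; exists i, (comp u h); rewrite compcA. Qed.

Definition family_sieve (A : X) (I : Type) (B : I -> X)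
    (f : forall i, hom A (B i)) : sieve A :=
  @Sieve A (fun D g => exists (i : I) (h : hom (B i) D), g = comp h (f i))
    (@family_closed A I B f).

Definition coverage := forall A : X, sieve A -> Prop.

Definition grothendieck_topology (J : coverage) : Prop :=
  [/\ forall A, J A (max_sieve A),
      forall (A B : X) (S : sieve A) (h : hom A B), J A S -> J B (pullback h S)
    & forall (A : X) (S R : sieve A), J A S ->
        (forall (B : X) (h : hom A B), S B h -> J B (pullback h R)) -> J A R].

Definition finer (J J' : coverage) : Prop :=
  forall (A : X) (S : sieve A), J' A S -> J A S.

Definition cover_class :=
  forall (A : X) (I : Type) (B : I -> X), (forall i, hom A (B i)) -> Prop.

Definition generated_topology (cov : cover_class) : coverage := fun A S =>
  forall J : coverage, grothendieck_topology J ->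
    (forall (A' : X) (I : Type) (B : I -> X) (f : forall i, hom A' (B i)),
       @cov A' I B f -> J A' (family_sieve f)) ->
    J A S.

Lemma generated_topologyP (cov : cover_class) :
  grothendieck_topology (generated_topology cov).
Proof.
split=> [A J [? _ _] _|A B S h JS J JT cJ|A S R JS SR J JT cJ]; first by [].
  by case: (JT) => _ p _; apply/p/(JS J).
by case: (JT) => _ _ p; apply: p (JS J JT cJ) _ => B h /SR; apply.
Qed.

End Sieves.

Definition posN := {n : nat | (0 < n)%N}.

Definition div_cat : category := @Category posN
  (fun n m => (val n %| val m)%N)
  (fun n => dvdnn _)
  (fun n m p (mp : (val m %| val p)%N) (nm : (val n %| val m)%N) =>
     dvdn_trans nm mp)
  (fun _ _ _ => bool_irrelevance _ _)
  (fun _ _ _ => bool_irrelevance _ _)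
  (fun _ _ _ _ _ _ _ => bool_irrelevance _ _).

Lemma mulp_gt0 (n k : posN) : (0 < val n * val k)%N.
Proof. by rewrite muln_gt0 (valP n) (valP k). Qed.

Definition mulp (n k : posN) : posN := exist _ (val n * val k)%N (mulp_gt0 n k).

Definition finite_type (K : coverage div_cat) : Prop :=
  forall (n : div_cat) (S : sieve n), K n S ->
    exists (l : nat) (m : 'I_l -> div_cat) (f : forall i, hom n (m i)),
      K n (family_sieve f) /\
      forall (p : div_cat) (g : hom n p), family_sieve f p g -> S p g.

Definition stable_under_mul (K : coverage div_cat) : Prop :=
  forall (n k : posN) (I : Type) (m : I -> posN)
         (f : forall i, @hom div_cat n (m i)),
    K n (family_sieve f) ->
    K (mulp n k)
      (@family_sieve div_cat (mulp n k) I (fun i => mulp (m i) k)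
         (fun i => dvdn_mul (f i) (dvdnn (val k)))).

Section Modules.
Variable C : comPzRingType.

(* M is a direct summand of a finite free module.                              *)
Definition fg_projective (M : lmodType C) : Prop :=
  exists (n : nat) (p : {linear 'rV[C]_n -> M}) (s : {linear M -> 'rV[C]_n}),
    forall x : M, p (s x) = x.

Definition faithful (M : lmodType C) : Prop :=
  forall c : C, (forall x : M, c *: x = 0) -> c = 0.

End Modules.

(* M (x)_C N is the quotient of the formal sums of pairs (m, n) by the         *)
(* relations holding in every abelian group under every C-balanced map; hence  *)
(* it has the universal property of the tensor product by construction.        *)
Section Tensor.
Variables (C : comPzRingType) (M N : lmodType C).

Definition balanced (G : zmodType) (b : M -> N -> G) : Prop :=
  [/\ forall m m' n, b (m + m') n = b m n + b m' n,
      forall m n n', b m (n + n') = b m n + b m n'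
    & forall (c : C) m n, b (c *: m) n = b m (c *: n)].

Definition ev (G : zmodType) (b : M -> N -> G) (s : seq (M * N)) : G :=
  \sum_(x <- s) b x.1 x.2.

Definition tensor_eq (s t : seq (M * N)) : bool :=
  `[< forall (G : zmodType) (b : M -> N -> G), balanced b -> ev b s = ev b t >].

Lemma tensor_eqP : equiv_class_of tensor_eq.
Proof.
split=> [s|s t|t s u].
- exact/asboolP.
- by apply/asboolP/asboolP => h G b /h ->.
- by move=> /asboolP st /asboolP tu; apply/asboolP => G b hb; rewrite st ?tu.
Qed.

Canonical tensor_equiv := EquivRelPack tensor_eqP.

Definition tensor := {eq_quot tensor_equiv}.
HB.instance Definition _ := Choice.on tensor.
HB.instance Definition _ := EqQuotient.on tensor.

Definition pure (m : M) (n : N) : tensor := \pi_tensor [:: (m, n)].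

Definition tlift (G : zmodType) (b : M -> N -> G) (t : tensor) : G :=
  ev b (repr t).

Lemma tlift_pi (G : zmodType) (b : M -> N -> G) s :
  balanced b -> tlift b (\pi_tensor s) = ev b s.
Proof.
move=> hb; rewrite /tlift.
have /eqmodP/asboolP : repr (\pi_tensor s) = s %[mod tensor] by rewrite reprK.
exact.
Qed.

Lemma tensor_ext (s t : tensor) :
  (forall (G : zmodType) (b : M -> N -> G), balanced b ->
     tlift b s = tlift b t) -> s = t.
Proof. by move=> h; rewrite -[s]reprK -[t]reprK; apply/eqmodP/asboolP. Qed.

Definition tzero : tensor := \pi_tensor [::].
Definition tadd (s t : tensor) : tensor := \pi_tensor (repr s ++ repr t).
Definition topp (s : tensor) : tensor :=
  \pi_tensor [seq (- x.1, x.2) | x <- repr s].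

Lemma balanced0l (G : zmodType) (b : M -> N -> G) n : balanced b -> b 0 n = 0.
Proof. by case=> bD _ _; apply: (addrI (b 0 n)); rewrite -bD !addr0. Qed.

Lemma balancedNl (G : zmodType) (b : M -> N -> G) m n :
  balanced b -> b (- m) n = - b m n.
Proof.
move=> hb; apply: (addrI (b m n)); rewrite subrr.
by case: (hb) => <- _ _; rewrite subrr balanced0l.
Qed.

Lemma tlift0 (G : zmodType) (b : M -> N -> G) : balanced b -> tlift b tzero = 0.
Proof. by move=> hb; rewrite tlift_pi // /ev big_nil. Qed.

Lemma tliftD (G : zmodType) (b : M -> N -> G) s t :
  balanced b -> tlift b (tadd s t) = tlift b s + tlift b t.
Proof. by move=> hb; rewrite tlift_pi // /ev big_cat. Qed.

Lemma tliftN (G : zmodType) (b : M -> N -> G) s :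
  balanced b -> tlift b (topp s) = - tlift b s.
Proof.
move=> hb; rewrite tlift_pi // /tlift /ev big_map -sumrN.
by apply: eq_bigr => x _; rewrite balancedNl.
Qed.

Lemma taddA : associative tadd.
Proof. by move=> s t u; apply: tensor_ext => G b hb; rewrite !tliftD ?addrA. Qed.

Lemma taddC : commutative tadd.
Proof. by move=> s t; apply: tensor_ext => G b hb; rewrite !tliftD // addrC. Qed.

Lemma tadd0 : left_id tzero tadd.
Proof. by move=> s; apply: tensor_ext => G b hb; rewrite tliftD // tlift0 ?add0r. Qed.

Lemma taddN : left_inverse tzero topp tadd.
Proof.
by move=> s; apply: tensor_ext => G b hb; rewrite tliftD // tliftN // tlift0 // addNr.
Qed.

HB.instance Definition _ :=
  GRing.isZmodule.Build tensor taddA taddC tadd0 taddN.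

Lemma tlift_pure (G : zmodType) (b : M -> N -> G) m n :
  balanced b -> tlift b (pure m n) = b m n.
Proof. by move=> hb; rewrite tlift_pi // /ev big_seq1. Qed.

Lemma pure_balanced : balanced pure.
Proof.
split=> *; apply: tensor_ext => G b hb; rewrite ?tliftD // !tlift_pure //;
  by case: hb.
Qed.

Lemma tensor_ind (P : tensor -> Prop) :
  P 0 -> (forall m n, P (pure m n)) -> (forall s t, P s -> P t -> P (s + t)) ->
  forall t, P t.
Proof.
move=> P0 P1 PD t; rewrite -[t]reprK; elim: (repr t) => [//|[m n] s IH].
have -> : \pi_tensor ((m, n) :: s) = pure m n + \pi_tensor s.
  apply: tensor_ext => G b hb.
  by rewrite tliftD // !tlift_pi // /ev big_seq1 big_cons.
exact: PD.
Qed.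

End Tensor.

Arguments pure {C M N}.

Record algebra (C : comPzRingType) := Algebra {
  carrier :> pzRingType;
  scalar : {rmorphism C -> carrier};
  scalar_central : forall (c : C) (a : carrier), scalar c * a = a * scalar c }.

Definition asmod (C : comPzRingType) (A : algebra C) : Type := A.

Section AlgebraModule.
Variables (C : comPzRingType) (A : algebra C).

HB.instance Definition _ := GRing.Zmodule.copy (asmod A) (carrier A).

Let scale (c : C) (a : asmod A) : asmod A := scalar A c * (a : A).

Lemma scale_A c d a : scale c (scale d a) = scale (c * d) a.
Proof. by rewrite /scale rmorphM mulrA. Qed.
Lemma scale_1 : left_id 1 scale.
Proof. by move=> a; rewrite /scale rmorph1 mul1r. Qed.
Lemma scale_Dr : right_distributive scale +%R.
Proof. by move=> c a b; rewrite /scale mulrDr. Qed.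
Lemma scale_Dl a : {morph scale^~ a : c d / c + d}.
Proof. by move=> c d; rewrite /scale rmorphD mulrDl. Qed.

HB.instance Definition _ := GRing.Zmodule_isLmodule.Build C (asmod A)
  scale_A scale_1 scale_Dr scale_Dl.

Lemma asmod_scaleE (c : C) (a : asmod A) : c *: a = scalar A c * (a : A) :> A.
Proof. by []. Qed.

End AlgebraModule.

Section AlgebraTensor.
Variables (C : comPzRingType) (A B : algebra C).

Definition talg : Type := tensor (asmod A) (asmod B).
HB.instance Definition _ := GRing.Zmodule.on talg.

Definition tpure (a : A) (b : B) : talg :=
  pure (a : asmod A) (b : asmod B).

(* (a (x) b) * t.                                                              *)
Definition tmul1 (a : asmod A) (b : asmod B) (t : talg) : talg :=
  tlift (fun (a' : asmod A) (b' : asmod B) =>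
    tpure ((a : A) * (a' : A)) ((b : B) * (b' : B))) t.

Definition tmul (s t : talg) : talg := tlift (fun a b => tmul1 a b t) s.

Definition tone : talg := tpure 1 1.

Lemma tpureDl a a' b : tpure (a + a') b = tpure a b + tpure a' b.
Proof. by case: (@pure_balanced C (asmod A) (asmod B)) => + _ _; apply. Qed.
Lemma tpureDr a b b' : tpure a (b + b') = tpure a b + tpure a b'.
Proof. by case: (@pure_balanced C (asmod A) (asmod B)) => _ + _; apply. Qed.
Lemma tpureZ c a b : tpure (scalar A c * a) b = tpure a (scalar B c * b).
Proof. by case: (@pure_balanced C (asmod A) (asmod B)) => _ _; apply. Qed.

Lemma tmul1_balanced' (a : asmod A) (b : asmod B) :
  balanced (fun (a' : asmod A) (b' : asmod B) =>
    tpure ((a : A) * (a' : A)) ((b : B) * (b' : B))).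
Proof.
split=> [m m' n|m n n'|c m n].
- by rewrite -tpureDl -mulrDr.
- by rewrite -tpureDr -mulrDr.
- by rewrite !asmod_scaleE mulrA -scalar_central -mulrA tpureZ mulrA
    scalar_central mulrA.
Qed.

Lemma tmul1D a b s t : tmul1 a b (s + t) = tmul1 a b s + tmul1 a b t.
Proof. exact/tliftD/tmul1_balanced'. Qed.

Lemma tmul1_pure a b a' b' : tmul1 a b (tpure a' b') = tpure (a * a') (b * b').
Proof. exact/(tlift_pure _ _ (tmul1_balanced' a b)). Qed.

Lemma tmul1_0 a b : tmul1 a b 0 = 0.
Proof. exact/tlift0/tmul1_balanced'. Qed.

Lemma tmul1_balanced (t : talg) :
  balanced (fun (a : asmod A) (b : asmod B) => tmul1 a b t).
Proof.
split=> [m m' n|m n n'|c m n]; elim/tensor_ind: t => [|a b|s t].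
- by rewrite !tmul1_0 addr0.
- by rewrite !tmul1_pure -tpureDl -mulrDl.
- by rewrite !tmul1D => -> ->; rewrite addrACA.
- by rewrite !tmul1_0 addr0.
- by rewrite !tmul1_pure -tpureDr -mulrDl.
- by rewrite !tmul1D => -> ->; rewrite addrACA.
- by rewrite !tmul1_0.
- by rewrite !tmul1_pure !asmod_scaleE -!mulrA tpureZ.
- by rewrite !tmul1D => -> ->.
Qed.

Lemma tmul_pure a b a' b' :
  tmul (tpure a b) (tpure a' b') = tpure (a * a') (b * b').
Proof. by rewrite /tmul (tlift_pure _ _ (tmul1_balanced _)) tmul1_pure. Qed.

Lemma tmulDl : left_distributive tmul +%R.
Proof. by move=> s t u; apply/tliftD/tmul1_balanced. Qed.

Lemma tmul0t t : tmul 0 t = 0.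
Proof. exact/tlift0/tmul1_balanced. Qed.

Lemma tmulDr : right_distributive tmul +%R.
Proof.
move=> s t u; elim/tensor_ind: s => [|a b|s s' Hs Hs'].
- by rewrite !tmul0t addr0.
- by rewrite /tmul !(tlift_pure _ _ (tmul1_balanced _)) tmul1D.
- by rewrite !tmulDl Hs Hs' addrACA.
Qed.

Lemma tmult0 t : tmul t 0 = 0.
Proof. by apply: (addrI (tmul t 0)); rewrite -tmulDr !addr0. Qed.

Lemma tmulA : associative tmul.
Proof.
move=> s t u; elim/tensor_ind: s => [|a b|s s' Hs Hs'].
- by rewrite !tmul0t.
- elim/tensor_ind: t => [|a' b'|t t' Ht Ht'].
  + by rewrite !tmul0t !tmult0 !tmul0t.
  + elim/tensor_ind: u => [|a'' b''|u u' Hu Hu'].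
    * by rewrite !tmult0.
    * by rewrite !tmul_pure !mulrA.
    * by rewrite !tmulDr Hu Hu'.
  + by rewrite tmulDl !tmulDr tmulDl Ht Ht'.
- by rewrite !tmulDl Hs Hs'.
Qed.

Lemma tmul1t : left_id tone tmul.
Proof.
elim/tensor_ind => [|a b|s s' Hs Hs'].
- exact: tmult0.
- by rewrite tmul_pure !mul1r.
- by rewrite tmulDr Hs Hs'.
Qed.

Lemma tmult1 : right_id tone tmul.
Proof.
elim/tensor_ind => [|a b|s s' Hs Hs'].
- exact: tmul0t.
- by rewrite tmul_pure !mulr1.
- by rewrite tmulDl Hs Hs'.
Qed.

HB.instance Definition _ :=
  GRing.Zmodule_isPzRing.Build talg tmulA tmul1t tmult1 tmulDl tmulDr.

End AlgebraTensor.

Arguments tpure {C A B}.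

Definition alg_of_map (C D : comPzRingType) (f : {rmorphism C -> D}) :
  algebra C := @Algebra C D f (fun _ _ => mulrC _ _).

Section BaseChange.
Variables (C D : comPzRingType) (f : {rmorphism C -> D}) (A : algebra C).

Definition bc_scalar (d : D) : talg A (alg_of_map f) :=
  tpure (1 : A) (d : alg_of_map f).

Lemma bc_scalar_is_zmod : zmod_morphism bc_scalar.
Proof.
move=> x y; apply: (addIr (bc_scalar y)); rewrite subrK.
by rewrite /bc_scalar -tpureDr subrK.
Qed.

Lemma bc_scalar_is_monoid : monoid_morphism bc_scalar.
Proof.
split=> // x y.
by rewrite [RHS](tmul_pure (1 : A) (x : alg_of_map f) 1 (y : alg_of_map f)) mulr1.
Qed.

HB.instance Definition _ :=
  GRing.isZmodMorphism.Build D (talg A (alg_of_map f)) bc_scalar bc_scalar_is_zmod.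
HB.instance Definition _ :=
  GRing.isMonoidMorphism.Build D (talg A (alg_of_map f)) bc_scalar
    bc_scalar_is_monoid.

Lemma bc_central (d : D) (t : talg A (alg_of_map f)) :
  bc_scalar d * t = t * bc_scalar d.
Proof.
elim/tensor_ind: t => [|a b|s t Hs Ht]; first by rewrite mulr0 mul0r.
- rewrite [LHS](tmul_pure (1 : A) (d : alg_of_map f) a b).
  rewrite [RHS](tmul_pure a b (1 : A) (d : alg_of_map f)).
  by rewrite mul1r mulr1; congr tpure; apply: (@mulrC D).
- by rewrite mulrDr mulrDl Hs Ht.
Qed.

Definition base_change : algebra D :=
  @Algebra D (talg A (alg_of_map f)) bc_scalar bc_central.

Definition to_base_change (a : A) : base_change :=
  tpure a (1 : alg_of_map f).

End BaseChange.

Section Azumaya.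
Variables (C : comPzRingType) (A : algebra C).

Definition op_scalar (c : C) : A^c := scalar A c.

Lemma op_scalar_is_zmod : zmod_morphism op_scalar.
Proof. exact: (rmorphB (scalar A)). Qed.

Lemma op_scalar_is_monoid : monoid_morphism op_scalar.
Proof.
split=> [|x y]; first exact: (rmorph1 (scalar A)).
by rewrite mulrC; apply: (rmorphM (scalar A)).
Qed.

HB.instance Definition _ :=
  GRing.isZmodMorphism.Build C (A^c) op_scalar op_scalar_is_zmod.
HB.instance Definition _ :=
  GRing.isMonoidMorphism.Build C (A^c) op_scalar op_scalar_is_monoid.

Definition op_alg : algebra C :=
  @Algebra C (A^c) op_scalar (fun c a => esym (scalar_central c (a : A))).

(* a (x) b |-> (r |-> a r b)                                                   *)
Definition sandwich (t : tensor (asmod A) (asmod op_alg)) (r : asmod A) :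
    asmod A :=
  tlift (fun (a : asmod A) (b : asmod op_alg) =>
    ((a : A) * (r : A) * (b : A) : asmod A)) t.

Lemma sandwich_balanced (r : A) :
  balanced (fun (a : asmod A) (b : asmod op_alg) =>
    ((a : A) * (r : A) * (b : A) : asmod A)).
Proof.
split=> [m m' n|m n n'|c m n].
- by change ((m + m' : A) * r * (n : A) = m * r * (n : A) + m' * r * (n : A));
    rewrite !mulrDl.
- exact: (@mulrDr A).
- change (scalar A c * m * r * (n : A) = m * r * ((n : A) * scalar A c) :> A).
  by rewrite -scalar_central !mulrA scalar_central -(mulrA m) scalar_central mulrA.
Qed.

Lemma sandwich_linear t : linear (sandwich t).
Proof.
move=> c r r'; elim/tensor_ind: t => [|a b|s t Hs Ht].
- by rewrite /sandwich !(tlift0 (sandwich_balanced _)) scaler0 addr0.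
- rewrite /sandwich !(tlift_pure _ _ (sandwich_balanced _)).
  change ((a : A) * (scalar A c * r + r') * (b : A) =
          scalar A c * ((a : A) * r * (b : A)) + (a : A) * r' * (b : A) :> A).
  by rewrite mulrDr mulrDl !mulrA scalar_central.
- have E x : sandwich (s + t) x = sandwich s x + sandwich t x.
    exact: (tliftD _ _ (sandwich_balanced _)).
  by rewrite !E Hs Ht scalerDr addrACA.
Qed.

HB.instance Definition _ t :=
  GRing.isLinear.Build C (asmod A) (asmod A) *:%R (sandwich t)
    (sandwich_linear t).

(* The bijection below is automatically a ring morphism.                       *)
Definition azumaya : Prop :=
  [/\ fg_projective (asmod A), faithful (asmod A)
    & bijective (fun t => sandwich t : {linear asmod A -> asmod A})].

(* f identifies F with the residue field of C at the prime ideal ker f.        *)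
Definition residue_field (F : fieldType) (f : {rmorphism C -> F}) : Prop :=
  forall y : F, exists a b : C, f b != 0 /\ y = f a / f b.

Definition constant_rank (r : nat) : Prop :=
  forall (F : fieldType) (f : {rmorphism C -> F}), residue_field f ->
    exists phi : {linear 'rV[F]_r -> asmod (base_change f A)}, bijective phi.

Definition constant_degree (n : nat) : Prop := constant_rank (n ^ 2).

End Azumaya.

Section RingMaps.
Variables (C D : comPzRingType) (f : {rmorphism C -> D}).

(* f is the localization C -> C[c^-1].                                         *)
Definition localization_away (c : C) : Prop :=
  [/\ exists u : D, u * f c = 1,
      forall d : D, exists (a : C) (n : nat), d * f c ^+ n = f a
    & forall a : C, f a = 0 -> exists n : nat, c ^+ n * a = 0].

Definition formally_etale : Prop :=
  forall (E E' : comPzRingType) (p : {rmorphism E -> E'})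
         (u : {rmorphism C -> E}) (v : {rmorphism D -> E'}),
    (forall y, exists x, p x = y) ->
    (forall x y, p x = 0 -> p y = 0 -> x * y = 0) ->
    (forall c, p (u c) = v (f c)) ->
    exists w : {rmorphism D -> E},
      [/\ forall c, w (f c) = u c, forall d, p (w d) = v d
        & forall w' : {rmorphism D -> E}, (forall c, w' (f c) = u c) ->
            (forall d, p (w' d) = v d) -> forall d, w' d = w d].

End RingMaps.

Definition prime_ideal (C : comPzRingType) (P : C -> Prop) : Prop :=
  [/\ P 0, forall x y, P x -> P y -> P (x + y), forall a x, P x -> P (a * x),
      ~ P 1 & forall x y, P (x * y) -> P x \/ P y].

Definition spec_surjective (C D : comPzRingType) (f : {rmorphism C -> D}) :
    Prop :=
  forall P : C -> Prop, prime_ideal P ->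
    exists Q : D -> Prop, prime_ideal Q /\ forall c, P c <-> Q (f c).

Lemma rmorph_ext (A B : pzRingType) (f g : {rmorphism A -> B}) : f =1 g -> f = g.
Proof.
case: f g => [f fc] [g gc] /= /funext fg; subst g; congr GRing.RMorphism.Pack.
by case: fc gc => [[?] [?]] [[?] [?]]; congr GRing.RMorphism.Class;
  [congr Algebra.isNmodMorphism.Axioms_ |
   congr GRing.isMonoidMorphism.Axioms_]; apply: Prop_irrelevance.
Qed.

Section Categories.
Variable k : fieldType.

Definition finitely_presented (C : comPzRingType) (s : {rmorphism k -> C}) :
    Prop :=
  exists (n : nat) (p : {rmorphism {mpoly k[n]} -> C}),
    [/\ forall a : k, p a%:MP = s a,
        forall c, exists x, p x = c
      & exists (m : nat) (g : 'I_m -> {mpoly k[n]}), forall x,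
          p x = 0 <-> exists h : 'I_m -> {mpoly k[n]}, x = \sum_i h i * g i].

Record commalg := Commalg {
  commalg_ring :> comPzRingType;
  commalg_scalar : {rmorphism k -> commalg_ring};
  commalg_fp : finitely_presented commalg_scalar }.

Record commalg_hom (C D : commalg) := CommalgHom {
  commalg_map :> {rmorphism C -> D};
  commalg_map_scalar : forall a : k,
    commalg_map (commalg_scalar C a) = commalg_scalar D a }.

Lemma commalg_hom_ext (C D : commalg) (f g : commalg_hom C D) : f =1 g -> f = g.
Proof.
case: f g => [f fs] [g gs] /= /rmorph_ext fg; subst g.
by congr CommalgHom; apply: Prop_irrelevance.
Qed.

Definition commalg_id (C : commalg) : commalg_hom C C :=
  @CommalgHom C C idfun (fun _ => erefl).

Lemma commalg_comp_scalar (C D E : commalg) (g : commalg_hom D E)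
    (f : commalg_hom C D) (a : k) :
  (g \o f) (commalg_scalar C a) = commalg_scalar E a.
Proof. by rewrite /= !commalg_map_scalar. Qed.

Definition commalg_comp (C D E : commalg) (g : commalg_hom D E)
    (f : commalg_hom C D) : commalg_hom C E :=
  @CommalgHom C E (g \o f) (commalg_comp_scalar g f).

Lemma commalg_comp1c (A B : commalg) (f : commalg_hom A B) :
  commalg_comp (commalg_id B) f = f.
Proof. exact: commalg_hom_ext. Qed.

Lemma commalg_compc1 (A B : commalg) (f : commalg_hom A B) :
  commalg_comp f (commalg_id A) = f.
Proof. exact: commalg_hom_ext. Qed.

Lemma commalg_compcA (A B D E : commalg) (h : commalg_hom D E) (g : commalg_hom B D)
    (f : commalg_hom A B) :
  commalg_comp h (commalg_comp g f) = commalg_comp (commalg_comp h g) f.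
Proof. exact: commalg_hom_ext. Qed.

Definition commalg_cat : category := @Category commalg commalg_hom
  commalg_id commalg_comp
  commalg_comp1c commalg_compc1 commalg_compcA.

Definition unit_ideal (C : comPzRingType) (I : Type) (c : I -> C) : Prop :=
  exists s : seq (C * I), \sum_(x <- s) x.1 * c x.2 = 1.

Definition zariski_cover : cover_class commalg_cat :=
  fun (C : commalg) (I : Type) (L : I -> commalg)
      (l : forall i, commalg_hom C (L i)) =>
    exists c : I -> C, unit_ideal c /\ forall i, localization_away (l i) (c i).

(* A morphism of finitely presented k-algebras is of finite presentation, so   *)
(* it is etale as soon as it is formally etale.                                *)
Definition etale_cover : cover_class commalg_cat :=
  fun (C : commalg) (I : Type) (D : I -> commalg)
      (f : forall i, commalg_hom C (D i)) =>
    exists c : I -> C, unit_ideal c /\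
      forall i, exists (L : commalg) (l : commalg_hom C L) (e : commalg_hom L (D i)),
        [/\ localization_away l (c i), formally_etale e, spec_surjective e
          & f i = commalg_comp e l].

Definition zariski_topology : coverage commalg_cat :=
  generated_topology zariski_cover.

Definition etale_topology : coverage commalg_cat :=
  generated_topology etale_cover.

(* The structure map of an Azumaya C-algebra identifies C with the center, so  *)
(* an Azumaya algebra with center C is an Azumaya C-algebra.  Morphisms need   *)
(* not be C-linear: they induce a map of centers.                              *)
Record azumaya_alg := AzumayaAlg {
  az_center : commalg;
  az_alg :> algebra az_center;
  az_azumaya : azumaya az_alg }.

Definition az_scalar (A : azumaya_alg) (a : k) : A :=
  scalar A (commalg_scalar (az_center A) a).

Definition central (A : pzRingType) (z : A) : Prop :=
  forall a : A, z * a = a * z.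

Record azumaya_hom (A B : azumaya_alg) := AzumayaHom {
  az_map :> {rmorphism A -> B};
  az_map_scalar : forall a : k, az_map (az_scalar A a) = az_scalar B a;
  az_map_central : forall z : A, central z -> central (az_map z) }.

Lemma azumaya_hom_ext (A B : azumaya_alg) (f g : azumaya_hom A B) :
  f =1 g -> f = g.
Proof.
case: f g => [f fs fz] [g gs gz] /= /rmorph_ext fg; subst g.
by congr AzumayaHom; apply: Prop_irrelevance.
Qed.

Definition azumaya_id (A : azumaya_alg) : azumaya_hom A A :=
  @AzumayaHom A A idfun (fun _ => erefl) (fun _ hz => hz).

Lemma azumaya_comp_scalar (A B D : azumaya_alg) (g : azumaya_hom B D)
    (f : azumaya_hom A B) (a : k) : (g \o f) (az_scalar A a) = az_scalar D a.
Proof. by rewrite /= !az_map_scalar. Qed.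

Definition azumaya_comp (A B D : azumaya_alg) (g : azumaya_hom B D)
    (f : azumaya_hom A B) : azumaya_hom A D :=
  @AzumayaHom A D (g \o f) (azumaya_comp_scalar g f)
    (fun z hz => az_map_central g (az_map_central f hz)).

Lemma azumaya_comp1c (A B : azumaya_alg) (f : azumaya_hom A B) :
  azumaya_comp (azumaya_id B) f = f.
Proof. exact: azumaya_hom_ext. Qed.

Lemma azumaya_compc1 (A B : azumaya_alg) (f : azumaya_hom A B) :
  azumaya_comp f (azumaya_id A) = f.
Proof. exact: azumaya_hom_ext. Qed.

Lemma azumaya_compcA (A B D E : azumaya_alg) (h : azumaya_hom D E) (g : azumaya_hom B D)
    (f : azumaya_hom A B) :
  azumaya_comp h (azumaya_comp g f) = azumaya_comp (azumaya_comp h g) f.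
Proof. exact: azumaya_hom_ext. Qed.

Definition azumaya_cat : category := @Category azumaya_alg azumaya_hom
  azumaya_id azumaya_comp
  azumaya_comp1c azumaya_compc1 azumaya_compcA.

Section JK.
Variables (J : coverage commalg_cat) (K : coverage div_cat).

Definition represented (A : azumaya_alg) (L : @sieve azumaya_cat A)
    (D : commalg) (f : commalg_hom (az_center A) D) (m : posN) : Prop :=
  exists (B : algebra D) (hB : azumaya B),
    constant_degree B (val m) /\
    exists phi : {rmorphism base_change f A -> B},
      (forall d : D, phi (scalar (base_change f A) d) = scalar B d) /\
      exists g : azumaya_hom A (AzumayaAlg hB),
        (forall a : A, g a = phi (to_base_change f a)) /\
        L (AzumayaAlg hB) g.

(* Over D = 0 every degree is attained, so n is not determined by f in that  *)
(* case.                                                                       *)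
Definition centrally_covered (A : azumaya_alg) (L : @sieve azumaya_cat A)
    (D : commalg) (f : commalg_hom (az_center A) D) : Prop :=
  exists n : posN,
    constant_degree (base_change f A) (val n) /\
    exists S : @sieve div_cat n,
      K S /\ forall m : posN,
        represented L f m <-> exists nm : @hom div_cat n m, S m nm.

(* The centrally covered maps are the members of a J-covering sieve.           *)
Definition JK : coverage azumaya_cat :=
  fun (A : azumaya_alg) (L : @sieve azumaya_cat A) =>
    exists S : @sieve commalg_cat (az_center A),
      J S /\ forall (D : commalg) (f : commalg_hom (az_center A) D),
        S D f <-> centrally_covered L f.

End JK.

End Categories.

(* Main.v *)
Require Import Defs.
From mathcomp Require Import all_boot all_order all_algebra.
From mathcomp Require Import reals complex.
From HB Require Import structures.
From mathcomp Require Import separable boolp classical_sets mpoly generic_quotient ring.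
Import Defs.
Set Implicit Arguments.
Unset Strict Implicit.
Unset Printing Implicit Defensive.
Import Order.TTheory GRing.Theory Num.Theory.
Local Open Scope ring_scope.
Local Open Scope quotient_scope.

(* As C is uncountable, a finitely presented algebra has enough C-points, so a *)
(* sieve is covering for a topology finer than the Zariski topology as soon as *)
(* it is covering near every C-point.                                          *)
(*                                                                             *)
(* Stability under pullback along A -> B is the main point.  Where A and B     *)
(* have degrees n and n' = n q, the double centralizer theorem gives           *)
(* B = A (x) V with V = Z_B(A) of degree q.  If A -> A' is in L and A' has     *)
(* degree m = n r, then A' (x) V has degree m q and contains A' and B          *)
(* compatibly; when K is stable under multiplication, this is enough.          *)
(* Otherwise also write A' = A (x) U.  After an etale cover U and V become     *)
(* matrix algebras of sizes r and q, both embed in the matrices of size        *)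
(* lcm(r, q), and A (x) M_lcm(r,q) has degree lcm(m, n').  Since K is of       *)
(* finite type, only finitely many m have to be treated, on a common cover.    *)
(*                                                                             *)
(* For the etale splitting of an Azumaya algebra U near a point, let X and Z   *)
(* lift diagonal matrices of the fiber.  The operator y |-> X y + y Z has      *)
(* distinct eigenvalues on the fiber, so its characteristic polynomial chi is  *)
(* separable there, and over D[t]/(chi), localized, it has an eigenvector of   *)
(* rank one, which splits U.  The rank of U at a point is read off from the    *)
(* trace of a dual basis, since the residue characteristic is zero.            *)

(** * Covering sieves *)

(** The sieve [piK] on the center turns each axiom for [JK] into a covering statement for [J]
    together with one for [K] ([JKE]). By [centrally_coveredP], a map to a nonzero ring is centrally
    covered as soon as some [K]-covering sieve consists of represented numbers: represented numbers
    are closed under multiples, since one may tensor with matrices, and they are multiples of the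
    degree. The zero ring is covered by the empty family and causes no trouble.

    For the maximal sieve, [degree_near_point] gives a constant degree near each point. For
    transitivity ([JK_local]), finite type leaves finitely many numbers [m i], each represented by
    some algebra; the [J]-covering sieves supplied by these algebras meet in one over which
    transitivity of [K] applies. For pullback ([JK_pullback]), a member of the sieve and the given
    morphism have to be completed to a commutative square whose corner has controlled degree. Only
    here do the two alternatives differ: [rep_pullback_mul] amalgamates by a tensor product,
    [split_pullback_covering] inside matrices after an etale cover.

    The algebra rests on [azumaya_data], a dual basis with elements of the enveloping algebra that
    realize its functionals. Being equational, it passes to base changes and tensor products, and
    letting it act on an overalgebra [B] yields [B = A (x) V] with [V] the centralizer
    ([centralizer_basis], [centralizer_map]). The etale splitting is assembled in
    [free_split_covering] from [cyclic_near], [etale_root] and [cyclic_split]. *)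

Section Topologies.
Variable X : category.

Lemma sieve_ext (A : X) (S T : sieve A) :
  (forall B (f : hom A B), S B f <-> T B f) -> S = T.
Proof.
case: S T => [S cS] [T cT] /= ST.
have E : S = T by do 2![apply: functional_extensionality_dep => ?]; apply/propext.
by subst T; congr Sieve; apply: Prop_irrelevance.
Qed.

Lemma pullback_comp (A B D : X) (g : hom B D) (f : hom A B) (S : sieve A) :
  pullback (comp g f) S = pullback g (pullback f S).
Proof. by apply: sieve_ext => E h /=; rewrite compcA. Qed.

Variables (J : coverage X) (hJ : grothendieck_topology J).

Lemma covering_mem (A B : X) (S : sieve A) (f : hom A B) :
  S B f -> J (pullback f S).
Proof.
case: hJ => Jmax _ _ Sf; have -> : pullback f S = max_sieve B by
  apply: sieve_ext => D g; split=> // _; apply: sieve_closed.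
exact: Jmax.
Qed.

Lemma covering_sub (A : X) (S T : sieve A) :
  J S -> (forall B (f : hom A B), S B f -> T B f) -> J T.
Proof. by case: hJ => _ _ Jloc JS ST; apply: Jloc JS _ => B h /ST/covering_mem. Qed.

Definition meet_sieve (A : X) (S T : sieve A) : sieve A :=
  @Sieve X A (fun B f => S B f /\ T B f)
    (fun B D h f Sf => conj (sieve_closed h Sf.1) (sieve_closed h Sf.2)).

Lemma covering_meet (A : X) (S T : sieve A) : J S -> J T -> J (meet_sieve S T).
Proof.
case: (hJ) => _ Jpull Jloc JS JT; apply: (Jloc _ S) => // B h Sh.
apply: covering_sub (Jpull _ _ _ h JT) _ => D g Tg; split=> //.
exact: sieve_closed.
Qed.

Definition bigmeet_sieve (A : X) (l : nat) (S : 'I_l -> sieve A) : sieve A :=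
  @Sieve X A (fun B f => forall i, S i B f)
    (fun B D h f Sf i => sieve_closed h (Sf i)).

Lemma covering_bigmeet (A : X) (l : nat) (S : 'I_l -> sieve A) :
  (forall i, J (S i)) -> J (bigmeet_sieve S).
Proof.
elim: l S => [|l IH] S JS.
  by case: (hJ) => Jmax _ _; apply: covering_sub (Jmax A) _ => B f _ [].
apply: covering_sub (covering_meet (JS ord0) (IH _ (fun i => JS (lift ord0 i)))) _.
by move=> B f [S0 SS] i; case: (unliftP ord0 i) => [j ->|->].
Qed.

Lemma covering_loc (A : X) (S R : sieve A) : J S ->
  (forall B (h : hom A B), S B h -> J (pullback h R)) -> J R.
Proof. by case: hJ => _ _; apply. Qed.

Lemma covering_pull (A B : X) (S : sieve A) (h : hom A B) : J S -> J (pullback h S).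
Proof. by case: hJ => _ + _; apply. Qed.

End Topologies.

(** * The Nullstellensatz over an uncountable field *)

Section Ideals.
Variable R : comPzRingType.

Definition ideal_pred (I : R -> Prop) : Prop :=
  [/\ I 0, forall x y, I x -> I y -> I (x + y) & forall a x, I x -> I (a * x)].

Lemma ideal_sum (I : R -> Prop) (T : Type) (s : seq T) (P : pred T) (F : T -> R) :
  ideal_pred I -> (forall i, P i -> I (F i)) -> I (\sum_(i <- s | P i) F i).
Proof. by case=> I0 ID IM FI; elim/big_rec: _ => // i x Pi Ix; apply/ID/Ix/FI. Qed.

Lemma idealN (I : R -> Prop) x : ideal_pred I -> I x -> I (- x).
Proof. by case=> I0 ID IM Ix; rewrite -mulN1r; apply: IM. Qed.

Lemma idealB (I : R -> Prop) x y : ideal_pred I -> I x -> I y -> I (x - y).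
Proof. by move=> hI Ix Iy; case: (hI) => _ + _; apply=> //; apply: idealN. Qed.

Definition adjoin (I : R -> Prop) (d x : R) : Prop :=
  exists y a, I y /\ x = y + a * d.

Lemma adjoin_ideal I d : ideal_pred I -> ideal_pred (adjoin I d).
Proof.
case=> I0 ID IM; split; first by exists 0, 0; rewrite mul0r addr0.
- move=> _ _ [y [a [Iy ->]]] [z [b [Iz ->]]]; exists (y + z), (a + b).
  by rewrite mulrDl addrACA; split=> //; apply: ID.
- move=> c _ [y [a [Iy ->]]]; exists (c * y), (c * a).
  by rewrite mulrDr mulrA; split=> //; apply: IM.
Qed.

(** One use of Zorn's lemma for two purposes: with [S] the singleton of 1 the result is a maximal
    ideal, and for multiplicative [S] it is prime. *)
Lemma exists_maximal_avoiding (I S : R -> Prop) :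
  ideal_pred I -> (forall x, S x -> ~ I x) ->
  exists P : R -> Prop, [/\ ideal_pred P, forall x, I x -> P x,
    forall x, S x -> ~ P x &
    forall d, ~ P d -> exists x, S x /\ adjoin P d x].
Proof.
move=> hI SI.
pose good (A : set R) := [/\ ideal_pred A, forall x, I x -> A x &
  forall x, S x -> ~ A x].
(* The union of the empty chain is empty and not an ideal, so goodness is asked of inhabited sets
   only. *)
have [|A [PA Amax]] := @Zorn_bigcup R (fun A => (exists x, A x) -> good A).
  move=> F FP Ftot [x [X FX Xx]].
  have gX : good X by apply: FP => //; exists x.
  have hF Y y : F Y -> Y y -> good Y by move=> FY Yy; apply: FP => //; exists y.
  case: gX => -[X0 XD XM] XI XS; split; [split| |].
  - by exists X.
  - move=> y z [Y FY Yy] [Z FZ Zz].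
    have [[[_ YD _] _ _] [[_ ZD _] _ _]] := (hF _ _ FY Yy, hF _ _ FZ Zz).
    by case: (Ftot _ _ FY FZ) => YZ; [exists Z => //; apply: ZD => //; apply: YZ|
      exists Y => //; apply: YD => //; apply: YZ].
  - by move=> a y [Y FY Yy]; exists Y => //; have [[_ _ YM] _ _] := hF _ _ FY Yy; apply: YM.
  - by move=> y Iy; exists X => //; apply: XI.
  - by move=> y Sy [Y FY Yy]; have [_ _ YS] := hF _ _ FY Yy; apply: (YS y).
have gI : good I by [].
have neA : exists x, A x.
  apply: contrapT => nA; apply: (Amax I) => //; split=> [x Ax|IA].
    by case: nA; exists x.
  by apply: nA; exists 0; apply: IA; case: hI.
have [hA AI AS] := PA neA; exists A; split=> // d nAd.
apply: contrapT => nS; apply: (Amax (adjoin A d)).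
  split=> [x Ax|sub]; first by exists x, 0; rewrite mul0r addr0.
  by apply/nAd/sub; exists 0, 1; rewrite mul1r add0r; case: hA.
move=> _; split; first exact: adjoin_ideal.
  by move=> x /AI Ax; exists x, 0; rewrite mul0r addr0.
by move=> x Sx dx; apply: nS; exists x.
Qed.

(** If [x] and [y] lie outside the maximal [P], then [P + (x)] and [P + (y)] both meet [S]; were
    [x * y] in [P], the product of the two elements found would be in [P] too. *)
Lemma exists_prime_avoiding (I S : R -> Prop) :
  ideal_pred I -> S 1 -> (forall x y, S x -> S y -> S (x * y)) ->
  (forall x, S x -> ~ I x) ->
  exists P : R -> Prop, [/\ prime_ideal P, forall x, I x -> P x &
    forall x, S x -> ~ P x].
Proof.
move=> hI S1 SM /(exists_maximal_avoiding hI) [P [hP IP SP Pmax]]; exists P.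
have [P0 PD PM] := hP; split=> //; split=> // [|x y Pxy]; first exact: SP.
apply: contrapT => /not_orP[nx ny].
have [s [Ss [p [a [Pp es]]]]] := Pmax x nx.
have [t [St [q [b [Pq et]]]]] := Pmax y ny.
subst s t; apply: (SP _ (SM _ _ Ss St)).
rewrite mulrDl mulrDr (mulrC p q) -addrA; apply: (PD); first exact: PM.
apply: (PD); first by rewrite mulrC; apply: (PM).
rewrite mulrDr; apply: (PD); first exact: PM.
by rewrite mulrACA; apply: (PM).
Qed.

End Ideals.

(** Nested intervals: each [F n] is finite, so an interval contains a smaller closed one that misses
    it, and the supremum of the left ends lies in all of them. *)
Lemma real_uncountable (R : realType) (F : nat -> seq R) :
  exists x, forall n, x \notin F n.
Proof.
have split_ (p : R * R) (s : seq R) : p.1 < p.2 ->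
    exists q : R * R, [/\ p.1 <= q.1, q.1 < q.2, q.2 <= p.2 &
      forall x, q.1 <= x <= q.2 -> x \notin s].
  (* The points are avoided one at a time: of the disjoint intervals from [a] to [m'] and from [m]
     to [b], one misses [y]. *)
  elim: s p => [|y s IH] [a b] /= ab; first by exists (a, b); split=> /=.
  have [m /andP[am mb]] : exists m, a < m < b.
    by exists ((a + b) / 2%:R); have [-> ->] := midf_lt ab.
  have [m' /andP[am' mb']] : exists m', a < m' < m.
    by exists ((a + m) / 2%:R); have [-> ->] := midf_lt am.
  have [ym|my] := leP y m'.
    have [[c d] /= [c1 c2 c3 c4]] := IH (m, b) mb.
    exists (c, d); split=> //=; first exact: le_trans (ltW am) c1.
    move=> x xcd; rewrite in_cons negb_or c4 // andbT.
    apply/eqP => xy; move: xcd; rewrite xy => /andP[cy _].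
    by have := le_lt_trans (le_trans c1 cy) (le_lt_trans ym mb'); rewrite ltxx.
  have [[c d] /= [c1 c2 c3 c4]] := IH (a, m') am'.
  exists (c, d); split=> //=; first exact: le_trans c3 (ltW (lt_trans mb' mb)).
  move=> x xcd; rewrite in_cons negb_or c4 // andbT.
  apply/eqP => xy; move: xcd; rewrite xy => /andP[_ yd].
  by have := lt_le_trans my (le_trans yd c3); rewrite ltxx.
pose T := {p : R * R | p.1 < p.2}.
have step (n : nat) (p : T) : {q : T | [/\ (val p).1 <= (val q).1,
    (val q).2 <= (val p).2 &
    forall x, (val q).1 <= x <= (val q).2 -> x \notin F n]}.
  apply: cid; have [q [q1 q2 q3 q4]] := split_ (val p) (F n) (valP p).
  by exists (exist _ q q2).
pose t := fix t n : T := if n is n'.+1 then sval (step n' (t n'))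
  else exist _ (0, 1) ltr01.
have tS n : [/\ (val (t n)).1 <= (val (t n.+1)).1,
    (val (t n.+1)).2 <= (val (t n)).2 &
    forall x, (val (t n.+1)).1 <= x <= (val (t n.+1)).2 -> x \notin F n].
  exact: (svalP (step n (t n))).
have mono1 m n : (m <= n)%N -> (val (t m)).1 <= (val (t n)).1.
  elim: n => [|n IH]; first by rewrite leqn0 => /eqP->.
  rewrite leq_eqVlt => /orP[/eqP->//|/IH/le_trans]; apply.
  by case: (tS n).
have mono2 m n : (m <= n)%N -> (val (t n)).2 <= (val (t m)).2.
  elim: n => [|n IH]; first by rewrite leqn0 => /eqP->.
  rewrite leq_eqVlt => /orP[/eqP->//|/IH]; apply: le_trans.
  by case: (tS n).
have lt12 m n : (val (t m)).1 <= (val (t n)).2.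
  apply: le_trans (mono1 _ _ (leq_maxl m n)) _.
  by apply: le_trans (mono2 _ _ (leq_maxr m n)); apply/ltW/(valP (t _)).
pose A : set R := fun x => exists n, x = (val (t n)).1.
have supA : has_sup A.
  split; first by exists (val (t 0%N)).1, 0%N.
  by exists (val (t 0%N)).2 => _ [n ->].
exists (sup A) => n; case: (tS n) => _ _; apply; apply/andP; split.
  by apply: ub_le_sup; [case: supA | exists n.+1].
by apply: ge_sup; [case: supA | move=> _ [m ->]].
Qed.

Lemma complex_uncountable (R : realType) (F : nat -> seq R[i]) :
  exists x, forall n, x \notin F n.
Proof.
have [x xF] := real_uncountable (fun n => [seq complex.Re z | z <- F n]).
exists (x%:C)%C => n; apply: contra (xF n) => xn.
by apply/mapP; exists (x%:C)%C.
Qed.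

Lemma exists_rmorphism (A B : pzRingType) (f : A -> B) :
  f 1 = 1 -> {morph f : x y / x + y} -> {morph f : x y / x * y} ->
  exists g : {rmorphism A -> B}, forall x, g x = f x.
Proof.
move=> f1 fD fM.
have fB : zmod_morphism f by move=> x y; apply: (addIr (f y)); rewrite -fD !subrK.
pose ia := GRing.isZmodMorphism.Build A B f fB.
pose im := GRing.isMonoidMorphism.Build A B f (conj f1 fM).
pose g : {rmorphism A -> B} := HB.pack f ia im.
by exists g.
Qed.

(* A polynomial is evaluated in a ring that may vanish, which horner_morph     *)
(* does not allow.                                                             *)
Section Evaluation.
Variables (D : comNzRingType) (S : comPzRingType) (u : {rmorphism D -> S}) (s : S).

Definition peval (p : {poly D}) : S := \sum_(i < size p) u p`_i * s ^+ i.

Lemma peval_widen n (p : {poly D}) : (size p <= n)%N -> peval p = \sum_(i < n) u p`_i * s ^+ i.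
Proof.
move=> pn; rewrite /peval (big_ord_widen n (fun i => u p`_i * s ^+ i)) // big_mkcond.
apply: eq_bigr => i _; case: ltnP => // /leq_sizeP -> //.
by rewrite rmorph0 mul0r.
Qed.

Lemma pevalD : {morph peval : p q / p + q}.
Proof.
move=> p q; pose n := maxn (size p) (size q).
rewrite !(@peval_widen n) ?leq_maxl ?leq_maxr ?size_polyD // -big_split /=.
by apply: eq_bigr => i _; rewrite coefD rmorphD mulrDl.
Qed.

Lemma pevalC c : peval c%:P = u c.
Proof. by rewrite (@peval_widen 1) ?size_polyC_leq1 // big_ord1 coefC mulr1. Qed.

Lemma pevalMX p : peval (p * 'X) = peval p * s.
Proof.
rewrite (@peval_widen (size p).+1); last first.
  by have [->|/size_mulX->//] := eqVneq p 0; rewrite mul0r size_poly0.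
rewrite big_ord_recl coefMX rmorph0 mul0r add0r mulr_suml.
by apply: eq_bigr => i _; rewrite coefMX /= -mulrA -exprSr.
Qed.

Lemma pevalCM c p : peval (c%:P * p) = u c * peval p.
Proof.
rewrite (@peval_widen (size p)); last by rewrite mul_polyC size_scale_leq.
by rewrite mulr_sumr; apply: eq_bigr => i _; rewrite coefCM rmorphM mulrA.
Qed.

Lemma pevalM : {morph peval : p q / p * q}.
Proof.
move=> p q; elim/poly_ind: p => [|p c IH].
  by rewrite mul0r /peval size_poly0 big_ord0 mul0r.
by rewrite mulrDl !pevalD mulrAC !pevalMX pevalCM pevalC IH mulrDl mulrAC.
Qed.

Lemma peval_zmod : zmod_morphism peval.
Proof. by move=> p q; apply: (addIr (peval q)); rewrite -pevalD !subrK. Qed.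

Lemma peval_monoid : monoid_morphism peval.
Proof. by split=> [|p q]; [rewrite pevalC rmorph1 | apply: pevalM]. Qed.

HB.instance Definition _ := GRing.isZmodMorphism.Build {poly D} S peval peval_zmod.
HB.instance Definition _ := GRing.isMonoidMorphism.Build {poly D} S peval peval_monoid.

Lemma pevalX : peval 'X = s.
Proof. by rewrite -['X]mul1r pevalMX rmorph1 mul1r. Qed.

Lemma peval_unique (g : {rmorphism {poly D} -> S}) :
  (forall c, g c%:P = u c) -> g 'X = s -> forall p, g p = peval p.
Proof.
move=> gC gX; elim/poly_ind => [|p c IH]; first by rewrite !rmorph0.
by rewrite pevalD pevalMX pevalC rmorphD rmorphM gX gC IH.
Qed.

End Evaluation.

(** Objects of [commalg] may vanish, whereas polynomials are formed over nontrivial rings. An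
    equality of structures, not an isomorphism, lets dependent data be transported. *)
Lemma comNzRing_of (C : comPzRingType) : (1 : C) != 0 ->
  exists C' : comNzRingType, (C' : comPzRingType) = C.
Proof.
case: C => T c C1; pose C := GRing.ComPzRing.Pack c.
pose C' : comNzRingType := HB.pack T (GRing.PzSemiRing_isNonZero.Build C C1) c.
by exists C'.
Qed.

(** * Quotients of commutative rings by ideals *)

Section Quotient.
Variables (R : comPzRingType) (I : R -> Prop) (hI : ideal_pred I).

Definition quot_rel (x y : R) : bool := `[<I (x - y)>].

Lemma quot_rel_equiv : equiv_class_of quot_rel.
Proof.
have I0 : I 0 by case: hI.
split=> [x|x y|y x z]; first by apply/asboolP; rewrite subrr.
- by apply/asboolP/asboolP => /(idealN hI); rewrite opprB.
- move=> /asboolP xy /asboolP yz; apply/asboolP.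
  have -> : x - z = (x - y) + (y - z) by rewrite addrA subrK.
  by case: hI => _ ID _; apply: ID.
Qed.

Canonical quot_equiv := EquivRelPack quot_rel_equiv.
Definition quot := {eq_quot quot_equiv}.
HB.instance Definition _ := Choice.on quot.
HB.instance Definition _ := EqQuotient.on quot.

Definition toquot (x : R) : quot := \pi_quot x.

Lemma toquot_eq x y : toquot x = toquot y <-> I (x - y).
Proof. by split=> [/eqmodP/asboolP|?]; last exact/eqmodP/asboolP. Qed.

Lemma toquot_repr (x : quot) : toquot (repr x) = x.
Proof. exact: reprK. Qed.

Lemma repr_toquot x : I (repr (toquot x) - x).
Proof. by apply/toquot_eq; rewrite toquot_repr. Qed.

Definition qadd (x y : quot) := toquot (repr x + repr y).
Definition qopp (x : quot) := toquot (- repr x).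
Definition qmul (x y : quot) := toquot (repr x * repr y).

Lemma qaddE x y : qadd (toquot x) (toquot y) = toquot (x + y).
Proof.
by apply/toquot_eq; rewrite opprD addrACA; case: (hI) => _ + _; apply; apply: repr_toquot.
Qed.

Lemma qoppE x : qopp (toquot x) = toquot (- x).
Proof. by apply/toquot_eq; rewrite -opprD; apply/(idealN hI)/repr_toquot. Qed.

Lemma qmulE x y : qmul (toquot x) (toquot y) = toquot (x * y).
Proof.
apply/toquot_eq; set x' := repr _; set y' := repr _.
have -> : x' * y' - x * y = y' * (x' - x) + x * (y' - y).
  by rewrite !mulrBr [y' * x']mulrC [y' * x]mulrC addrA subrK.
by case: (hI) => _ ID IM; apply: ID; apply: IM; apply: repr_toquot.
Qed.

Lemma quot_ind (P : quot -> Prop) : (forall x, P (toquot x)) -> forall x, P x.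
Proof. by move=> h x; rewrite -(toquot_repr x). Qed.

Lemma qaddA : associative qadd.
Proof. by do 3![elim/quot_ind => ?]; rewrite !qaddE addrA. Qed.
Lemma qaddC : commutative qadd.
Proof. by do 2![elim/quot_ind => ?]; rewrite !qaddE addrC. Qed.
Lemma qadd0 : left_id (toquot 0) qadd.
Proof. by elim/quot_ind => ?; rewrite qaddE add0r. Qed.
Lemma qaddN : left_inverse (toquot 0) qopp qadd.
Proof. by elim/quot_ind => ?; rewrite qoppE qaddE addNr. Qed.
HB.instance Definition _ := GRing.isZmodule.Build quot qaddA qaddC qadd0 qaddN.

Lemma qmulA : associative qmul.
Proof. by do 3![elim/quot_ind => ?]; rewrite !qmulE mulrA. Qed.
Lemma qmulC : commutative qmul.
Proof. by do 2![elim/quot_ind => ?]; rewrite !qmulE mulrC. Qed.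
Lemma qmul1 : left_id (toquot 1) qmul.
Proof. by elim/quot_ind => ?; rewrite qmulE mul1r. Qed.
Lemma qmulD : left_distributive qmul qadd.
Proof. by do 3![elim/quot_ind => ?]; rewrite !(qaddE, qmulE) mulrDl. Qed.
HB.instance Definition _ := GRing.Zmodule_isComPzRing.Build quot qmulA qmulC qmul1 qmulD.

Lemma toquot_zmod : zmod_morphism toquot.
Proof. by move=> x y; rewrite -qaddE -qoppE. Qed.
Lemma toquot_monoid : monoid_morphism toquot.
Proof. by split=> // x y; rewrite -qmulE. Qed.
HB.instance Definition _ := GRing.isZmodMorphism.Build R quot toquot toquot_zmod.
HB.instance Definition _ := GRing.isMonoidMorphism.Build R quot toquot toquot_monoid.

Lemma toquot_eq0 x : toquot x = 0 <-> I x.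
Proof. by rewrite -(rmorph0 toquot) toquot_eq subr0. Qed.

Lemma toquot_surj (x : quot) : exists y, toquot y = x.
Proof. by exists (repr x); apply: toquot_repr. Qed.

Lemma quot_factor (S : pzRingType) (g : {rmorphism R -> S}) :
  (forall x, I x -> g x = 0) ->
  exists h : {rmorphism quot -> S}, forall x, h (toquot x) = g x.
Proof.
move=> gI.
have gE x : g (repr (toquot x)) = g x.
  by apply/eqP; rewrite -subr_eq0 -rmorphB; apply/eqP/gI/repr_toquot.
have [|||h hE] := @exists_rmorphism quot S (g \o repr).
- by rewrite /= gE rmorph1.
- by do 2![elim/quot_ind => ?]; rewrite /= -rmorphD !gE rmorphD.
- by do 2![elim/quot_ind => ?]; rewrite /= -rmorphM !gE rmorphM.
by exists h => x; rewrite hE /= gE.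
Qed.

End Quotient.

Lemma linear_dependence (k : fieldType) (m n : nat) (A : 'M[k]_(m, n)) :
  (n < m)%N -> exists2 c : 'rV[k]_m, c != 0 & c *m A = 0.
Proof.
move=> nm; exists (nz_row (kermx A)); last first.
  by apply/eqP; have := nz_row_sub (kermx A); rewrite sub_kermx.
rewrite nz_row_eq0 -mxrank_eq0 mxrank_ker subn_eq0 -ltnNge.
exact: leq_ltn_trans (rank_leq_col A) nm.
Qed.

Lemma finite_of_bounded_uniq (T : eqType) (Q : T -> Prop) (M : nat) :
  (forall s, uniq s -> (forall x, x \in s -> Q x) -> (size s <= M)%N) ->
  exists s : seq T, forall x, Q x -> x \in s.
Proof.
move=> bnd.
pose P m := `[< exists s, [/\ uniq s, forall x, x \in s -> Q x & size s = m] >].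
have exP : exists m, P m by exists 0%N; apply/asboolP; exists [::].
have ubP m : P m -> (m <= M)%N by move=> /asboolP[s [us sQ <-]]; apply: bnd.
case: (ex_maxnP exP ubP) => m /asboolP[s [us sQ sm]] mmax; exists s => x Qx.
apply: contraT => xs; have /mmax : P m.+1.
  apply/asboolP; exists (x :: s); split=> [|y|/=]; rewrite ?sm //=; first by rewrite xs.
  by rewrite in_cons => /orP[/eqP->|/sQ].
by rewrite ltnn.
Qed.

Section Nullstellensatz.
Variable k : numClosedFieldType.
Hypothesis k_uncountable : forall F : nat -> seq k, exists x, forall n, x \notin F n.

Section Dependence.
Variables (C : comPzRingType) (s : {rmorphism k -> C}) (P : C -> Prop).
Hypotheses (hP : ideal_pred P) (P1 : ~ P 1).
Hypothesis Pinv : forall d, ~ P d -> exists a, P (a * d - 1).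

Lemma maximal_scalar_eq0 a : P (s a) -> a = 0.
Proof.
move=> Pa; apply: contrapT => /eqP a0; apply: P1.
by rewrite -(rmorph1 s) -(mulVf a0) rmorphM; case: hP => _ _; apply.
Qed.

Lemma maximal_mul x y : P (x * y) -> P x \/ P y.
Proof.
have [P0 PD PM] := hP => Pxy; have [|/Pinv[a Pa]] := pselect (P x); [by left|right].
have -> : y = a * (x * y) - y * (a * x - 1).
  by rewrite mulrBr mulr1 mulrA [a * x * y]mulrC subKr.
by apply: idealB => //; apply: (PM).
Qed.

Lemma maximal_prod (I : eqType) (r : seq I) (F : I -> C) :
  P (\prod_(i <- r) F i) -> exists2 i, i \in r & P (F i).
Proof.
elim: r => [|i r IH]; first by rewrite big_nil.
rewrite big_cons => /maximal_mul[Pi|/IH[j jr Pj]].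
  by exists i; rewrite ?mem_head.
by exists j; rewrite // in_cons jr orbT.
Qed.

Lemma maximal_root (q : {poly k}) (t : C) :
  q != 0 -> P (peval s t q) -> exists x, P (t - s x).
Proof.
move=> q0; have [r ->] := closed_field_poly_normal q.
rewrite -mul_polyC pevalCM => /maximal_mul[/maximal_scalar_eq0/eqP|].
  by rewrite lead_coef_eq0 (negbTE q0).
rewrite rmorph_prod => /maximal_prod[x _]; rewrite rmorphB /= pevalX pevalC.
by exists x.
Qed.

(* A linear relation among the inverses of the [t - x] is an algebraic         *)
(* equation for [t].                                                           *)
Lemma maximal_dependent_inverses (m : nat) (x : 'I_m -> k) (h : 'I_m -> C)
    (c : 'I_m -> k) (t : C) (i0 : 'I_m) :
  injective x -> (forall i, P (h i * (t - s (x i)) - 1)) ->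
  \sum_i s (c i) * h i = 0 -> c i0 != 0 -> exists x, P (t - s x).
Proof.
move=> xinj hP1 sum0 ci0; have [P0 PD PM] := hP.
pose q : {poly k} := \sum_i (c i)%:P * \prod_(j | j != i) ('X - (x j)%:P).
apply: (@maximal_root q).
  apply: contraNneq ci0 => q0; have : q.[x i0] = 0 by rewrite q0 horner0.
  rewrite horner_sum (bigD1 i0) //= [X in _ + X]big1 => [|i ii0]; last first.
    rewrite hornerM (bigD1 i0) 1?eq_sym //= hornerM hornerXsubC subrr.
    by rewrite mul0r mulr0.
  rewrite addr0 hornerM hornerC horner_prod => /eqP; rewrite mulf_eq0.
  case/orP=> // /prodf_eq0[j ji0]; rewrite hornerXsubC subr_eq0.
  by move=> /eqP/xinj i0j; rewrite i0j eqxx in ji0.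
have E : \sum_i s (c i) * h i * \prod_j (t - s (x j)) = 0.
  by rewrite -mulr_suml sum0 mul0r.
rewrite -[peval _ _ _]subr0 -[X in _ - X]E rmorph_sum -sumrB.
apply: ideal_sum => // i _; rewrite rmorphM /= pevalC rmorph_prod.
rewrite (bigD1 i (F := fun j => t - s (x j))) //=.
under eq_bigr => j _ do rewrite rmorphB /= pevalX pevalC.
rewrite mulrA -mulrBl mulrC; apply: (PM).
rewrite -{1}[s _]mulr1 -mulrA -mulrBr; apply: (PM).
by rewrite -opprB; apply: idealN.
Qed.

End Dependence.

(** Amitsur's argument. Let [P] be a maximal ideal over [I]. If [t] is congruent to no scalar, every
    [t - x] is invertible modulo [P]. These inverses are indexed by the uncountable [k], while [C]
    is a countable union of finite-dimensional subspaces, the images of polynomials of bounded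
    degree. So some of the inverses are linearly dependent, and [maximal_dependent_inverses] makes
    [t] congruent to a scalar after all. *)
Lemma nullstellensatz (C : commalg k) (I : C -> Prop) :
  ideal_pred I -> ~ I 1 ->
  exists e : {rmorphism C -> k},
    (forall a, e (commalg_scalar C a) = a) /\ forall x, I x -> e x = 0.
Proof.
move=> hI nI1; set s := commalg_scalar C.
have [|P [hP IP P1 Pmax]] := @exists_maximal_avoiding C I (eq 1) hI.
  by move=> _ <-.
have {}P1 : ~ P 1 by apply: P1.
have [P0 PD PM] := hP.
have Pinv d : ~ P d -> exists a, P (a * d - 1).
  move=> /Pmax[_ [<- [y [a [Py E]]]]]; exists a.
  by rewrite E opprD addrCA subrr addr0; apply: idealN.
have [n [p [ps psurj _]]] := commalg_fp C.
have key t : exists x, P (t - s x).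
  apply: contrapT => nt.
  have /choice[h hP1] x : exists h, P (p h * (t - s x) - 1).
    have [|a Pa] := Pinv (t - s x); first by move=> Px; apply: nt; exists x.
    by have [h E] := psurj a; exists h; rewrite E.
  pose Q N x := (msize (h x) <= N)%N.
  (* More scalars in [Q N] than there are monomials of degree below [N] would force a linear
     relation, so each [Q N] is finite. *)
  have /choice[F FP] N : exists r : seq k, forall x, Q N x -> x \in r.
    apply: (@finite_of_bounded_uniq _ _ #|{: 'X_{1..n < N}}|) => r ur rQ.
    rewrite leqNgt; apply/negP => big_r; apply: nt.
    pose x (i : 'I_(size r)) := r`_i.
    pose A : 'M[k]_(size r, #|{: 'X_{1..n < N}}|) :=
      \matrix_(i, j) (h (x i))@_(enum_val j : 'X_{1..n < N}).
    have [c c0 cA] := linear_dependence A big_r.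
    have [i0 ci0] : exists i, c 0 i != 0.
      by move/rV0Pn: c0.
    apply: (@maximal_dependent_inverses C s P hP P1 Pinv (size r) x
      (fun i => p (h (x i))) (c 0) t i0) => //.
      by move=> i j /eqP; rewrite nth_uniq // => /eqP/val_inj.
    suff H : \sum_i c 0 i *: h (x i) = 0.
      transitivity (p (\sum_i c 0 i *: h (x i))); last by rewrite H rmorph0.
      by rewrite rmorph_sum; apply: eq_bigr => i _; rewrite -mul_mpolyC rmorphM /= ps.
    apply/mpolyP => m; rewrite mcoeff0 raddf_sum /=.
    have [mN|Nm] := ltnP (mdeg m) N; last first.
      rewrite big1 // => i _; rewrite mcoeffZ memN_msupp_eq0 ?mulr0 //.
      apply: contraL Nm => /msize_mdeg_lt mlt; rewrite -ltnNge.
      by apply: leq_trans mlt (rQ _ _); apply: mem_nth.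
    have := congr1 (fun B : 'rV_ _ => B 0 (enum_rank (BMultinom mN))) cA.
    rewrite !mxE => E; rewrite -[RHS]E; apply: eq_bigr => i _.
    by rewrite !mxE enum_rankK mcoeffZ.
  have [x xF] := k_uncountable F.
  by have := xF (msize (h x)); rewrite FP // /Q.
(* The scalar congruent to [t] is unique; this alone makes [e] a ring map fixing the scalars. *)
have uniq_ x y t : P (t - s x) -> P (t - s y) -> x = y.
  move=> Px Py; apply/eqP; rewrite -subr_eq0; apply/eqP.
  apply: (maximal_scalar_eq0 (s := s) hP P1); rewrite rmorphB.
  have -> : s x - s y = (t - s y) - (t - s x).
    by rewrite opprB [RHS]addrC addrA subrK.
  exact: idealB.
have [e eP] := choice key.
have [|x y|x y|e' e'E] := @exists_rmorphism C k e.
- by apply: (uniq_ _ _ 1) => //; rewrite rmorph1 subrr.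
- apply: (uniq_ _ _ (x + y)) => //; rewrite rmorphD opprD addrACA.
  exact: PD.
- apply: (uniq_ _ _ (x * y)) => //; rewrite rmorphM.
  have -> : x * y - s (e x) * s (e y) = y * (x - s (e x)) + s (e x) * (y - s (e y)).
    by rewrite !mulrBr addrA [y * s _]mulrC subrK [y * x]mulrC.
  by apply: (PD); apply: (PM).
exists e'; split=> [a|x Ix]; rewrite e'E.
  by apply: (uniq_ _ _ (s a)) => //; rewrite subrr.
by apply: (uniq_ _ _ x) => //; rewrite rmorph0 subr0; apply: IP.
Qed.

End Nullstellensatz.

(** * Quotients of polynomial rings, localization and etale maps *)

Lemma mpoly_rmorph_ext (k : comNzRingType) (n : nat) (S : pzRingType)
    (f g : {rmorphism {mpoly k[n]} -> S}) :
  (forall a, f a%:MP = g a%:MP) -> (forall i, f 'X_i = g 'X_i) -> f =1 g.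
Proof.
move=> fgC fgX p; rewrite [p]mpolyE !rmorph_sum; apply: eq_bigr => m _.
rewrite -mul_mpolyC !rmorphM fgC; congr (_ * _).
rewrite mpolyXE_id; elim/big_rec: _ => [|i x _ IH]; first by rewrite !rmorph1.
by rewrite !rmorphM IH !rmorphXn fgX.
Qed.

Section MpolyPoly.
Variables (k : comNzRingType) (n : nat).

Definition mpoly_poly : {mpoly k[n.+1]} -> {poly {mpoly k[n]}} :=
  mmap (polyC \o @mpolyC n k)
    (fun i => if unlift ord_max i is Some j then ('X_j)%:P else 'X).

HB.instance Definition _ := GRing.RMorphism.on mpoly_poly.

Definition poly_mpoly : {poly {mpoly k[n]}} -> {mpoly k[n.+1]} :=
  peval (mmap (@mpolyC n.+1 k) (fun j => 'X_(lift ord_max j))) 'X_ord_max.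

HB.instance Definition _ := GRing.RMorphism.on poly_mpoly.

Lemma mpoly_polyM : {morph mpoly_poly : x y / x * y}.
Proof. exact: (rmorphM mpoly_poly). Qed.

Lemma mpoly_polyK : cancel mpoly_poly poly_mpoly.
Proof.
apply: (@mpoly_rmorph_ext k n.+1 _ (poly_mpoly \o mpoly_poly) idfun) => [a|i] /=.
  by rewrite /mpoly_poly mmapC /= /poly_mpoly pevalC /= mmapC.
rewrite /mpoly_poly mmapX mmap1U /poly_mpoly.
by case: unliftP => [j ->|->]; rewrite ?pevalC ?pevalX //= mmapX mmap1U.
Qed.

Lemma poly_mpolyK : cancel poly_mpoly mpoly_poly.
Proof.
have EC x : mpoly_poly (poly_mpoly x%:P) = x%:P.
  apply: (@mpoly_rmorph_ext k n _ (mpoly_poly \o poly_mpoly \o polyC) polyC) => [a|i] /=.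
    by rewrite /poly_mpoly pevalC /= mmapC /mpoly_poly mmapC.
  by rewrite /poly_mpoly pevalC /= mmapX mmap1U /mpoly_poly mmapX mmap1U liftK.
elim/poly_ind => [|p c IH]; first by rewrite !rmorph0.
rewrite -[LHS]/((mpoly_poly \o poly_mpoly) _) rmorphD rmorphM /= EC IH.
by rewrite /poly_mpoly pevalX /mpoly_poly mmapX mmap1U unlift_none.
Qed.

End MpolyPoly.

Section PrincipalQuotient.
Variables (D : comNzRingType) (h : {poly D}).

Definition princ (x : {poly D}) : Prop := exists q, x = q * h.

Lemma princ_ideal : ideal_pred princ.
Proof.
split; first by exists 0; rewrite mul0r.
- by move=> _ _ [p ->] [q ->]; exists (p + q); rewrite mulrDl.
- by move=> a _ [q ->]; exists (a * q); rewrite mulrA.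
Qed.

(** Localizations ([h = c * X - 1]) and standard etale covers ([h] monic, with derivative invertible
    modulo [h]) are both of this form, so [pquot_fp] serves for both. *)
Definition pquot : comPzRingType := quot princ_ideal.
Definition to_pquot : {rmorphism {poly D} -> pquot} := toquot princ_ideal.
Definition pquotC : {rmorphism D -> pquot} := to_pquot \o polyC.

Lemma to_pquot_eq0 x : to_pquot x = 0 <-> princ x.
Proof. exact: toquot_eq0. Qed.

Lemma to_pquot_surj y : exists x, to_pquot x = y.
Proof. exact: toquot_surj. Qed.

Lemma pquot_map (S : comPzRingType) (u : {rmorphism D -> S}) (s : S) :
  peval u s h = 0 ->
  exists w : {rmorphism pquot -> S}, forall p, w (to_pquot p) = peval u s p.
Proof.
by move=> hs; apply: quot_factor => _ [q ->]; rewrite /= pevalM hs mulr0.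
Qed.

Lemma pquot_unique (S : comPzRingType) (w w' : {rmorphism pquot -> S}) :
  (forall c, w (pquotC c) = w' (pquotC c)) -> w (to_pquot 'X) = w' (to_pquot 'X) ->
  w =1 w'.
Proof.
move=> EC EX y; have [p <-] := to_pquot_surj y.
have Ew := @peval_unique D S (w \o pquotC) (w (to_pquot 'X)) (w \o to_pquot)
  (fun _ => erefl) erefl p.
have Ew' := @peval_unique D S (w \o pquotC) (w (to_pquot 'X)) (w' \o to_pquot)
  (fun c => esym (EC c)) (esym EX) p.
exact: etrans Ew (esym Ew').
Qed.

Lemma pquot_fp (k : fieldType) (s : {rmorphism k -> D}) :
  finitely_presented s -> finitely_presented (pquotC \o s).
Proof.
move=> [n [p [ps psurj [m [g gP]]]]].
have lift_poly (f : {poly D}) : exists F, map_poly p F = f.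
  have [r rP] := choice psurj; exists (\poly_(i < size f) r f`_i).
  apply/polyP => i; rewrite coef_map coef_poly.
  case: ltnP => [_|fi]; first exact: rP.
  by rewrite nth_default // raddf0.
have [H Hh] := lift_poly h.
exists n.+1, (to_pquot \o (map_poly p \o @mpoly_poly _ _)); split=> [a|y|].
- by rewrite /= /mpoly_poly mmapC /= map_polyC /= ps.
- have [f <-] := to_pquot_surj y; have [F <-] := lift_poly f.
  by exists (poly_mpoly F); rewrite /= poly_mpolyK.
(* The relations are a lift of [h] and the old relations [g], seen as constant polynomials. *)
exists m.+1, (fun i => if unlift ord0 i is Some j then poly_mpoly (g j)%:P
  else poly_mpoly H) => x; split.
  move=> /to_pquot_eq0[q] /= E; have [Q Qq] := lift_poly q.
  (* This difference maps to the zero polynomial over [D], so all its coefficients lie in the kernel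
     of [p]. *)
  set y := mpoly_poly x - Q * H.
  have /choice[r rP] i : exists r : 'I_m -> {mpoly k[n]}, y`_i = \sum_j r j * g j.
    apply/gP; have <- : (map_poly p y)`_i = p y`_i by rewrite coef_map.
    by rewrite rmorphB rmorphM /= E Qq Hh subrr coef0.
  exists (fun i => if unlift ord0 i is Some j
    then poly_mpoly (\poly_(l < size y) r l j) else poly_mpoly Q).
  rewrite big_ord_recl unlift_none /=; under eq_bigr => i _ do rewrite liftK.
  apply: (can_inj (@mpoly_polyK _ _)); rewrite rmorphD rmorph_sum /= mpoly_polyM !poly_mpolyK.
  under eq_bigr => i _ do rewrite mpoly_polyM !poly_mpolyK.
  apply/eqP; rewrite addrC -subr_eq -/y; apply/eqP/polyP => l.
  rewrite coef_sum; under eq_bigr => i _ do rewrite coefMC coef_poly.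
  case: ltnP => ly; first exact: rP.
  by rewrite nth_default // big1 // => i _; rewrite mul0r.
move=> [r ->]; apply/to_pquot_eq0; rewrite !rmorph_sum /= big_ord_recl unlift_none.
rewrite mpoly_polyM poly_mpolyK rmorphM /= Hh.
rewrite big1 ?addr0; first by exists (map_poly p (mpoly_poly (r ord0))).
move=> i _; rewrite liftK mpoly_polyM poly_mpolyK rmorphM /= map_polyC /=.
have -> : p (g i) = 0.
  apply/gP; exists (fun j => (j == i)%:R); rewrite (bigD1 i) //= eqxx mul1r.
  by rewrite big1 ?addr0 // => j /negbTE->; rewrite mul0r.
by rewrite polyC0 mulr0.
Qed.

End PrincipalQuotient.

Section Localization.
Variables (D : comNzRingType) (c : D).

Lemma pquot_localization :
  localization_away (pquotC (c%:P * 'X - 1)) c.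
Proof.
set h := _ - 1; pose q := to_pquot h; pose x := q 'X.
have xc : x * pquotC h c = 1.
  apply/eqP; rewrite -subr_eq0 -(rmorph1 q) -rmorphM -rmorphB; apply/eqP.
  by apply/to_pquot_eq0; exists 1; rewrite mul1r mulrC.
split; first by exists x.
- move=> y; have [p <-] := to_pquot_surj y; elim/poly_ind: p => [|p a [b [n E]]].
    by exists 0, 0%N; rewrite !rmorph0 mul0r.
  exists (b + a * c ^+ n.+1), n.+1.
  rewrite !rmorphD !rmorphM rmorphXn /= mulrDl; congr (_ + _).
  by rewrite -/x exprSr mulrACA xc mulr1 E.
(* If [a = p * (c * X - 1)], comparing coefficients gives [p_i = - c^i a], which vanishes beyond the
   degree of [p]. *)
- move=> a /to_pquot_eq0[p] E.
  have p0 : p`_0 = - a.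
    have := congr1 (fun f : {poly D} => f`_0) E.
    by rewrite mulrBr mulr1 mulrA coefB coefMX coefC /= sub0r => ->; rewrite opprK.
  have pS i : p`_i.+1 = c * p`_i.
    have := congr1 (fun f : {poly D} => f`_i.+1) E.
    rewrite mulrBr mulr1 mulrA coefB coefMX coefC coefMC /= => /esym/eqP.
    by rewrite subr_eq0 mulrC => /eqP.
  have pE i : p`_i = - (c ^+ i * a).
    by elim: i => [|i IH]; rewrite ?p0 ?mul1r // pS IH exprS mulrN mulrA.
  exists (size p); apply/eqP; rewrite -oppr_eq0 -pE.
  by rewrite nth_default.
Qed.

End Localization.

(** A fraction [a / c^n] must go to [e a / e c^n]. The relation [Q] says so without choosing a
    fraction, and is single-valued because [e c] is invertible. *)
Lemma localization_extend (D L : comPzRingType) (l : {rmorphism D -> L}) (c : D)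
    (F : fieldType) (e : {rmorphism D -> F}) :
  localization_away l c -> e c != 0 ->
  exists e' : {rmorphism L -> F}, forall d, e' (l d) = e d.
Proof.
move=> [_ lfrac lker] ec0.
have ecn n : e c ^+ n != 0 by rewrite expf_neq0.
pose Q d y := exists (a : D) (n : nat), d * l c ^+ n = l a /\ y * e c ^+ n = e a.
have exQ d : exists y, Q d y.
  have [a [n E]] := lfrac d; exists (e a / e c ^+ n), a, n.
  by rewrite divfK.
have Qeq d y y' : Q d y -> Q d y' -> y = y'.
  move=> [a [n [E Ey]]] [b [m [E' Ey']]].
  have : l (a * c ^+ m - b * c ^+ n) = 0.
    by rewrite rmorphB !rmorphM -E -E' !rmorphXn mulrAC subrr.
  move=> /lker[p] /(congr1 e); rewrite rmorph0 rmorphM rmorphXn => /eqP.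
  rewrite mulf_eq0 (negbTE (ecn p)) /= rmorphB !rmorphM !rmorphXn -Ey -Ey' subr_eq0.
  by rewrite mulrAC => /eqP/(mulIf (ecn n))/(mulIf (ecn m)).
have [e' e'Q] := choice exQ.
have [|x y|x y|g gE] := @exists_rmorphism L F e'.
- by apply: (Qeq 1) => //; exists 1, 0%N; rewrite !rmorph1 !mulr1.
- apply: (Qeq (x + y)) => //.
  have [a [n [E Ey]]] := e'Q x; have [b [m [E' Ey']]] := e'Q y.
  exists (a * c ^+ m + b * c ^+ n), (n + m)%N.
  rewrite !rmorphD !rmorphM !rmorphXn -E -E' -Ey -Ey' !mulrDl !exprD !mulrA.
  by split; congr (_ + _); rewrite mulrAC.
- apply: (Qeq (x * y)) => //.
  have [a [n [E Ey]]] := e'Q x; have [b [m [E' Ey']]] := e'Q y.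
  exists (a * b), (n + m)%N.
  by rewrite !rmorphM -E -E' -Ey -Ey' !exprD; split; rewrite mulrACA.
exists g => d; rewrite gE; apply: (Qeq (l d)) => //.
by exists d, 0%N; rewrite !mulr1.
Qed.

(** Shrinking twice is one localization of the original ring: with [d = a / c^n], inverting [c] and
    then [d] amounts to inverting [c * a]. *)
Lemma localization_trans (D L M : comPzRingType) (l : {rmorphism D -> L})
    (m : {rmorphism L -> M}) (c a : D) (d : L) (n : nat) :
  localization_away l c -> localization_away m d -> d * l c ^+ n = l a ->
  localization_away (m \o l) (c * a).
Proof.
move=> [[u uc] lfrac lker] [[v vd] mfrac mker] dE.
have muc : m u * m (l c) = 1 by rewrite -rmorphM uc rmorph1.
have laE : m (l a) = m d * m (l c) ^+ n by rewrite -dE rmorphM rmorphXn.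
split.
- exists (m u ^+ n.+1 * v); rewrite /= !rmorphM /= laE.
  transitivity ((m u * m (l c)) ^+ n.+1 * (v * m d)); last first.
    by rewrite muc vd expr1n mulr1.
  by rewrite exprMn !exprS; ring.
- move=> y; have [x [i E]] := mfrac y; have [b [j E']] := lfrac x.
  exists (b * c ^+ (i + n * i) * a ^+ j), (i + j)%N.
  rewrite /= !rmorphM !rmorphXn /= -E' !rmorphM !rmorphXn /= laE -E.
  rewrite !exprMn !exprD exprM; set X := m d; set Y := m (l c); rewrite -!exprM.
  by ring.
- move=> x /= /mker[i E].
  have : l (a ^+ i * x) = 0.
    by rewrite rmorphM rmorphXn -dE exprMn mulrAC E mul0r.
  move=> /lker[j E']; exists (i + j)%N.
  have -> : (c * a) ^+ (i + j) * x = c ^+ i * a ^+ j * (c ^+ j * (a ^+ i * x)).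
    by rewrite exprMn !exprD; ring.
  by rewrite E' mulr0.
Qed.

Section MonicQuotient.
Variables (D : comNzRingType) (h : {poly D}).

(** Newton's method: across a square-zero extension a single correction by [- h(t0) / h'(t0)] makes
    an approximate root exact, and two roots with the same image differ by an element that the unit
    [h'(t)] kills. *)
Lemma pquot_formally_etale (a b : {poly D}) :
  a * h^`() + b * h = 1 -> formally_etale (pquotC h).
Proof.
move=> ab E E' p u v psurj psq puv.
have [t0 pt0] := psurj (v (to_pquot h 'X)).
have pev q t : p t = v (to_pquot h 'X) -> p (peval u t q) = v (to_pquot h q).
  move=> pt; rewrite /peval rmorph_sum.
  rewrite -[v _]/((v \o to_pquot h) q).
  rewrite (@peval_unique D E' (v \o pquotC h) (v (to_pquot h 'X))) //.
  by apply: eq_bigr => i _; rewrite rmorphM rmorphXn puv pt.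
have h0 : to_pquot h h = 0 by apply/to_pquot_eq0; exists 1; rewrite mul1r.
have taylor t n q : n * n = 0 -> peval u (t + n) q = peval u t q + peval u t q^`() * n.
  move=> nn; elim/poly_ind: q => [|q c IH].
    by rewrite deriv0 !rmorph0 mul0r addr0.
  rewrite derivMXaddC !pevalD !pevalMX !pevalC IH.
  set A := peval u t q; set B := peval u t q^`().
  transitivity (A * t + u c + (A + B * t) * n + B * (n * n)); first ring.
  by rewrite nn mulr0 addr0.
(* The derivative is a unit modulo the kernel of [p], and the geometric series for its inverse stops
   after two terms. *)
have inv_h' t : p t = v (to_pquot h 'X) -> exists g, peval u t h^`() * g = 1.
  move=> pt; set x := peval u t h^`(); set y := peval u t a.
  have : p (1 - x * y) = 0.
    rewrite rmorphB rmorphM rmorph1 /x /y !(pev _ t pt) -rmorphM -(rmorphM (to_pquot h)).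
    have -> : h^`() * a = 1 - b * h by rewrite -ab addrK mulrC.
    by rewrite rmorphB rmorph1 (rmorphM (to_pquot h)) h0 mulr0 subr0 rmorph1 subrr.
  move=> pn; have := psq _ _ pn pn => nn; exists (y * (1 + (1 - x * y))).
  transitivity (1 - (1 - x * y) * (1 - x * y)); first ring.
  by rewrite nn subr0.
have [g gE] := inv_h' t0 pt0.
pose n := - (peval u t0 h * g); pose t := t0 + n.
have pn : p n = 0 by rewrite rmorphN rmorphM (pev _ t0 pt0) h0 rmorph0 mul0r oppr0.
have pt : p t = v (to_pquot h 'X) by rewrite rmorphD pn addr0.
have ht : peval u t h = 0.
  rewrite taylor; last exact: psq.
  by rewrite /n mulrN mulrCA gE mulr1 subrr.
have [w wE] := pquot_map ht.
have wX : w (to_pquot h 'X) = t by rewrite wE pevalX.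
have wC c : w (pquotC h c) = u c by rewrite [LHS]wE pevalC.
exists w; split=> // [d|w' w'C w'p d].
  by have [q <-] := to_pquot_surj d; rewrite wE (pev _ t pt).
apply: pquot_unique => [c|]; first by rewrite wC w'C.
set t' := w' _; rewrite wX.
have pt' : p t' = v (to_pquot h 'X) by rewrite /t' w'p.
have w'h : peval u t' h = 0.
  rewrite -(rmorph0 w') -h0 -[RHS]/((w' \o to_pquot h) h).
  by rewrite (@peval_unique D E u t' (w' \o to_pquot h)).
have pd : p (t' - t) = 0 by rewrite rmorphB pt pt' subrr.
have [g' g'E] := inv_h' t pt.
have := taylor t (t' - t) h (psq _ _ pd pd).
rewrite addrC subrK w'h ht add0r => /(congr1 (fun z => g' * z)).
by rewrite mulr0 mulrA (mulrC g') g'E mul1r => /esym/eqP; rewrite subr_eq0 => /eqP.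
Qed.

(** Lying over: by [key] the extension of [P] misses the image of the complement of [P], so a prime
    that contains the former and avoids the latter contracts to [P]. *)
Lemma pquot_spec_surjective :
  h \is monic -> (1 < size h)%N -> spec_surjective (pquotC h).
Proof.
move=> hmon hsz P hP; have [P0 PD PM P1 Pprime] := hP.
have hIP : ideal_pred P by split.
pose PP (q : {poly D}) := forall i, P q`_i.
(* Modulo [P] the constant [s] is a multiple of the monic [h] of positive degree; hence [g] vanishes
   modulo [P], by descending induction on its coefficients, and so does [s]. *)
have key s g q : PP q -> s%:P = g * h + q -> P s.
  move=> Pq E; pose N := (size h).-1.
  have hN : h`_N = 1 by apply/monicP.
  have N0 : (0 < N)%N by rewrite -ltnS prednK // ltnW.
  have Pg m i : (size g <= i + m)%N -> P g`_i.
    elim: m i => [|m IH] i gi; first by rewrite addn0 in gi; rewrite nth_default.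
    have iN : (i < (i + N).+1)%N by rewrite ltnS leq_addr.
    have : P (g * h)`_(i + N).
      have -> : g * h = s%:P - q by rewrite E addrK.
      rewrite coefB coefC addn_eq0 [N == _]eqn0Ngt N0 andbF sub0r.
      exact: idealN.
    rewrite coefM (bigD1 (Ordinal iN)) //= addKn hN mulr1 => PS.
    rewrite -[X in P X](addrK (\sum_(j < (i + N).+1 | j != Ordinal iN) g`_j * h`_(i + N - j))).
    apply: idealB => //; apply: ideal_sum => // j ji.
    have [ij|jl] := ltnP i j.
      by rewrite mulrC; apply: (PM); apply: IH; rewrite addnS -addSn in gi *;
        apply: leq_trans gi _; rewrite leq_add2r.
    have {ji jl} ji : (j < i)%N by rewrite ltn_neqAle jl andbT.
    rewrite [h`_ _]nth_default ?mulr0 // -(ltn_predK hsz) -/N.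
    by rewrite -addnBAC ?(ltnW ji) // -[N.+1]add1n leq_add2r subn_gt0.
  have -> : s = (g * h)`_0 + q`_0 by rewrite -coefD -E coefC.
  apply: (PD) => //; rewrite coefM big_ord1 mulrC; apply: (PM).
  by apply: (Pg (size g)); rewrite leq_addl.
pose I y := exists q, PP q /\ y = to_pquot h q.
pose S y := exists s, ~ P s /\ y = pquotC h s.
have hI : ideal_pred I.
  split.
  - by exists 0; rewrite rmorph0; split=> // i; rewrite coef0.
  - move=> _ _ [q [Pq ->]] [r [Pr ->]]; exists (q + r); rewrite rmorphD; split=> // i.
    by rewrite coefD; apply: (PD).
  - move=> y _ [q [Pq ->]]; have [f <-] := to_pquot_surj y.
    exists (f * q); rewrite rmorphM; split=> // i; rewrite coefM.
    by apply: ideal_sum => // j _; apply: (PM).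
have [||_ [s [Ps ->]] [q [Pq E]]|Q [hQ IQ SQ]] := exists_prime_avoiding (S := S) hI.
- by exists 1; rewrite rmorph1.
- move=> _ _ [s [Ps ->]] [t [Pt ->]]; exists (s * t); rewrite rmorphM; split=> //.
  by case/Pprime.
- apply: Ps; have /to_pquot_eq0[g gE] : to_pquot h (s%:P - q) = 0.
    by rewrite rmorphB -E subrr.
  by apply: (key s g q) => //; rewrite -gE subrK.
exists Q; split=> // c; split=> [Pc|Qc].
  by apply: IQ; exists c%:P; split=> // i; rewrite coefC; case: ifP.
by apply: contrapT => nPc; apply: SQ Qc; exists c.
Qed.

End MonicQuotient.

(** * Covering near points *)

Lemma unit_ideal_empty (C : comPzRingType) (I : Type) (c : I -> C) :
  (1 : C) = 0 -> unit_ideal c.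
Proof. by move=> C0; exists [::]; rewrite big_nil C0. Qed.

Lemma identity_formally_etale (C : comPzRingType) :
  formally_etale (idfun : {rmorphism C -> C}).
Proof. by move=> E E' p u v _ _ puv; exists u; split. Qed.

Lemma identity_spec_surjective (C : comPzRingType) :
  spec_surjective (idfun : {rmorphism C -> C}).
Proof. by move=> P hP; exists P. Qed.

Section Geometry.
Variable k : numClosedFieldType.
Local Notation cat := (commalg_cat k).

Definition rational_point (D : commalg k) (e : {rmorphism D -> k}) : Prop :=
  forall a, e (commalg_scalar D a) = a.

Lemma point_neq0 (D : commalg k) (e : {rmorphism D -> k}) : (1 : D) != 0.
Proof.
by apply: contra_neqT (oner_neq0 k) => /negPn/eqP/(congr1 e); rewrite rmorph1 rmorph0.
Qed.

Lemma exists_localization (D : commalg k) (c : D) : (1 : D) != 0 ->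
  exists (L : commalg k) (l : commalg_hom D L), localization_away l c.
Proof.
case: D c => D s fp /= c D1; have [D' E] := comNzRing_of D1.
case: _ / E s fp c {D1} => s fp c.
exists (Commalg (pquot_fp (c%:P * 'X - 1) fp)).
exists (@CommalgHom k (Commalg fp) (Commalg (pquot_fp _ fp)) (pquotC _) (fun _ => erefl)).
exact: pquot_localization.
Qed.

(** What the two alternatives of the theorem have in common. *)
Definition coarse_zariski (J : coverage cat) : Prop :=
  forall (D : commalg k) (I : Type) (L : I -> commalg k) (l : forall i, commalg_hom D (L i)),
    zariski_cover l -> J D (family_sieve (X := cat) l).

Lemma finer_zariski (J : coverage cat) :
  finer J (@zariski_topology k) -> coarse_zariski J.
Proof. by move=> hJ D I L l cov; apply: hJ => J' _; apply. Qed.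

Lemma finer_etale_zariski (J : coverage cat) :
  finer J (@etale_topology k) -> coarse_zariski J.
Proof.
move=> hJ D I L l [c [c1 cl]]; apply: hJ => J' _; apply.
exists c; split=> // i; exists (L i), (l i), (commalg_id _); split=> //.
- exact: identity_formally_etale.
- exact: identity_spec_surjective.
- by rewrite commalg_comp1c.
Qed.

Section Covering.
Variables (J : coverage cat) (hJ : grothendieck_topology J).

Lemma covering_family (D : cat) (S : sieve D) (I : Type) (L : I -> cat)
    (l : forall i, hom D (L i)) :
  J (family_sieve l) -> (forall i, J (pullback (l i) S)) -> J S.
Proof.
move=> cov JS; apply: (covering_loc hJ cov) => B h [i [g ->]].
rewrite pullback_comp; exact: covering_pull.
Qed.

Lemma covering_etale (D : commalg k) (S : @sieve cat D) (E : commalg k)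
    (e : commalg_hom D E) :
  finer J (@etale_topology k) -> formally_etale e -> spec_surjective e ->
  J (@pullback cat _ _ e S) -> J S.
Proof.
move=> Jet eet esurj Je; apply: (@covering_family D S unit (fun _ => E) (fun _ => e)) => //.
apply: Jet => J' _; apply; exists (fun _ => 1); split.
  by exists [:: (1, tt)]; rewrite big_seq1 mulr1.
move=> _; exists D, (commalg_id D), e; split=> //.
- split=> [|d|a /= ->]; first by exists 1; rewrite mulr1.
    by exists d, 0%N; rewrite mulr1.
  by exists 0%N; rewrite mulr0.
- by rewrite commalg_compc1.
Qed.

Hypothesis Jzar : coarse_zariski J.

(** The unit ideal of the zero ring is generated by the empty family. This disposes of the centers
    over which degrees are not determined. *)
Lemma covering_zero (D : commalg k) (S : @sieve cat D) : (1 : D) = 0 -> J S.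
Proof.
move=> D0; apply: (@covering_family D S void (fun i : void => match i return cat with end)
  (fun i : void => match i with end)) => [|[]].
by apply: Jzar; exists (fun i : void => match i with end); split=> [|[]]; apply: unit_ideal_empty.
Qed.

Hypothesis k_uncountable : forall F : nat -> seq k, exists x, forall n, x \notin F n.

(* The elements around which the sieve becomes covering generate the unit     *)
(* ideal: otherwise they would vanish together at some point.                  *)
Lemma covering_near_points (D : commalg k) (S : @sieve cat D) :
  (forall e : {rmorphism D -> k}, rational_point e ->
    exists c (L : commalg k) (l : commalg_hom D L),
    [/\ e c != 0, localization_away l c & J (@pullback cat _ _ l S)]) ->
  J S.
Proof.
move=> near.
pose P (c : D) := exists Ll : {L : commalg k & commalg_hom D L},
  localization_away (projT2 Ll) c /\ J (@pullback cat _ _ (projT2 Ll) S).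
pose ch (i : {c : D | P c}) := cid (svalP i).
apply: (@covering_family D S {c : D | P c} (fun i => projT1 (sval (ch i)))
  (fun i => projT2 (sval (ch i)))); last by move=> i; case: (svalP (ch i)).
apply: Jzar; exists sval; split; last by move=> i; case: (svalP (ch i)).
pose I x := exists s : seq (D * {c : D | P c}), x = \sum_(y <- s) y.1 * sval y.2.
suff [s sE] : I 1 by exists s.
apply: contrapT => nI1.
have hI : ideal_pred I.
  split; first by exists [::]; rewrite big_nil.
  - by move=> _ _ [s ->] [t ->]; exists (s ++ t); rewrite big_cat.
  - move=> a _ [s ->]; exists [seq (a * y.1, y.2) | y <- s].
    by rewrite big_map mulr_sumr; apply: eq_bigr => y _; rewrite mulrA.
have [e [ep eI]] := nullstellensatz k_uncountable hI nI1.
have [c [L [l [ec lc Jl]]]] := near e ep.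
have Pc : P c by exists (existT _ L l).
have : I c by exists [:: (1, exist _ c Pc)]; rewrite big_seq1 mul1r.
by move=> /eI/eqP; rewrite (negbTE ec).
Qed.

End Covering.

Lemma point_extend (D L : commalg k) (l : commalg_hom D L) (c : D) (e : {rmorphism D -> k}) :
  rational_point e -> localization_away l c -> e c != 0 ->
  exists e' : {rmorphism L -> k}, rational_point e' /\ forall d, e' (l d) = e d.
Proof.
move=> ep lc ec; have [e' e'E] := localization_extend lc ec; exists e'; split=> // a.
by rewrite -(commalg_map_scalar l) e'E ep.
Qed.

Lemma exists_point (D : commalg k) :
  (forall F : nat -> seq k, exists x, forall n, x \notin F n) ->
  (1 : D) != 0 -> exists e : {rmorphism D -> k}, rational_point e.
Proof.
move=> unc D1; have [||e [ep _]] := @nullstellensatz k unc D (eq 0); last by exists e.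
  by split=> // [x y <- <-|a x <-]; rewrite ?addr0 ?mulr0.
by move/esym/eqP; rewrite (negbTE D1).
Qed.

End Geometry.

(** * Azumaya algebras *)

Section TensorMaps.
Variables (C : comPzRingType) (A B : algebra C).

Lemma talg_ind (P : talg A B -> Prop) :
  P 0 -> (forall a b, P (tpure a b)) -> (forall s t, P s -> P t -> P (s + t)) ->
  forall t, P t.
Proof. by move=> P0 P1 PD t; elim/tensor_ind: t. Qed.

Lemma tpureM (a a' : A) (b b' : B) : tpure a b * tpure a' b' = tpure (a * a') (b * b').
Proof. exact: tmul_pure. Qed.

Lemma talg_map (P : pzRingType) (f : {rmorphism A -> P}) (g : {rmorphism B -> P}) :
  (forall c, f (scalar A c) = g (scalar B c)) ->
  (forall a b, f a * g b = g b * f a) ->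
  exists h : {rmorphism talg A B -> P}, forall a b, h (tpure a b) = f a * g b.
Proof.
move=> fg comm; pose b (x : asmod A) (y : asmod B) : P := f x * g y.
have bal : balanced b.
  split=> [x x' y|x y y'|c x y].
  - by rewrite /b (rmorphD f) mulrDl.
  - by rewrite /b (rmorphD g) mulrDr.
  - by rewrite /b !asmod_scaleE (rmorphM f) (rmorphM g) fg mulrA comm.
have hp x y : tlift b (tpure x y) = f x * g y by apply: tlift_pure.
have h0 : tlift b 0 = 0 by apply: tlift0.
have hD s t : tlift b (s + t) = tlift b s + tlift b t by apply: tliftD.
have [|//|s t|h hE] := @exists_rmorphism (talg A B) P (tlift b).
- by rewrite [LHS]hp !rmorph1 mulr1.
- elim/talg_ind: s => [|x y|s s' IH IH']; first by rewrite mul0r h0 mul0r.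
    elim/talg_ind: t => [|x' y'|t t' IH IH']; first by rewrite mulr0 h0 mulr0.
      by rewrite tpureM !hp (rmorphM f) (rmorphM g) -!mulrA (mulrA (f x')) comm -!mulrA.
    by rewrite mulrDr !hD IH IH' mulrDr.
  by rewrite mulrDl !hD IH IH' mulrDl.
by exists h => x y; rewrite hE hp.
Qed.

Lemma talg_rmorph_ext (P : pzRingType) (f g : {rmorphism talg A B -> P}) :
  (forall a b, f (tpure a b) = g (tpure a b)) -> f =1 g.
Proof.
by move=> fg; elim/talg_ind => [|//|s t IH IH']; rewrite ?rmorph0 // !rmorphD IH IH'.
Qed.

Definition tensl : A -> talg A B := fun a => tpure a 1.
Definition tensr : B -> talg A B := fun b => tpure 1 b.

Lemma tensl_zmod : zmod_morphism tensl.
Proof. by move=> x y; apply: (addIr (tensl y)); rewrite subrK -tpureDl subrK. Qed.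
Lemma tensl_monoid : monoid_morphism tensl.
Proof. by split=> // x y; rewrite /tensl tpureM mulr1. Qed.
Lemma tensr_zmod : zmod_morphism tensr.
Proof. by move=> x y; apply: (addIr (tensr y)); rewrite subrK -tpureDr subrK. Qed.
Lemma tensr_monoid : monoid_morphism tensr.
Proof. by split=> // x y; rewrite /tensr tpureM mulr1. Qed.
HB.instance Definition _ := GRing.isZmodMorphism.Build A (talg A B) tensl tensl_zmod.
HB.instance Definition _ := GRing.isMonoidMorphism.Build A (talg A B) tensl tensl_monoid.
HB.instance Definition _ := GRing.isZmodMorphism.Build B (talg A B) tensr tensr_zmod.
HB.instance Definition _ := GRing.isMonoidMorphism.Build B (talg A B) tensr tensr_monoid.

Lemma tenslM a a' : tensl (a * a') = tensl a * tensl a'.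
Proof. exact: (rmorphM tensl). Qed.
Lemma tensrM b b' : tensr (b * b') = tensr b * tensr b'.
Proof. exact: (rmorphM tensr). Qed.
Lemma tenslD a a' : tensl (a + a') = tensl a + tensl a'.
Proof. exact: (rmorphD tensl). Qed.
Lemma tensrD b b' : tensr (b + b') = tensr b + tensr b'.
Proof. exact: (rmorphD tensr). Qed.

Lemma tpureE a b : tpure a b = tensl a * tensr b.
Proof. by rewrite tpureM mulr1 mul1r. Qed.

Lemma tens_comm a b : tensl a * tensr b = tensr b * tensl a.
Proof. by rewrite !tpureM !(mulr1, mul1r). Qed.

Lemma tens_scalar c : tensl (scalar A c) = tensr (scalar B c).
Proof. by rewrite /tensl /tensr -[scalar A c]mulr1 tpureZ mulr1. Qed.

End TensorMaps.

(** * The enveloping algebra and its action *)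

Section Sandwich.
Variables (C : comPzRingType) (A : algebra C).
Local Notation env := (talg A (op_alg A)).

Definition sw (t : env) (r : A) : A := sandwich t (r : asmod A).

Lemma sw_pure (a b r : A) : sw (tpure a (b : op_alg A)) r = a * r * b.
Proof. exact/(tlift_pure _ _ (sandwich_balanced _)). Qed.

Lemma swDl s t r : sw (s + t) r = sw s r + sw t r.
Proof. exact/(tliftD _ _ (sandwich_balanced _)). Qed.

Lemma sw0l r : sw 0 r = 0.
Proof. exact/(tlift0 (sandwich_balanced _)). Qed.

Lemma sw_suml (I : Type) (s : seq I) (P : pred I) (F : I -> env) r :
  sw (\sum_(i <- s | P i) F i) r = \sum_(i <- s | P i) sw (F i) r.
Proof. by elim/big_rec2: _ => [|i x y _ <-]; rewrite ?sw0l ?swDl. Qed.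

Lemma swDr t r r' : sw t (r + r') = sw t r + sw t r'.
Proof. exact: (linearD (sandwich t)). Qed.

Lemma sw0r t : sw t 0 = 0.
Proof. exact: (linear0 (sandwich t)). Qed.

Lemma swZr t c r : sw t (scalar A c * r) = scalar A c * sw t r.
Proof. exact: (linearZ_LR (sandwich t) c r). Qed.

Lemma sw_sumr (I : Type) (s : seq I) (P : pred I) (F : I -> A) t :
  sw t (\sum_(i <- s | P i) F i) = \sum_(i <- s | P i) sw t (F i).
Proof. by elim/big_rec2: _ => [|i x y _ <-]; rewrite ?sw0r ?swDr. Qed.

Lemma sw1 r : sw 1 r = r.
Proof. by rewrite [LHS]sw_pure mul1r mulr1. Qed.

Lemma swM s t r : sw (s * t) r = sw s (sw t r).
Proof.
elim/talg_ind: s => [|a b|s s' IH IH']; first by rewrite mul0r !sw0l.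
  elim/talg_ind: t => [|a' b'|t t' IH IH']; first by rewrite mulr0 !sw0l sw0r.
    by rewrite tpureM !sw_pure !mulrA.
  by rewrite mulrDr !swDl IH IH' swDr.
by rewrite mulrDl !swDl IH IH'.
Qed.

Definition alinear (l : A -> C) : Prop :=
  (forall a b, l (a + b) = l a + l b) /\ forall c a, l (scalar A c * a) = c * l a.

Lemma alinear0 l : alinear l -> l 0 = 0.
Proof. by move=> [_ lZ]; have := lZ 0 0; rewrite mulr0 mul0r. Qed.

Lemma alinear_sum l (I : Type) (s : seq I) (P : pred I) (F : I -> A) : alinear l ->
  l (\sum_(i <- s | P i) F i) = \sum_(i <- s | P i) l (F i).
Proof.
by move=> lA; elim/big_rec2: _ => [|i x y _ <-]; [apply: alinear0 | case: lA => ->].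
Qed.

Definition dual_basis (I : finType) (x : I -> A) (l : I -> A -> C) : Prop :=
  (forall i, alinear (l i)) /\ forall a, a = \sum_i scalar A (l i a) * x i.

Lemma dual_basis_fg (I : finType) (x : I -> A) (l : I -> A -> C) :
  dual_basis x l -> fg_projective (asmod A).
Proof.
move=> [lin xl]; pose N := #|I|.
pose p (v : 'rV[C]_N) : asmod A := \sum_i scalar A (v 0 i) * x (enum_val i).
pose s (a : asmod A) : 'rV[C]_N := \row_i l (enum_val i) a.
have pl : linear p.
  move=> c u v; rewrite /p asmod_scaleE mulr_sumr -big_split /=.
  by apply: eq_bigr => i _; rewrite !mxE rmorphD rmorphM mulrDl mulrA.
have sl : linear s.
  move=> c u v; apply/rowP => i; rewrite !mxE.
  have [lD lZ] := lin (enum_val i).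
  by rewrite [LHS](lD _ _) asmod_scaleE lZ.
pose p' : {linear 'rV[C]_N -> asmod A} := HB.pack p (GRing.isLinear.Build _ _ _ _ p pl).
pose s' : {linear asmod A -> 'rV[C]_N} := HB.pack s (GRing.isLinear.Build _ _ _ _ s sl).
exists N, p', s' => a; rewrite /= /p [RHS]xl (reindex (@enum_val I (mem I))) /=.
  by apply: eq_bigr => i _; rewrite mxE.
exact/onW_bij/enum_val_bij.
Qed.

Lemma fg_dual_basis :
  fg_projective (asmod A) -> exists N (x : 'I_N -> A) l, dual_basis x l.
Proof.
move=> [N [p [s ps]]].
exists N, (fun i => p (delta_mx 0 i)), (fun i a => s (a : asmod A) 0 i).
split=> [i|a].
  split=> [a b|c a]; first by rewrite -[a + b]/((a : asmod A) + (b : asmod A)) linearD mxE.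
  by rewrite -asmod_scaleE linearZ mxE.
rewrite -{1}[a](ps (a : asmod A)) [s a in LHS]row_sum_delta linear_sum.
by apply: eq_bigr => i _; rewrite linearZ.
Qed.

(* [w i] is the preimage of [r |-> l i r] under the sandwich isomorphism.  In  *)
(* contrast with the bijectivity of the latter, these equations are visibly    *)
(* preserved by ring maps.                                                     *)
Definition azumaya_data (I : finType) (x : I -> A) (l : I -> A -> C) (w : I -> env) : Prop :=
  [/\ dual_basis x l, forall i r, sw (w i) r = scalar A (l i r),
      \sum_i tensl _ (x i) * w i = 1,
      forall a i, tensl _ a * w i = tensr _ (a : op_alg A) * w i
    & forall c, scalar A c = 0 -> c = 0].

Lemma linear_ext (M N : lmodType C) (f g : {linear M -> N}) : f =1 g -> f = g.
Proof.
case: f g => [f fc] [g gc] /= /funext fg; subst g; congr GRing.Linear.Pack.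
by case: fc gc => [[?] [?]] [[?] [?]]; congr GRing.Linear.Class;
  [congr Algebra.isNmodMorphism.Axioms_ | congr GRing.isScalable.Axioms_];
  apply: Prop_irrelevance.
Qed.

Lemma azumaya_dataP : azumaya A -> exists N (x : 'I_N -> A) l w, azumaya_data x l w.
Proof.
move=> [/fg_dual_basis[N [x [l [lin xl]]]] Af [inv swK invK]].
have swI s t : (forall r, sw s r = sw t r) -> s = t.
  by move=> st; apply: (can_inj swK); apply: linear_ext.
pose T i (r : asmod A) : asmod A := scalar A (l i r).
have Tl i : linear (T i).
  move=> c u v; have [lD lZ] := lin i.
  by rewrite /T [l i _]lD asmod_scaleE lZ rmorphD rmorphM.
pose T' i : {linear asmod A -> asmod A} :=
  HB.pack (T i) (GRing.isLinear.Build _ _ _ _ (T i) (Tl i)).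
have wE i r : sw (inv (T' i)) r = scalar A (l i r).
  exact: (congr1 (fun f : {linear asmod A -> asmod A} => f (r : asmod A)) (invK (T' i))).
exists N, x, l, (fun i => inv (T' i)); split=> //.
- apply: swI => r; rewrite sw_suml sw1 [RHS]xl; apply: eq_bigr => i _.
  by rewrite swM sw_pure wE mulr1 scalar_central.
- move=> a i; apply: swI => r; rewrite !swM !sw_pure wE mulr1 mul1r.
  by rewrite scalar_central.
- by move=> c c0; apply: Af => r; rewrite asmod_scaleE c0 mul0r.
Qed.

(** The inverse of the sandwich map sends [T] to the sum of the [tensl (T (x i)) * w i]. It recovers
    [t] because the commutation rule of the data identifies [tensl (sw t (x i)) * w i] with
    [t * tensl (x i) * w i]. *)
Lemma azumaya_of_data (I : finType) (x : I -> A) l w : azumaya_data x l w -> azumaya A.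
Proof.
move=> [[lin xl] wE w1 wC cI]; split.
- exact: dual_basis_fg (conj lin xl).
- by move=> c /(_ 1); rewrite asmod_scaleE mulr1; apply: cI.
exists (fun T : {linear asmod A -> asmod A} => \sum_i tensl (op_alg A) (T (x i) : A) * w i).
  move=> t; rewrite -[RHS]mulr1 -w1 mulr_sumr; apply: eq_bigr => i _.
  transitivity (tensl (op_alg A) (sw t (x i)) * w i); first by [].
  elim/talg_ind: t => [|a b|s t IH IH']; first by rewrite sw0l rmorph0 !mul0r.
    rewrite sw_pure !rmorphM -!mulrA (wC b) tpureE -!mulrA; congr (_ * _).
    by rewrite mulrA tens_comm -mulrA.
  by rewrite swDl rmorphD !mulrDl IH IH'.
move=> T; apply: linear_ext => r.
rewrite -[LHS]/(sw _ r) sw_suml [in RHS](xl r).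
have -> : T (\sum_i scalar A (l i r) * x i) = \sum_i T (scalar A (l i r) * x i).
  exact: (linear_sum T).
apply: eq_bigr => i _; rewrite swM sw_pure wE mulr1.
by have := linearZ_LR T (l i r) (x i); rewrite !asmod_scaleE => ->; rewrite scalar_central.
Qed.

Lemma azumaya_sw_inj s t : azumaya A -> (forall r, sw s r = sw t r) -> s = t.
Proof.
by move=> [_ _ [inv swK _]] st; apply: (can_inj swK); apply: linear_ext.
Qed.

(** Criterion used for centralizers, where faithfulness of the sandwich action is easier to reach
    than equations in the enveloping algebra; the latter follow by comparing actions. *)
Lemma azumaya_of_inj (I : finType) (x : I -> A) l : dual_basis x l ->
  (forall i, exists w, forall r, sw w r = scalar A (l i r)) ->
  (forall t, (forall r, sw t r = 0) -> t = 0) ->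
  (forall c, scalar A c = 0 -> c = 0) -> azumaya A.
Proof.
move=> xl exw sw_inj cI; have [w wE] := choice exw.
have swN t r : sw (- t) r = - sw t r.
  by apply: (addrI (sw t r)); rewrite -swDl !subrr sw0l.
have {}sw_inj s t : (forall r, sw s r = sw t r) -> s = t.
  move=> st; apply/eqP; rewrite -subr_eq0; apply/eqP/sw_inj => r.
  by rewrite swDl swN st subrr.
apply: (azumaya_of_data (w := w) (x := x) (l := l)); split=> //.
- apply: sw_inj => r; rewrite sw_suml sw1 [RHS]xl.2; apply: eq_bigr => i _.
  by rewrite swM sw_pure wE mulr1 scalar_central.
- move=> a i; apply: sw_inj => r; rewrite !swM !sw_pure wE mulr1 mul1r.
  by rewrite scalar_central.
Qed.

End Sandwich.

Section AzumayaBasics.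
Variables (C : comPzRingType) (A : algebra C).
Hypothesis azA : azumaya A.

Lemma azumaya_scalar_inj (c d : C) : scalar A c = scalar A d -> c = d.
Proof.
have /azumaya_dataP[N [x [l [w [_ _ _ _ cI]]]]] := azA => cd.
by apply/eqP; rewrite -subr_eq0; apply/eqP/cI; rewrite rmorphB cd subrr.
Qed.

(* The ideal generated by the [l j 1] annihilates A modulo itself, so it is    *)
(* the unit ideal by the determinant trick.                                    *)
Lemma azumaya_retraction : exists l : A -> C, alinear l /\ l 1 = 1.
Proof.
have /azumaya_dataP[N [x [l [w [[lin xl] _ _ _ cI]]]]] := azA.
pose I y := exists d : 'I_N -> C, y = \sum_j d j * l j 1.
have hI : ideal_pred I.
  split.
  - by exists (fun _ => 0); rewrite big1 // => j _; rewrite mul0r.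
  - move=> _ _ [d ->] [e ->]; exists (fun j => d j + e j).
    by rewrite -big_split; apply: eq_bigr => j _; rewrite mulrDl.
  - move=> a _ [d ->]; exists (fun j => a * d j).
    by rewrite mulr_sumr; apply: eq_bigr => j _; rewrite mulrA.
have lI j : I (l j 1).
  exists (fun i => (i == j)%:R); rewrite (bigD1 j) //= eqxx mul1r.
  by rewrite big1 ?addr0 // => i /negbTE->; rewrite mul0r.
pose M : 'M[C]_N := \matrix_(i, j) \sum_m l m 1 * l j (x m * x i).
have xM i : x i = \sum_j scalar A (M i j) * x j.
  rewrite -[LHS]mul1r [X in X * _]xl mulr_suml.
  under eq_bigr => m _ do rewrite -mulrA (xl (x m * x i)) mulr_sumr.
  rewrite exchange_big; apply: eq_bigr => j _.
  rewrite mxE rmorph_sum mulr_suml; apply: eq_bigr => m _.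
  by rewrite rmorphM mulrA.
have M0 i : \sum_j scalar A ((1%:M - M) i j) * x j = 0.
  under eq_bigr => j _ do rewrite !mxE rmorphB mulrBl.
  rewrite sumrB; apply/eqP; rewrite subr_eq0; apply/eqP.
  transitivity (x i).
    rewrite (bigD1 i) //= eqxx rmorph1 mul1r big1 ?addr0 // => j ji.
    by rewrite eq_sym (negbTE ji) rmorph0 mul0r.
  by rewrite {1}(xM i); apply: eq_bigr => j _; rewrite mxE.
have detx i : scalar A (\det (1%:M - M)) * x i = 0.
  transitivity (\sum_j scalar A ((\adj (1%:M - M) *m (1%:M - M)) i j) * x j).
    rewrite mul_adj_mx (bigD1 i) //= big1 => [|j ji].
      by rewrite !mxE eqxx addr0.
    by rewrite !mxE eq_sym (negbTE ji) rmorph0 mul0r.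
  under eq_bigr => j _ do rewrite mxE rmorph_sum mulr_suml.
  rewrite exchange_big big1 // => m _.
  under eq_bigr => j _ do rewrite rmorphM -mulrA.
  by rewrite -mulr_sumr M0 mulr0.
have det0 : \det (1%:M - M) = 0.
  apply: cI; rewrite -[LHS]mulr1 [X in _ * X]xl mulr_sumr big1 // => i _.
  by rewrite mulrA scalar_central -mulrA detx mulr0.
have [d dE] : I 1.
  apply/(toquot_eq0 hI); rewrite rmorph1.
  have <- : toquot hI (\det (1%:M - M)) = 1.
    rewrite -[LHS]det_map_mx -[RHS](det1 _ N); congr (\det _).
    apply/matrixP => i j; rewrite !mxE [LHS](rmorphB (toquot hI)) /=.
    have -> : toquot hI (\sum_m l m 1 * l j (x m * x i)) = 0.
      apply/toquot_eq0; apply: ideal_sum => // m _; rewrite mulrC.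
      by case: hI => _ _; apply.
    by rewrite subr0; apply: (rmorph_nat (toquot hI)).
  by rewrite det0 rmorph0.
exists (fun a => \sum_j d j * l j a); split=> //; split=> [a b|c a].
  rewrite -big_split; apply: eq_bigr => j _; have [-> _] := lin j.
  by rewrite mulrDr.
rewrite mulr_sumr; apply: eq_bigr => j _; have [_ ->] := lin j.
by rewrite mulrCA.
Qed.

Lemma azumaya_env_functional (l : A -> C) : alinear l ->
  exists w : talg A (op_alg A), forall r, sw w r = scalar A (l r).
Proof.
have /azumaya_dataP[N [x [l' [w [[lin xl] wE w1 wC cI]]]]] := azA => lA.
exists (\sum_i tensl (op_alg A) (scalar A (l (x i))) * w i) => r.
rewrite [in RHS](xl r) (alinear_sum _ _ _ lA) rmorph_sum sw_suml.
apply: eq_bigr => i _; have [_ ->] := lA.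
by rewrite swM sw_pure wE mulr1 -rmorphM mulrC.
Qed.

(** Let [w] realize a functional with [l 1 = 1]. Sandwiching commutes with multiplication by a
    central [z], so the scalar [l z] is [sw w z = z * sw w 1 = z]. *)
Lemma azumaya_center (z : A) : central z -> exists c, z = scalar A c.
Proof.
move=> zC; have [l [lA l1]] := azumaya_retraction.
have [w wE] := azumaya_env_functional lA; exists (l z); rewrite -wE.
transitivity (z * sw w 1); first by rewrite wE l1 rmorph1 mulr1.
elim/talg_ind: w {wE} => [|a b|s t IH IH']; first by rewrite !sw0l mulr0.
  by rewrite !sw_pure mulr1 mulrA zC.
by rewrite !swDl mulrDr IH IH'.
Qed.

End AzumayaBasics.

Section EnvMap.
Variables (C D : comPzRingType) (s : {rmorphism C -> D}) (A : algebra C) (B : algebra D).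
Variable f : {rmorphism A -> B}.
Hypothesis fs : forall c, f (scalar A c) = scalar B (s c).

Lemma env_map : exists F : {rmorphism talg A (op_alg A) -> talg B (op_alg B)},
  forall a b : A, F (tpure a (b : op_alg A)) = tpure (f a) (f b : op_alg B).
Proof.
have [|||g gE] := @exists_rmorphism (op_alg A) (talg B (op_alg B))
  (fun a => tensr B (f a : op_alg B)).
- by rewrite rmorph1.
- by move=> x y; rewrite [f _](rmorphD f); apply: (rmorphD (@tensr D B (op_alg B))).
- by move=> x y; rewrite [f _](rmorphM f); apply: (rmorphM (@tensr D B (op_alg B))).
pose fl : {rmorphism A -> talg B (op_alg B)} := tensl (op_alg B) \o f.
have [||F FE] := @talg_map C A (op_alg A) _ fl g.
- by move=> c; rewrite gE /= fs tens_scalar.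
- by move=> a b; rewrite gE /= tens_comm.
by exists F => a b; rewrite FE gE -tpureE.
Qed.

Lemma sw_env_map (F : {rmorphism talg A (op_alg A) -> talg B (op_alg B)}) t r :
  (forall a b : A, F (tpure a (b : op_alg A)) = tpure (f a) (f b : op_alg B)) ->
  sw (F t) (f r) = f (sw t r).
Proof.
move=> FE; elim/talg_ind: t => [|a b|t t' IH IH'].
- by rewrite rmorph0 !sw0l rmorph0.
- by rewrite FE !sw_pure !rmorphM.
- by rewrite (rmorphD F) !swDl IH IH' rmorphD.
Qed.

End EnvMap.

(** * Base change *)

Section BaseChangeAzumaya.
Variables (C D : comPzRingType) (s : {rmorphism C -> D}) (A : algebra C).
Local Notation AD := (base_change s A).

Definition bcj : {rmorphism A -> AD} := @tensl C A (alg_of_map s).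

Lemma bcj_scalar c : bcj (scalar A c) = scalar AD (s c).
Proof. exact: (@tens_scalar C A (alg_of_map s)). Qed.

Lemma bc_ind (P : AD -> Prop) : P 0 -> (forall d a, P (scalar AD d * bcj a)) ->
  (forall x y, P x -> P y -> P (x + y)) -> forall x, P x.
Proof.
move=> P0 P1 PD; apply: talg_ind => // a d.
suff -> : tpure a d = scalar AD d * bcj a :> AD by apply: P1.
by rewrite scalar_central; apply: tpureE.
Qed.

Lemma bc_map (E : comPzRingType) (B : algebra E) (g : {rmorphism A -> B})
    (u : {rmorphism D -> E}) : (forall c, g (scalar A c) = scalar B (u (s c))) ->
  exists h : {rmorphism AD -> B},
    (forall d, h (scalar AD d) = scalar B (u d)) /\ (forall a, h (bcj a) = g a).
Proof.
move=> gs.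
pose g2 : {rmorphism alg_of_map s -> B} := scalar B \o u.
have [||h hE] := @talg_map C A (alg_of_map s) B g g2.
- by move=> c; rewrite gs.
- by move=> a d; rewrite /= scalar_central.
exists h; split=> [d|a].
  by rewrite [LHS]hE rmorph1 mul1r.
by rewrite [LHS]hE rmorph1 mulr1.
Qed.

Lemma bc_linear (l : A -> C) : alinear l ->
  exists L : AD -> D, alinear L /\ forall a, L (bcj a) = s (l a).
Proof.
move=> [lD lZ].
pose b (a : asmod A) (d : asmod (alg_of_map s)) : D := s (l a) * d.
have bal : balanced b.
  split=> [m m' n|m n n'|c m n].
  - by rewrite /b [l _]lD rmorphD mulrDl.
  - by rewrite /b [LHS]mulrDr.
  - by rewrite /b !asmod_scaleE lZ rmorphM mulrAC mulrC mulrCA.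
have Lp a d : tlift b (tpure a d) = s (l a) * d by apply: tlift_pure.
have L0 : tlift b 0 = 0 by apply: tlift0.
have LD t t' : tlift b (t + t') = tlift b t + tlift b t' by apply: tliftD.
exists (fun t : AD => tlift b t); split; last by move=> a; rewrite [LHS]Lp mulr1.
split=> [t t'|d t]; first exact: LD.
elim/talg_ind: t => [|a d'|t t' IH IH'].
- by rewrite [_ * 0]mulr0 !L0 mulr0.
- rewrite [scalar AD d * _]tpureM [LHS]Lp Lp mul1r.
  exact: (@mulrCA D).
- by rewrite [_ * (t + t')]mulrDr !LD IH IH' mulrDr.
Qed.

Lemma bc_dual_basis (I : finType) (x : I -> A) (l : I -> A -> C) :
  dual_basis x l -> exists L : I -> AD -> D, dual_basis (fun i => bcj (x i)) L /\
    forall i a, L i (bcj a) = s (l i a).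
Proof.
move=> [lin xl]; have [L LP] := choice (fun i => bc_linear (lin i)).
exists L; split; last by move=> i a; case: (LP i).
split=> [i|t]; first by case: (LP i).
elim/bc_ind: t => [|d a|t t' IH IH'].
- by rewrite big1 // => i _; rewrite (alinear0 (LP i).1) rmorph0 mul0r.
- rewrite {1}(xl a) rmorph_sum mulr_sumr; apply: eq_bigr => i _.
  have [[_ LZ] Lj] := LP i.
  by rewrite LZ Lj rmorphM bcj_scalar mulrA rmorphM.
- rewrite {1}IH {1}IH' -big_split; apply: eq_bigr => i _.
  by have [[LD _] _] := LP i; rewrite LD rmorphD mulrDl.
Qed.

(** The equations of the data are carried along [env_map]. Injectivity of the structure map is not
    an equation; it follows by extending to [AD] a functional with value 1 at 1. *)
Lemma base_change_azumaya : azumaya A -> azumaya AD.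
Proof.
move=> azA; have [N [x [l [w [xl wE w1 wC cI]]]]] := azumaya_dataP azA.
have [F FE] := env_map bcj_scalar.
have swF t r := @sw_env_map _ _ _ _ _ F t r FE.
have Fl a : F (tensl _ a) = tensl _ (bcj a) by rewrite [LHS]FE rmorph1.
have Fr (a : A) : F (tensr _ (a : op_alg A)) = tensr _ (bcj a : op_alg AD).
  by rewrite [LHS]FE rmorph1.
have [L [xL LE]] := bc_dual_basis xl.
apply: (@azumaya_of_data D AD 'I_N (fun i => bcj (x i)) L (fun i => F (w i))); split=> //.
- move=> i r; have [LD LZ] := xL.1 i.
  elim/bc_ind: r => [|d a|t t' IH IH'].
  + by rewrite sw0r (alinear0 (xL.1 i)) rmorph0.
  + by rewrite swZr swF wE LZ LE rmorphM bcj_scalar.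
  + by rewrite swDr IH IH' LD rmorphD.
- under eq_bigr => i _ do rewrite -Fl -rmorphM.
  by rewrite -rmorph_sum w1 rmorph1.
- move=> t i; elim/bc_ind: t => [|d a|t t' IH IH'].
  + by rewrite !rmorph0 !mul0r.
  + rewrite tenslM -mulrA -Fl -rmorphM wC rmorphM Fr mulrA.
    rewrite (tens_scalar AD (op_alg AD)) -tensrM; congr (_ * _).
    by congr (tensr _ _); apply: esym (scalar_central d (bcj a)).
  + rewrite tenslD mulrDl IH IH' -mulrDl; congr (_ * _).
    by rewrite -tensrD.
- move=> d d0; have [l1 [l1A l11]] := azumaya_retraction azA.
  have [L1 [L1A L1j]] := bc_linear l1A.
  have [_ L1Z] := L1A; have := L1Z d (bcj 1).
  by rewrite L1j l11 (rmorph1 s) mulr1 d0 mul0r (alinear0 L1A) => <-.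
Qed.

End BaseChangeAzumaya.

(** * Tensor products *)

Section TensorAlgebra.
Variables (C : comPzRingType) (A B : algebra C).

Lemma tens_central (c : C) (t : talg A B) :
  (@tensl C A B \o scalar A) c * t = t * (@tensl C A B \o scalar A) c.
Proof.
rewrite /=; elim/talg_ind: t => [|a b|s t IH IH']; first by rewrite mulr0 mul0r.
  by rewrite !tpureM scalar_central mul1r mulr1.
by rewrite mulrDr mulrDl IH IH'.
Qed.

Definition tens_alg : algebra C := @Algebra C (talg A B) (@tensl C A B \o scalar A) tens_central.

Definition tinl : {rmorphism A -> tens_alg} := @tensl C A B.
Definition tinr : {rmorphism B -> tens_alg} := @tensr C A B.

Lemma tinl_scalar c : tinl (scalar A c) = scalar tens_alg c.
Proof. by []. Qed.

Lemma tinr_scalar c : tinr (scalar B c) = scalar tens_alg c.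
Proof. exact/esym/tens_scalar. Qed.

Lemma tin_comm a b : tinl a * tinr b = tinr b * tinl a.
Proof. exact: tens_comm. Qed.

Lemma tens_ind (P : tens_alg -> Prop) : P 0 -> (forall a b, P (tinl a * tinr b)) ->
  (forall x y, P x -> P y -> P (x + y)) -> forall x, P x.
Proof.
move=> P0 P1 PD; apply: talg_ind => // a b.
suff -> : tpure a b = tinl a * tinr b :> tens_alg by apply: P1.
exact: tpureE.
Qed.

Lemma tens_linear (l : A -> C) (m : B -> C) : alinear l -> alinear m ->
  exists L : tens_alg -> C, alinear L /\ forall a b, L (tinl a * tinr b) = l a * m b.
Proof.
move=> [lD lZ] [mD mZ].
pose f (a : asmod A) (b : asmod B) : C := l a * m b.
have bal : balanced f.
  split=> [a a' b|a b b'|c a b].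
  - by rewrite /f [l _]lD mulrDl.
  - by rewrite /f [m _]mD mulrDr.
  - by rewrite /f !asmod_scaleE lZ mZ mulrAC mulrA mulrC mulrA.
have Lp a b : tlift f (tinl a * tinr b) = l a * m b.
  by rewrite -[tinl a * _]tpureE; apply: tlift_pure.
have L0 : tlift f 0 = 0 by apply: tlift0.
have LD t t' : tlift f (t + t') = tlift f t + tlift f t' by apply: tliftD.
exists (fun t : tens_alg => tlift f t); split=> //; split=> [t t'|c t]; first exact: LD.
elim/tens_ind: t => [|a b|t t' IH IH'].
- by rewrite mulr0 L0 mulr0.
- by rewrite mulrA -tinl_scalar -rmorphM !Lp lZ mulrA.
- by rewrite mulrDr !LD IH IH' mulrDr.
Qed.

Lemma tens_dual_basis (I J : finType) (x : I -> A) l (y : J -> B) m :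
  dual_basis x l -> dual_basis y m -> exists L : I * J -> tens_alg -> C,
    dual_basis (fun p => tinl (x p.1) * tinr (y p.2)) L /\
    forall p a b, L p (tinl a * tinr b) = l p.1 a * m p.2 b.
Proof.
move=> [ll xl] [mm ym].
have [L LP] := choice (fun p : I * J => tens_linear (ll p.1) (mm p.2)).
exists L; split; last by move=> p a b; case: (LP p).
split=> [p|t]; first by case: (LP p).
elim/tens_ind: t => [|a b|t t' IH IH'].
- by rewrite big1 // => p _; rewrite (alinear0 (LP p).1) rmorph0 mul0r.
- rewrite {1}(xl a) {1}(ym b) !rmorph_sum mulr_suml.
  under eq_bigr => i _ do rewrite mulr_sumr.
  rewrite pair_big; apply: eq_bigr => p _.
  rewrite (LP p).2 (rmorphM tinl) (rmorphM tinr) tinl_scalar tinr_scalar rmorphM.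
  by rewrite -!mulrA; congr (_ * _); rewrite !mulrA scalar_central.
- rewrite {1}IH {1}IH' -big_split; apply: eq_bigr => p _.
  by have [[LD _] _] := LP p; rewrite LD rmorphD mulrDl.
Qed.

(** The data of the tensor product are products of those of the factors; the verification rests on
    the image of the enveloping algebra of [A] commuting with what comes from [B]. *)
Lemma tens_azumaya : azumaya A -> azumaya B -> azumaya tens_alg.
Proof.
move=> azA azB.
have [N [x [l [w [xl wE w1 wC _]]]]] := azumaya_dataP azA.
have [M [y [m [v [ym vE v1 vC _]]]]] := azumaya_dataP azB.
have [F FE] := env_map (s := idfun) (f := tinl) tinl_scalar.
have [G GE] := env_map (s := idfun) (f := tinr) tinr_scalar.
have [L [xL LE]] := tens_dual_basis xl ym.
have swF t a b : sw (F t) (tinl a * tinr b) = tinl (sw t a) * tinr b.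
  elim/talg_ind: t => [|p q|t t' IH IH'].
  - by rewrite rmorph0 !sw0l rmorph0 mul0r.
  - by rewrite FE !sw_pure !rmorphM -!mulrA; congr (_ * (_ * _)); rewrite tin_comm.
  - by rewrite (rmorphD F) !swDl IH IH' rmorphD mulrDl.
have swG t a b : sw (G t) (tinl a * tinr b) = tinl a * tinr (sw t b).
  elim/talg_ind: t => [|p q|t t' IH IH'].
  - by rewrite rmorph0 !sw0l rmorph0 mulr0.
  - by rewrite GE !sw_pure !rmorphM !mulrA tin_comm.
  - by rewrite (rmorphD G) !swDl IH IH' rmorphD mulrDr.
have Fl a : F (tensl _ a) = tensl _ (tinl a) by rewrite [LHS]FE rmorph1.
have Fr (a : A) : F (tensr _ (a : op_alg A)) = tensr _ (tinl a : op_alg tens_alg).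
  by rewrite [LHS]FE rmorph1.
have Gl b : G (tensl _ b) = tensl _ (tinr b) by rewrite [LHS]GE rmorph1.
have Gr (b : B) : G (tensr _ (b : op_alg B)) = tensr _ (tinr b : op_alg tens_alg).
  by rewrite [LHS]GE rmorph1.
have Fcomml t b : F t * tensl _ (tinr b) = tensl _ (tinr b) * F t.
  elim/talg_ind: t => [|p q|t t' IH IH']; first by rewrite rmorph0 mulr0 mul0r.
    by rewrite FE [LHS]tpureM [RHS]tpureM mulr1 mul1r tin_comm.
  by rewrite (rmorphD F) mulrDl mulrDr IH IH'.
have Fcommr t b : F t * tensr _ (tinr b : op_alg tens_alg) =
    tensr _ (tinr b : op_alg tens_alg) * F t.
  elim/talg_ind: t => [|p q|t t' IH IH']; first by rewrite rmorph0 mulr0 mul0r.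
    rewrite FE [LHS]tpureM [RHS]tpureM mulr1 mul1r; congr tpure.
    exact: esym (tin_comm q b).
  by rewrite (rmorphD F) mulrDl mulrDr IH IH'.
apply: (@azumaya_of_data C tens_alg _ (fun p => tinl (x p.1) * tinr (y p.2)) L
  (fun p => F (w p.1) * G (v p.2))); split=> //.
- move=> p r; have [LD LZ] := xL.1 p; elim/tens_ind: r => [|a b|t t' IH IH'].
  + by rewrite sw0r (alinear0 (xL.1 p)) rmorph0.
  + by rewrite LE swM swG swF wE vE tinr_scalar tinl_scalar rmorphM.
  + by rewrite swDr IH IH' LD rmorphD.
- transitivity (\sum_p F (tensl _ (x p.1) * w p.1) * G (tensl _ (y p.2) * v p.2)).
    apply: eq_bigr => p _; rewrite (rmorphM F) (rmorphM G) Fl Gl tenslM.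
    by rewrite -!mulrA; congr (_ * _); rewrite !mulrA Fcomml.
  rewrite -(pair_big xpredT xpredT (fun i j =>
    F (tensl _ (x i) * w i) * G (tensl _ (y j) * v j))) /=.
  under eq_bigr => i _ do rewrite -mulr_sumr -rmorph_sum v1 rmorph1 mulr1.
  by rewrite -rmorph_sum w1 rmorph1.
- move=> t p; elim/tens_ind: t => [|a b|t t' IH IH'].
  + by rewrite !rmorph0 !mul0r.
  + rewrite tenslM -mulrA (mulrA _ (F _)) -Fcomml -(mulrA (F _)) -Gl -rmorphM vC.
    rewrite mulrA -Fl -rmorphM wC (rmorphM F) (rmorphM G) Fr Gr -mulrA (mulrA (F _)) Fcommr !mulrA.
    congr (_ * _ * _); rewrite -tensrM; congr (tensr _ _).
    exact: esym (tin_comm a b).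
  + rewrite tenslD mulrDl IH IH' -mulrDl; congr (_ * _).
    by rewrite -tensrD.
- move=> c c0.
  have [l1 [l1A l11]] := azumaya_retraction azA.
  have [m1 [m1A m11]] := azumaya_retraction azB.
  have [L1 [L1A L1E]] := tens_linear l1A m1A.
  have [_ L1Z] := L1A; have := L1Z c (tinl 1 * tinr 1).
  by rewrite c0 mul0r (alinear0 L1A) L1E l11 m11 !mulr1 => <-.
Qed.

End TensorAlgebra.

(** * Matrix algebras *)

Section MatrixAlgebra.
Variables (C : comPzRingType) (n : nat).

Lemma scalar_mx_central (c : C) (M : 'M[C]_n) : c%:M * M = M * c%:M.
Proof. exact: (esym (scalar_mxC c M)). Qed.

Definition mat_alg : algebra C :=
  @Algebra C 'M[C]_n (@scalar_mx C n) scalar_mx_central.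

Lemma mat_dual_basis :
  @dual_basis C mat_alg ('I_n * 'I_n)%type (fun p => delta_mx p.1 p.2) (fun p M => M p.1 p.2).
Proof.
split=> [p|M].
  split=> [M N|c M]; first by rewrite mxE.
  by rewrite [scalar _ c * _]mul_scalar_mx mxE.
rewrite {1}(matrix_sum_delta M) pair_big; apply: eq_bigr => p _.
by rewrite [scalar _ _ * _]mul_scalar_mx.
Qed.

Lemma mat_azumaya : (0 < n)%N -> azumaya mat_alg.
Proof.
move=> n0; pose d i j : mat_alg := delta_mx i j.
have dM i j i' j' : d i j * d i' j' = if j == i' then d i j' else 0.
  rewrite -[LHS]/(delta_mx i j *m delta_mx i' j') mul_delta_mx_cond.
  by case: eqP.
have d1 : \sum_s d s s = 1 by apply/esym/mx1_sum_delta.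
pose env := talg mat_alg (op_alg mat_alg).
have t0l b : tpure 0 b = 0 :> env by rewrite tpureE rmorph0 mul0r.
have t0r a : tpure a 0 = 0 :> env by rewrite tpureE rmorph0 mulr0.
(* For [p = (i, j)] this realizes the entry functional: the sum over [s] of [e_si M e_js] is [M_ij]
   times the identity. *)
pose w (p : 'I_n * 'I_n) : env := \sum_s tpure (d s p.1) (d p.2 s : op_alg mat_alg).
have one_term (F : 'I_n -> env) j : \sum_s (if j == s then F s else 0) = F j.
  by rewrite -big_mkcond (big_pred1 j) // => s /=; rewrite eq_sym.
have wl a b p : tensl _ (d a b) * w p = tpure (d a p.1) (d p.2 b : op_alg mat_alg).
  rewrite /w mulr_sumr -[RHS](one_term (fun s => tpure (d a p.1) (d p.2 s : op_alg mat_alg)) b).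
  apply: eq_bigr => s _; rewrite tpureM mul1r dM.
  by case: eqP.
have wr a b p : tensr _ (d a b : op_alg mat_alg) * w p = tpure (d a p.1) (d p.2 b : op_alg mat_alg).
  rewrite /w mulr_sumr -[RHS](one_term (fun s => tpure (d s p.1) (d p.2 b : op_alg mat_alg)) a).
  apply: eq_bigr => s _; rewrite tpureM mul1r.
  rewrite -[(d a b : op_alg mat_alg) * _]/(d p.2 s * d a b) dM eq_sym.
  by case: eqP.
have [lin xl] := mat_dual_basis.
have swd p q : sw (w p) (d q.1 q.2) = if p == q then 1 else 0.
  rewrite /w sw_suml; under eq_bigr => s _ do rewrite sw_pure dM.
  case: p q => i j [i' j'] /=; rewrite xpair_eqE.
  have [_|ii'] := eqVneq i i'; last by rewrite big1 // => s _; rewrite mul0r.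
  under eq_bigr => s _ do rewrite dM.
  rewrite eq_sym; case: eqP => _; first exact: d1.
  by rewrite big1.
apply: (@azumaya_of_data C mat_alg _ (fun p => d p.1 p.2) (fun p M => M p.1 p.2) w).
split=> //.
- move=> p M; rewrite {1}[M]xl sw_sumr (bigD1 p) //= swZr swd eqxx mulr1.
  by rewrite big1 ?addr0 // => q qp; rewrite swZr swd eq_sym (negbTE qp) mulr0.
- under eq_bigr => p _ do rewrite wl.
  rewrite -(pair_big xpredT xpredT (fun i j => tpure (d i i) (d j j : op_alg mat_alg))) /=.
  have dd i j : tpure (d i i) (d j j : op_alg mat_alg) =
      tensl _ (d i i) * tensr _ (d j j : op_alg mat_alg).
    exact: tpureE.
  under eq_bigr => i _ do under eq_bigr => j _ do rewrite dd.
  have r1 : \sum_j tensr mat_alg (d j j : op_alg mat_alg) = 1.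
    have d1' : \sum_s (d s s : op_alg mat_alg) = 1 :> op_alg mat_alg := d1.
    by rewrite -(rmorph_sum (@tensr C mat_alg (op_alg mat_alg))) d1' rmorph1.
  under eq_bigr => i _ do rewrite -mulr_sumr r1 mulr1.
  by rewrite -rmorph_sum d1 rmorph1.
- move=> M p; rewrite [M]xl rmorph_sum mulr_suml.
  have -> : tensr mat_alg (\sum_q scalar mat_alg (M q.1 q.2) * d q.1 q.2 : op_alg mat_alg) =
      \sum_q tensr _ (scalar mat_alg (M q.1 q.2) : op_alg mat_alg) *
        tensr _ (d q.1 q.2 : op_alg mat_alg).
    rewrite [LHS](rmorph_sum (@tensr C mat_alg (op_alg mat_alg))); apply: eq_bigr => q _.
    by rewrite -tensrM scalar_central.
  rewrite mulr_suml; apply: eq_bigr => q _.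
  transitivity (tensl (op_alg mat_alg) (scalar mat_alg (M q.1 q.2) * d q.1 q.2) * w p).
    by [].
  by rewrite tenslM (tens_scalar mat_alg (op_alg mat_alg)) -!mulrA wl wr.
- move=> c /(congr1 (fun M : 'M[C]_n => M (Ordinal n0) (Ordinal n0))).
  by rewrite !mxE eqxx.
Qed.

End MatrixAlgebra.

(** * Centralizers *)

Section Centralizer.
Variables (C : comPzRingType) (A B : algebra C) (f : {rmorphism A -> B}).

Definition cent_pred : {pred B} := fun b => `[< forall a, f a * b = b * f a >].

Lemma cent_predP b : reflect (forall a, f a * b = b * f a) (b \in cent_pred).
Proof. exact: asboolP. Qed.

Lemma cent_subring_closed : subring_closed cent_pred.
Proof.
split=> [|b b' /cent_predP hb /cent_predP hb'|b b' /cent_predP hb /cent_predP hb'];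
  apply/cent_predP => a.
- by rewrite mulr1 mul1r.
- by rewrite mulrBr mulrBl hb hb'.
- by rewrite mulrA hb -mulrA hb' mulrA.
Qed.

HB.instance Definition _ := GRing.isSubringClosed.Build B cent_pred cent_subring_closed.

Record centralizer := Cent { cval : B; _ : cval \in cent_pred }.
HB.instance Definition _ := [isSub for cval].
HB.instance Definition _ := [Choice of centralizer by <:].
HB.instance Definition _ := GRing.SubChoice_isSubPzRing.Build B cent_pred centralizer
  cent_subring_closed.

Lemma cvalP (v : centralizer) a : f a * val v = val v * f a.
Proof. by move: a; apply/cent_predP/(valP v). Qed.

Lemma scalar_cent c : scalar B c \in cent_pred.
Proof. by apply/cent_predP => a; rewrite scalar_central. Qed.

Definition cent_scalar c : centralizer := Cent (scalar_cent c).

Lemma cent_scalar_zmod : zmod_morphism cent_scalar.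
Proof. by move=> x y; apply: val_inj; rewrite /= rmorphB. Qed.
Lemma cent_scalar_monoid : monoid_morphism cent_scalar.
Proof. by split=> [|x y]; apply: val_inj; rewrite /= ?rmorph1 ?rmorphM. Qed.
HB.instance Definition _ := GRing.isZmodMorphism.Build C centralizer cent_scalar cent_scalar_zmod.
HB.instance Definition _ :=
  GRing.isMonoidMorphism.Build C centralizer cent_scalar cent_scalar_monoid.

Lemma cent_scalar_central c (v : centralizer) : cent_scalar c * v = v * cent_scalar c.
Proof. by apply: val_inj; rewrite /= scalar_central. Qed.

Definition cent_alg : algebra C := @Algebra C centralizer cent_scalar cent_scalar_central.

Definition cincl : {rmorphism cent_alg -> B} := (val : centralizer -> B).

Lemma cincl_inj : injective cincl.
Proof. exact: val_inj. Qed.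

Lemma cincl_scalar c : cincl (scalar cent_alg c) = scalar B c.
Proof. by []. Qed.

Lemma cincl_comm a v : f a * cincl v = cincl v * f a.
Proof. exact: cvalP. Qed.

Lemma in_centralizer b : (forall a, f a * b = b * f a) -> exists v, cincl v = b.
Proof. by move=> /cent_predP hb; exists (Cent hb). Qed.

Hypothesis fs : forall c, f (scalar A c) = scalar B c.
Hypothesis azA : azumaya A.

(** Left and right multiplication by [A] agree on an element [w] that realizes a functional, so [w]
    acting on [B] lands in the centralizer. This is the projection of [A (x) V] onto [V] along
    [l]. *)
Lemma centralizer_proj (l : A -> C) : alinear l -> exists pr : B -> cent_alg,
  [/\ forall b b', pr (b + b') = pr b + pr b',
      forall a v, pr (f a * cincl v) = scalar cent_alg (l a) * v &
      exists F : {rmorphism talg A (op_alg A) -> talg B (op_alg B)}, exists w,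
        [/\ forall a b : A, F (tpure a (b : op_alg A)) = tpure (f a) (f b : op_alg B),
            forall r, sw w r = scalar A (l r) & forall b, cincl (pr b) = sw (F w) b]].
Proof.
move=> lA; have [w wE] := azumaya_env_functional azA lA.
have [F FE] := env_map (s := idfun) fs.
have wC a : tensl _ a * w = tensr _ (a : op_alg A) * w.
  apply: azumaya_sw_inj => // r.
  by rewrite !swM !sw_pure wE mulr1 mul1r scalar_central.
have /choice[pr prE] b : exists v, cincl v = sw (F w) b.
  apply: in_centralizer => a.
  have -> : f a * sw (F w) b = sw (F (tensl _ a * w)) b.
    by rewrite rmorphM swM FE sw_pure rmorph1 mulr1.
  by rewrite wC rmorphM swM FE sw_pure rmorph1 mul1r.
exists pr; split.
- by move=> b b'; apply: cincl_inj; rewrite rmorphD !prE swDr.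
- move=> a v; apply: cincl_inj; rewrite prE rmorphM cincl_scalar -fs -wE.
  elim/talg_ind: w {wE wC prE} => [|p q|s t IH IH'].
  + by rewrite rmorph0 !sw0l rmorph0 mul0r.
  + by rewrite FE !sw_pure !rmorphM -!mulrA -cincl_comm.
  + by rewrite (rmorphD F) !swDl IH IH' rmorphD mulrDl.
- by exists F, w.
Qed.

(** The decomposition [B = A (x) V], obtained by letting the identity [\sum_i x_i w_i = 1] of the
    enveloping algebra of [A] act on [B]. *)
Lemma centralizer_basis (I : finType) (x : I -> A) (l : I -> A -> C) : dual_basis x l ->
  exists pr : I -> B -> cent_alg,
  [/\ forall i b b', pr i (b + b') = pr i b + pr i b',
      forall i a v, pr i (f a * cincl v) = scalar cent_alg (l i a) * v &
      forall b, b = \sum_i f (x i) * cincl (pr i b)].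
Proof.
move=> [lin xl]; have [pr prP] := choice (fun i => centralizer_proj (lin i)).
exists pr; split=> [i|i|b]; [by case: (prP i) | by case: (prP i)|].
have [F FE] := env_map (s := idfun) fs.
have /choice[w wP] i : exists w, (forall r, sw w r = scalar A (l i r)) /\
    forall b, cincl (pr i b) = sw (F w) b.
  have [_ _ [F' [w [F'E wE prE]]]] := prP i; exists w; split=> // b'; rewrite prE.
  congr sw; apply: talg_rmorph_ext => a a'; exact: etrans (F'E a a') (esym (FE a a')).
have w1 : \sum_i tensl _ (x i) * w i = 1.
  apply: azumaya_sw_inj => // r; rewrite sw_suml sw1 [RHS]xl.
  apply: eq_bigr => i _; case: (wP i) => wE _.
  by rewrite swM sw_pure wE mulr1 scalar_central.
transitivity (sw (F 1) b); first by rewrite rmorph1 sw1.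
rewrite -w1 rmorph_sum sw_suml; apply: eq_bigr => i _.
by case: (wP i) => _ ->; rewrite rmorphM swM FE sw_pure rmorph1 mulr1.
Qed.

Lemma centralizer_ind (P : B -> Prop) : P 0 -> (forall a v, P (f a * cincl v)) ->
  (forall b b', P b -> P b' -> P (b + b')) -> forall b, P b.
Proof.
move=> P0 P1 PD b; have [N [x [l [w [xl _ _ _ _]]]]] := azumaya_dataP azA.
have [pr [_ _ bE]] := centralizer_basis xl; rewrite (bE b).
by elim/big_rec: _ => // i y _ Py; apply: PD.
Qed.

(** The universal property of [A (x) V] transferred to [B]; it gives maps out of [B] without an
    explicit isomorphism. *)
Lemma centralizer_map (E : comPzRingType) (Q : algebra E) (u : {rmorphism C -> E})
    (g : {rmorphism A -> Q}) (h : {rmorphism cent_alg -> Q}) :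
  (forall c, g (scalar A c) = scalar Q (u c)) ->
  (forall c, h (scalar cent_alg c) = scalar Q (u c)) ->
  (forall a v, g a * h v = h v * g a) ->
  exists k : {rmorphism B -> Q}, [/\ forall a, k (f a) = g a,
    forall v, k (cincl v) = h v & forall c, k (scalar B c) = scalar Q (u c)].
Proof.
move=> gu hu gh; have [N [x [l [w [xl _ _ _ _]]]]] := azumaya_dataP azA.
have [pr [prD prE bE]] := centralizer_basis xl.
pose k b := \sum_i g (x i) * h (pr i b).
have kD b b' : k (b + b') = k b + k b'.
  by rewrite -big_split; apply: eq_bigr => i _; rewrite prD rmorphD mulrDr.
have kE a v : k (f a * cincl v) = g a * h v.
  rewrite [in RHS](xl.2 a) rmorph_sum mulr_suml; apply: eq_bigr => i _.
  by rewrite prE (rmorphM h) hu (rmorphM g) gu mulrA -scalar_central.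
have k0 : k 0 = 0 by apply: (addrI (k 0)); rewrite -kD !addr0.
have kM : {morph k : b b' / b * b'}.
  move=> b b'; elim/centralizer_ind: b => [|a v|b1 b2 IH IH'].
  - by rewrite mul0r k0 mul0r.
  - elim/centralizer_ind: b' => [|a' v'|b1 b2 IH IH'].
    + by rewrite mulr0 k0 mulr0.
    + have -> : f a * cincl v * (f a' * cincl v') = f (a * a') * cincl (v * v').
        by rewrite !rmorphM -!mulrA; congr (_ * _); rewrite !mulrA cincl_comm.
      rewrite !kE !rmorphM -!mulrA; congr (_ * _).
      by rewrite !mulrA gh.
    + by rewrite mulrDr !kD IH IH' mulrDr.
  - by rewrite mulrDl !kD IH IH' mulrDl.
have kf a : k (f a) = g a.
  by rewrite -[f a]mulr1 -(rmorph1 cincl) kE rmorph1 mulr1.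
have [|k' k'E] := @exists_rmorphism B Q k _ kD kM.
  by rewrite -(rmorph1 f) kf rmorph1.
exists k'; split=> [a|v|c]; rewrite k'E //.
  by rewrite -[cincl v]mul1r -(rmorph1 f) kE rmorph1 mul1r.
by rewrite -fs kf gu.
Qed.

Lemma centralizer_dual_basis (I J : finType) (x : I -> A) l (y : J -> cent_alg) m :
  dual_basis x l -> dual_basis y m ->
  exists L : I * J -> B -> C, dual_basis (fun p => f (x p.1) * cincl (y p.2)) L /\
    forall p, L p (f (x p.1) * cincl (y p.2)) = l p.1 (x p.1) * m p.2 (y p.2).
Proof.
move=> xl ym; have [pr [prD prE bE]] := centralizer_basis xl.
exists (fun p b => m p.2 (pr p.1 b)); split=> [|p]; last first.
  by rewrite prE; have [_ ->] := ym.1 p.2.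
have prZ i c b : pr i (scalar B c * b) = scalar cent_alg c * pr i b.
  have pr0 : pr i 0 = 0 by apply: (addrI (pr i 0)); rewrite -prD !addr0.
  elim/centralizer_ind: b => [|a v|b b' IH IH'].
  - by rewrite mulr0 pr0 mulr0.
  - rewrite -fs mulrA -rmorphM !prE; have [_ ->] := xl.1 i.
    by rewrite rmorphM mulrA.
  - by rewrite mulrDr !prD IH IH' mulrDr.
split=> [p|b].
  have [mD mZ] := ym.1 p.2; split=> [b b'|c b]; first by rewrite prD mD.
  by rewrite prZ mZ.
rewrite {1}[b]bE.
under eq_bigr => i _ do rewrite {1}(ym.2 (pr i b)) rmorph_sum mulr_sumr.
rewrite pair_big; apply: eq_bigr => p _.
by rewrite rmorphM cincl_scalar mulrA -scalar_central -mulrA.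
Qed.

(** The centralizer [V] is a retract of [B] through [pr], so functionals and sandwich operators pass
    from [B] to [V]. An element of the enveloping algebra of [V] that kills [V] kills [B = A V],
    hence vanishes. *)
Lemma centralizer_azumaya : azumaya B -> azumaya cent_alg.
Proof.
move=> azB; have [N [x [l [w [xl _ _ _ _]]]]] := azumaya_dataP azA.
have [pi [piD piE bE]] := centralizer_basis xl.
have [l1 [l1A l11]] := azumaya_retraction azA.
have [pr [prD prE _]] := centralizer_proj l1A.
have prv v : pr (cincl v) = v.
  by rewrite -[cincl v]mul1r -(rmorph1 f) prE l11 rmorph1 mul1r.
have pr0 : pr 0 = 0 by apply: (addrI (pr 0)); rewrite -prD !addr0.
have prZ c b : pr (scalar B c * b) = scalar cent_alg c * pr b.
  elim/centralizer_ind: b => [|a v|b b' IH IH'].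
  - by rewrite mulr0 pr0 mulr0.
  - rewrite -fs mulrA -rmorphM !prE; have [_ ->] := l1A.
    by rewrite rmorphM mulrA.
  - by rewrite mulrDr !prD IH IH' mulrDr.
have pr_sum (T : finType) (g : T -> B) : pr (\sum_i g i) = \sum_i pr (g i).
  by elim/big_rec2: _ => [|i b v _ <-]; rewrite ?pr0 ?prD.
have [M [y [m [w' [[mlin ym] w'E _ _ cI]]]]] := azumaya_dataP azB.
apply: (@azumaya_of_inj C cent_alg _ (fun j => pr (y j)) (fun j v => m j (cincl v))).
- split=> [j|v].
    have [mD mZ] := mlin j; split=> [v v'|c v]; first by rewrite rmorphD mD.
    by rewrite rmorphM cincl_scalar mZ.
  rewrite -{1}[v]prv {1}(ym (cincl v)) pr_sum.
  by apply: eq_bigr => j _; rewrite prZ.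
- move=> j.
  suff [t tE] : exists t : talg cent_alg (op_alg cent_alg),
      forall v, sw t v = pr (sw (w' j) (cincl v)).
    exists t => v; rewrite tE w'E -[scalar B _]mulr1 prZ -(rmorph1 cincl) prv.
    by rewrite mulr1.
  elim/talg_ind: (w' j) => [|b b'|s s' [t tE] [t' t'E]].
  + by exists 0 => v; rewrite !sw0l pr0.
  (* With [b] and [b'] expanded over the [x_i], the factors from [A] slide past [v], and [pr] turns
     each [x_i x_k] into a scalar. *)
  + exists (\sum_i \sum_k tpure (scalar cent_alg (l1 (x i * x k)) * pi i b)
      (pi k b' : op_alg cent_alg)) => v.
    rewrite sw_pure {2}[b]bE {2}[b']bE !mulr_suml pr_sum sw_suml; apply: eq_bigr => i _.
    rewrite mulr_sumr pr_sum sw_suml; apply: eq_bigr => k _.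
    rewrite sw_pure -!mulrA -prE; congr pr; rewrite !rmorphM.
    by rewrite -!mulrA; congr (_ * _); rewrite !mulrA; congr (_ * _);
      rewrite cincl_comm -!mulrA cincl_comm.
  + by exists (t + t') => v; rewrite !swDl tE t'E prD.
- move=> t t0; have [G GE] := env_map (s := idfun) (f := cincl) cincl_scalar.
  have Gt0 : G t = 0.
    apply: azumaya_sw_inj => // b; rewrite sw0l.
    have swG a v : sw (G t) (f a * cincl v) = f a * cincl (sw t v).
      elim/talg_ind: (t) => [|p q|s s' IH IH'].
      + by rewrite rmorph0 !sw0l rmorph0 mulr0.
      + by rewrite GE !sw_pure !rmorphM !mulrA cincl_comm.
      + by rewrite (rmorphD G) !swDl IH IH' rmorphD mulrDr.
    elim/centralizer_ind: b => [|a v|b b' IH IH']; first by rewrite sw0r.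
      by rewrite swG t0 rmorph0 mulr0.
    by rewrite swDr IH IH' addr0.
  (* Applying [pr] to both factors is a left inverse of [G], so [G t = 0] forces [t = 0]. *)
  pose bal (b : asmod B) (b' : asmod (op_alg B)) : talg cent_alg (op_alg cent_alg) :=
    tpure (pr b) (pr (b' : B) : op_alg cent_alg).
  have bal_bal : balanced bal.
    split=> [b b1 b'|b b' b1|c b b'].
    + by rewrite /bal -tpureDl -prD.
    + rewrite /bal -tpureDr; congr tpure; exact: prD.
    + rewrite /bal !asmod_scaleE prZ tpureZ; congr tpure.
      have -> : (scalar (op_alg B) c * (b' : op_alg B) : B) = (b' : B) * scalar B c by [].
      by rewrite -scalar_central prZ scalar_central.
  have retr s : tlift bal (G s) = s.
    elim/talg_ind: s => [|p q|s s' IH IH'].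
    + by rewrite rmorph0; apply: tlift0.
    + rewrite GE [LHS](tlift_pure _ _ bal_bal) /bal !prv //.
    + rewrite (rmorphD G) [LHS](tliftD _ _ bal_bal).
      by move: IH IH'; rewrite -[in LHS]/(tlift bal _) => -> ->.
  by rewrite -(retr t) Gt0; apply: tlift0.
- by move=> c c0; apply: cI; rewrite -cincl_scalar c0 rmorph0.
Qed.

End Centralizer.

(** * Degrees *)

Section FractionSubfield.
Variables (C : comPzRingType) (F : fieldType) (h : {rmorphism C -> F}).

Definition frac_pred : {pred F} := fun y => `[< exists a b : C, h b != 0 /\ y = h a / h b >].

Lemma frac_predP y : reflect (exists a b : C, h b != 0 /\ y = h a / h b) (y \in frac_pred).
Proof. exact: asboolP. Qed.

Lemma frac_divring_closed : divring_closed frac_pred.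
Proof.
split=> [|y z /frac_predP[a [b [hb ->]]] /frac_predP[c [d [hd ->]]]|
  y z /frac_predP[a [b [hb ->]]] /frac_predP[c [d [hd ->]]]]; apply/frac_predP.
- by exists 1, 1; rewrite rmorph1 oner_neq0 divr1.
- exists (a * d - c * b), (b * d); rewrite !rmorphM mulf_neq0 //; split=> //.
  by rewrite rmorphB !rmorphM -[in LHS]mulNr addf_div // mulNr.
- have [hc|hc] := eqVneq (h c) 0.
    by exists 0, 1; rewrite rmorph1 oner_neq0 hc rmorph0 !mul0r invr0 mulr0.
  exists (a * d), (b * c); rewrite !rmorphM mulf_neq0 //; split=> //.
  by rewrite invf_div mulf_div.
Qed.

HB.instance Definition _ := GRing.isDivringClosed.Build F frac_pred frac_divring_closed.

Record frac_subfield := FracSub { frac_val : F; _ : frac_val \in frac_pred }.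
HB.instance Definition _ := [isSub for frac_val].
HB.instance Definition _ := [Choice of frac_subfield by <:].
HB.instance Definition _ := [SubChoice_isSubIntegralDomain of frac_subfield by <:].
HB.instance Definition _ := [SubIntegralDomain_isSubField of frac_subfield by <:].

(** Ranks are defined at residue fields. A map to any field factors through the fractions of its
    image, so a constant rank can be read at every field. *)
Lemma residue_field_factor : exists (F0 : fieldType) (f : {rmorphism C -> F0})
  (i : {rmorphism F0 -> F}), residue_field f /\ forall c, i (f c) = h c.
Proof.
have hfrac c : h c \in frac_pred.
  by apply/frac_predP; exists c, 1; rewrite rmorph1 oner_neq0 divr1.
have [||//|f fE] := @exists_rmorphism C frac_subfield (fun c => FracSub (hfrac c)).
- by apply: val_inj; rewrite /= rmorph1.
- by move=> x y; apply: val_inj; rewrite /= rmorphD.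
- by move=> x y; apply: val_inj; rewrite /= rmorphM.
have vE c : val (f c) = h c by rewrite fE.
exists frac_subfield, f, (val : {rmorphism frac_subfield -> F}); split=> // y.
have /frac_predP[a [b [hb yE]]] := valP y; exists a, b; split.
  by apply: contraNneq hb => fb; rewrite -vE fb rmorph0.
by apply: val_inj; rewrite yE -!vE fmorph_div.
Qed.

End FractionSubfield.

(** The Hattori-Stallings rank, that is the trace of the identity: its image in a field is the
    dimension of the fiber. *)
Definition trace (C : comPzRingType) (A : algebra C) (I : finType) (x : I -> A)
  (l : I -> A -> C) : C := \sum_i l i (x i).

Lemma trace_unique (C : comPzRingType) (A : algebra C) (I J : finType)
    (x : I -> A) l (y : J -> A) m :
  dual_basis x l -> dual_basis y m -> trace x l = trace y m.
Proof.
move=> [lin xl] [mlin ym]; rewrite /trace.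
under eq_bigr => i _ do rewrite {1}(ym (x i)) (alinear_sum _ _ _ (lin i)).
under [RHS]eq_bigr => j _ do rewrite {1}(xl (y j)) (alinear_sum _ _ _ (mlin j)).
rewrite exchange_big; apply: eq_bigr => j _; apply: eq_bigr => i _.
by have [[_ ->] [_ ->]] := (lin i, mlin j); rewrite mulrC.
Qed.

Lemma idempotent_mx_factor (F : fieldType) (N : nat) (e : 'M[F]_N) : e *m e = e ->
  exists r (K : 'M[F]_(N, r)) (R : 'M[F]_(r, N)), K *m R = e /\ R *m K = 1%:M.
Proof.
move=> ee; exists (\rank e), (col_base e), (row_base e).
have KR : col_base e *m row_base e = e by apply: mulmx_base.
split=> //; apply: (row_full_inj (col_base_full e)).
apply: (row_free_inj (row_base_free e)).
by rewrite mulmx1 mulmxA KR -mulmxA KR ee.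
Qed.

Lemma fg_projective_field_free (F : fieldType) (M : lmodType F) :
  fg_projective M -> exists r (phi : {linear 'rV[F]_r -> M}), bijective phi.
Proof.
move=> [N [p [s ps]]].
pose e := lin1_mx (s \o p).
have eE v : v *m e = s (p v) by rewrite mul_rV_lin1.
have [|r [K [R [KR RK]]]] := @idempotent_mx_factor F N e.
  by apply/row_matrixP => i; rewrite row_mul rowE !eE ps.
pose phi (v : 'rV[F]_r) : M := p (v *m R).
have phil : linear phi by move=> c u v; rewrite /phi mulmxDl -scalemxAl linearP.
pose phi' : {linear 'rV[F]_r -> M} :=
  HB.pack phi (GRing.isLinear.Build _ _ _ _ phi phil).
exists r, phi', (fun a => s a *m K) => [v|a]; rewrite /= /phi.
  by rewrite -eE -KR !mulmxA -(mulmxA v) RK mulmx1 -mulmxA RK mulmx1.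
by rewrite -mulmxA KR eE !ps.
Qed.

Section TraceRank.
Variables (C : comPzRingType) (A : algebra C).

Lemma free_trace (r : nat) (phi : {linear 'rV[C]_r -> asmod A}) : bijective phi ->
  exists (y : 'I_r -> A) m, dual_basis y m /\ trace y m = r%:R.
Proof.
move=> [psi phiK psiK].
have psil : linear psi by apply: can2_linear phiK psiK.
exists (fun i => phi (delta_mx 0 i)), (fun i a => psi (a : asmod A) 0 i); split.
  split=> [i|a].
    split=> [a b|c a].
      have := psil 1 (a : asmod A) (b : asmod A); rewrite !scale1r => E.
      by rewrite [psi _]E mxE.
    have := psil c (a : asmod A) 0; rewrite !addr0 asmod_scaleE => ->.
    rewrite !mxE; suff -> : psi 0 = 0 by rewrite mxE addr0.
    by apply: (addrI (psi 0)); rewrite addr0; have := psil 1 0 0; rewrite !scale1r addr0 => <-.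
  rewrite -{1}[a](psiK (a : asmod A)) {1}[psi a]row_sum_delta linear_sum.
  by apply: eq_bigr => i _; rewrite linearZ.
rewrite /trace; under eq_bigr => i _ do rewrite phiK mxE !eqxx.
by rewrite sumr_const card_ord.
Qed.

End TraceRank.

Section ConstantRank.
Variables (k : numClosedFieldType) (C : comPzRingType) (s : {rmorphism k -> C}).
Variables (A : algebra C) (I : finType) (x : I -> A) (l : I -> A -> C).
Hypothesis xl : dual_basis x l.

Lemma natr_field_inj (F : fieldType) (f : {rmorphism C -> F}) (m n : nat) :
  m%:R = n%:R :> F -> m = n.
Proof.
move=> mn; apply/eqP; rewrite -(@eqr_nat k); apply/eqP.
by apply: (fmorph_inj (f \o s)); rewrite !rmorph_nat.
Qed.

(** The fiber over a field is free and its trace is its rank as an element of the field. This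
    determines the integer, as the field receives [k] and has characteristic zero. *)
Lemma constant_rankP r : constant_rank A r <->
  forall (F : fieldType) (f : {rmorphism C -> F}), f (trace x l) = r%:R.
Proof.
split=> [hr F h|hr F f _].
  have [F0 [f [i [fres fE]]]] := residue_field_factor h.
  have [phi /free_trace[y [m [ym tr]]]] := hr F0 f fres.
  have [L [xL LE]] := bc_dual_basis f xl.
  rewrite -fE -(rmorph_nat i) -tr -(trace_unique xL ym); congr (i _).
  by rewrite rmorph_sum; apply: eq_bigr => j _; rewrite LE.
have [L [xL LE]] := bc_dual_basis f xl.
have [r' [phi phi_bij]] := fg_projective_field_free (dual_basis_fg xL).
have [y [m [ym tr]]] := free_trace phi_bij.
suff <- : r' = r by exists phi.
apply: (natr_field_inj f); rewrite -tr -(hr F f) -(trace_unique xL ym).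
by rewrite rmorph_sum; apply: eq_bigr => j _; rewrite LE.
Qed.

Lemma constant_degreeP n : constant_degree A n <->
  forall (F : fieldType) (f : {rmorphism C -> F}), f (trace x l) = (n ^ 2)%:R.
Proof. exact: constant_rankP. Qed.

Lemma trace_nat (F : fieldType) (f : {rmorphism C -> F}) :
  exists r : nat, f (trace x l) = r%:R.
Proof.
have [L [xL LE]] := bc_dual_basis f xl.
have [r [phi phi_bij]] := fg_projective_field_free (dual_basis_fg xL).
have [y [m [ym tr]]] := free_trace phi_bij.
exists r; rewrite -tr -(trace_unique xL ym).
by rewrite rmorph_sum; apply: eq_bigr => j _; rewrite LE.
Qed.

End ConstantRank.

Section Degrees.
Variables (k : numClosedFieldType) (C : comPzRingType) (s : {rmorphism k -> C}).

Lemma base_change_degree (D : comPzRingType) (u : {rmorphism C -> D}) (A : algebra C) n :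
  azumaya A -> constant_degree A n -> constant_degree (base_change u A) n.
Proof.
move=> azA; have [N [x [l [w [xl _ _ _ _]]]]] := azumaya_dataP azA.
have [L [xL LE]] := bc_dual_basis u xl.
move=> /(constant_degreeP s xl) An; apply/(constant_degreeP (u \o s) xL) => F f.
rewrite -(An F (f \o u)) /= !rmorph_sum; apply: eq_bigr => i _.
by rewrite LE.
Qed.

Lemma tens_degree (A B : algebra C) n m : azumaya A -> azumaya B ->
  constant_degree A n -> constant_degree B m -> constant_degree (tens_alg A B) (n * m).
Proof.
move=> azA azB; have [N [x [l [_ [xl _ _ _ _]]]]] := azumaya_dataP azA.
have [M [y [p [_ [yp _ _ _ _]]]]] := azumaya_dataP azB.
have [L [xL LE]] := tens_dual_basis xl yp.
move=> /(constant_degreeP s xl) An /(constant_degreeP s yp) Bm.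
apply/(constant_degreeP s xL) => F f; rewrite expnMn natrM -(An F f) -(Bm F f).
rewrite -rmorphM mulr_suml; under [in RHS]eq_bigr => i _ do rewrite mulr_sumr.
by rewrite pair_big; congr (f _); apply: eq_bigr => i _; rewrite LE.
Qed.

Lemma mat_degree n : constant_degree (mat_alg C n) n.
Proof.
apply/(constant_degreeP s (mat_dual_basis C n)) => F f.
rewrite -(rmorph_nat f) /trace; congr (f _).
under eq_bigr => p _ do rewrite mxE !eqxx.
by rewrite sumr_const card_prod card_ord mulnn.
Qed.

Lemma zero_degree (A : algebra C) n : (1 : C) = 0 -> constant_degree A n.
Proof.
move=> C0 F f _; have /eqP := congr1 f C0; by rewrite rmorph1 rmorph0 oner_eq0.
Qed.

Variables (A B : algebra C) (f : {rmorphism A -> B}).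
Hypotheses (fs : forall c, f (scalar A c) = scalar B c) (azA : azumaya A) (azB : azumaya B).

(** The trace of [B] is the product of those of [A] and of the centralizer, so [n^2] divides [m^2]
    with quotient the rank of the centralizer at [e]. *)
Lemma degree_dvd (F : fieldType) (e : {rmorphism C -> F}) n m :
  constant_degree A n -> constant_degree B m -> (n %| m)%N.
Proof.
have [N [x [l [_ [xl _ _ _ _]]]]] := azumaya_dataP azA.
have [M [y [p [_ [yp _ _ _ _]]]]] := azumaya_dataP (centralizer_azumaya fs azA azB).
have [L [xL LE]] := centralizer_dual_basis fs azA xl yp.
move=> /(constant_degreeP s xl) An /(constant_degreeP s xL) Bm.
have [r rE] := trace_nat yp e.
rewrite -(@dvdn_pexp2r _ _ 2) //; apply/dvdnP; exists r.
apply: (natr_field_inj s e); rewrite -(Bm F e) natrM mulrC -(An F e) -rE -rmorphM.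
congr (e _); rewrite mulr_suml; under [in RHS]eq_bigr => i _ do rewrite mulr_sumr.
by rewrite pair_big; apply: eq_bigr => i _; rewrite LE.
Qed.

Lemma centralizer_degree n m : (0 < n)%N -> constant_degree A n ->
  constant_degree B (n * m) -> constant_degree (cent_alg f) m.
Proof.
move=> n0; have [N [x [l [_ [xl _ _ _ _]]]]] := azumaya_dataP azA.
have [M [y [p [_ [yp _ _ _ _]]]]] := azumaya_dataP (centralizer_azumaya fs azA azB).
have [L [xL LE]] := centralizer_dual_basis fs azA xl yp.
move=> /(constant_degreeP s xl) An /(constant_degreeP s xL) Bm.
apply/(constant_degreeP s yp) => F e.
have n2 : (n ^ 2)%:R != 0 :> F.
  by apply/eqP => /(natr_field_inj s e (n := 0))/eqP; rewrite expn_eq0 eqn0Ngt n0.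
apply: (mulfI n2); rewrite -natrM -expnMn -(Bm F e) -(An F e) -rmorphM.
congr (e _); rewrite mulr_suml; under [in LHS]eq_bigr => i _ do rewrite mulr_sumr.
by rewrite pair_big; apply: eq_bigr => i _; rewrite LE.
Qed.

End Degrees.

(** * Fibers at closed points *)

Section Wedderburn.
Variables (k : closedFieldType) (W : algebra k).
Hypothesis azW : azumaya W.

Lemma wedderburn_one_neq0 : (1 : W) != 0.
Proof.
apply/eqP => W0; have := @azumaya_scalar_inj k W azW 1 0.
by rewrite rmorph1 rmorph0 => /(_ W0)/eqP; rewrite oner_eq0.
Qed.

Variables (r : nat) (phi : {linear 'rV[k]_r -> asmod W}) (psi : W -> 'rV[k]_r).
Hypotheses (phiK : cancel phi psi) (psiK : forall a, phi (psi a) = a).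

Lemma wpsiD a b : psi (a + b) = psi a + psi b.
Proof. by rewrite -{1}(psiK a) -{1}(psiK b) -(linearD phi) phiK. Qed.

Lemma wpsiZ c a : psi (scalar W c * a) = c *: psi a.
Proof. by rewrite -{1}(psiK a) -asmod_scaleE -linearZ phiK. Qed.

Lemma wpsi0 : psi 0 = 0.
Proof. by apply: (addrI (psi 0)); rewrite -wpsiD !addr0. Qed.

Lemma wpsi_inj a b : psi a = psi b -> a = b.
Proof. by move=> E; rewrite -(psiK a) E psiK. Qed.

Definition rmul_fun (v : W) (u : 'rV[k]_r) : 'rV[k]_r := psi ((phi u : W) * v).

Lemma rmul_linear v : linear (rmul_fun v).
Proof.
move=> c u w; rewrite /rmul_fun linearP asmod_scaleE.
by rewrite [(_ + _) * v]mulrDl -mulrA wpsiD wpsiZ.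
Qed.

HB.instance Definition _ v := GRing.isLinear.Build _ _ _ _ (rmul_fun v) (rmul_linear v).

Definition lideal (v : W) : {vspace 'rV[k]_r} := limg (linfun (rmul_fun v)).

Lemma lidealP v y : reflect (exists w, y = w * v) (psi y \in lideal v).
Proof.
apply: (iffP memv_imgP) => [[u _]|[w ->]].
  by rewrite lfunE /= => /wpsi_inj->; exists (phi u).
by exists (psi w); rewrite ?memvf // lfunE /= /rmul_fun psiK.
Qed.

Lemma exists_minimal_lideal : exists2 v : W, v != 0 &
  forall w, w * v != 0 -> exists t, v = t * (w * v).
Proof.
pose P d := `[< exists2 v : W, v != 0 & \dim (lideal v) = d >].
have exP : exists d, P d.
  by exists (\dim (lideal 1)); apply/asboolP; exists 1 => //; apply: wedderburn_one_neq0.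
case: (ex_minnP exP) => d /asboolP[v v0 vd] dmin; exists v => // w wv0.
have sub : (lideal (w * v) <= lideal v)%VS.
  apply/subvP => y; rewrite -[y]phiK => /lidealP[t ->].
  by apply/lidealP; exists (t * w); rewrite mulrA.
have /eqP E : (lideal (w * v) == lideal v)%VS.
  rewrite eqEdim sub vd; apply: dmin.
  by apply/asboolP; exists (w * v).
by apply/lidealP; rewrite E; apply/lidealP; exists 1; rewrite mul1r.
Qed.

(* A generator of a minimal left ideal has rank one, by Schur's lemma.         *)
Lemma minimal_lideal_rank1 (v w : W) : v != 0 ->
  (forall w, w * v != 0 -> exists t, v = t * (w * v)) ->
  exists c, v * w * v = scalar W c * v.
Proof.
move=> v0 vmin; pose z := w * v.
(* This is [v * p(z)]; a polynomial of least degree with [ev p = 0] will be shown to have degree one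
   in effect. *)
pose ev (p : {poly k}) : W := \sum_(i < size p) scalar W p`_i * (v * z ^+ i).
have ev_widen n (p : {poly k}) : (size p <= n)%N ->
    ev p = \sum_(i < n) scalar W p`_i * (v * z ^+ i).
  move=> pn; rewrite /ev (big_ord_widen n (fun i => scalar W p`_i * (v * z ^+ i))) //.
  rewrite big_mkcond; apply: eq_bigr => i _; case: ltnP => // /leq_sizeP -> //.
  by rewrite rmorph0 mul0r.
have evD p q : ev (p + q) = ev p + ev q.
  pose n := maxn (size p) (size q).
  rewrite !(@ev_widen n) ?leq_maxl ?leq_maxr ?size_polyD // -big_split /=.
  by apply: eq_bigr => i _; rewrite coefD rmorphD mulrDl.
have evX p : ev (p * 'X) = ev p * z.
  rewrite (@ev_widen (size p).+1); last first.
    by have [->|/size_mulX->//] := eqVneq p 0; rewrite mul0r size_poly0.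
  rewrite big_ord_recl coefMX rmorph0 mul0r add0r mulr_suml.
  by apply: eq_bigr => i _; rewrite coefMX /= -!mulrA -exprSr.
have evZ c p : ev (c *: p) = scalar W c * ev p.
  rewrite (@ev_widen (size p)) ?size_scale_leq // mulr_sumr.
  by apply: eq_bigr => i _; rewrite coefZ rmorphM -mulrA.
have evC c : ev c%:P = scalar W c * v.
  by rewrite (@ev_widen 1) ?size_polyC_leq1 // big_ord1 coefC mulr1.
have ev_lideal p : exists x, ev p = x * v.
  elim/poly_ind: p => [|p c [x E]].
    by exists 0; rewrite /ev size_poly0 big_ord0 mul0r.
  exists (x * v * w + scalar W c).
  by rewrite evD evX E evC mulrDl !mulrA.
pose P n := `[< exists p : {poly k}, [/\ p != 0, ev p = 0 & size p = n] >].
have exP : exists n, P n.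
  pose M : 'M[k]_(r.+1, r) := \matrix_(i < r.+1) psi (v * z ^+ i).
  have [c c0 cM] := linear_dependence M (ltnSn r).
  exists (size (rVpoly c)); apply/asboolP; exists (rVpoly c); split=> //.
    by apply: contraNneq c0 => c0; rewrite -(rVpolyK c) c0 linear0.
  rewrite (ev_widen r.+1) ?size_poly //; apply: wpsi_inj; rewrite wpsi0 -cM mulmx_sum_row.
  have psi_sum n (F : 'I_n -> W) : psi (\sum_i F i) = \sum_i psi (F i).
    by elim/big_rec2: _ => [|i x y _ <-]; rewrite ?wpsi0 ?wpsiD.
  rewrite psi_sum; apply: eq_bigr => i _.
  by rewrite coef_rVpoly_ord wpsiZ rowK.
case: (ex_minnP exP) => n /asboolP[p [p0 evp pn]] nmin.
have p1 : size p != 1.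
  apply/eqP => /eqP/size_poly1P[c c0 pc]; move/eqP: v0; apply.
  have : scalar W c^-1 * ev p = 0 by rewrite evp mulr0.
  by rewrite pc evC mulrA -rmorphM mulVf // rmorph1 mul1r.
(* Split off a root [c] of [p]. By minimality [ev q] is nonzero, so it generates [W v]; a left
   multiplier [t] taking it back to [v] turns [ev p = 0] into [v * z = c * v]. *)
have /closed_rootP[c /factor_theorem[q pq]] := p1.
have q0 : q != 0 by apply: contraNneq p0 => q0; rewrite pq q0 mul0r.
have evq : ev q != 0.
  apply/eqP => evq; have /nmin : P (size q) by apply/asboolP; exists q.
  by rewrite -pn pq size_Mmonic ?monicXsubC // size_XsubC addn2 ltnn.
have [x xE] := ev_lideal q; rewrite xE in evq.
have [t vE] := vmin x evq; exists c.
have : t * ev p = 0 by rewrite evp mulr0.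
have -> : p = q * 'X + (- c) *: q by rewrite pq mulrBr [q * c%:P]mulrC mul_polyC scaleNr.
rewrite evD evX evZ xE rmorphN mulNr mulrBr (mulrA t) -vE.
rewrite (mulrA t (scalar W c)) -scalar_central -mulrA -vE => /eqP.
by rewrite subr_eq0 /z mulrA => /eqP.
Qed.

(** The two-sided ideal of [v] is everything: some functional of a dual basis is nonzero at [v], and
    it is realized by sandwiching. *)
Lemma rank1_unit (v : W) : v != 0 ->
  exists (n : nat) (p q : 'I_n -> W), \sum_i p i * v * q i = 1.
Proof.
move=> v0; have [N [x [l [w [[lin xl] wE _ _ _]]]]] := azumaya_dataP azW.
have [j lj] : exists j, l j v != 0.
  apply: contrapT => nj; move/eqP: v0; apply; rewrite (xl v) big1 // => j _.
  have [->|lj] := eqVneq (l j v) 0; first by rewrite rmorph0 mul0r.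
  by case: nj; exists j.
have : sw (w j) (scalar W (l j v)^-1 * v) = 1.
  by rewrite wE; have [_ ->] := lin j; rewrite mulVf // rmorph1.
suff [n [p [q <-]]] : exists n (p q : 'I_n -> W),
    \sum_i p i * v * q i = sw (w j) (scalar W (l j v)^-1 * v) by exists n, p, q.
elim/talg_ind: (w j) => [|a b|t t' [n [p [q E]]] [n' [p' [q' E']]]].
- by exists 0%N, (fun=> 0), (fun=> 0); rewrite sw0l big_ord0.
- exists 1%N, (fun=> a * scalar W (l j v)^-1), (fun=> b).
  by rewrite big_ord1 sw_pure !mulrA.
- exists (n + n')%N, (fun i => match split i with inl i => p i | inr i => p' i end).
  exists (fun i => match split i with inl i => q i | inr i => q' i end).
  rewrite swDl -E -E' big_split_ord; congr (_ + _); apply: eq_bigr => i _.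
    by rewrite -[lshift _ _]/(unsplit (inl i)) unsplitK.
  by rewrite -[rshift _ _]/(unsplit (inr i)) unsplitK.
Qed.

(** [W] acts on the minimal left ideal [W v], faithfully because [W v W = W]. A matrix [M] is
    realized by [\sum_j s_j v q_j] with [s_j v] the image of [p_j v] under [M], since [v q_j t v] is
    a multiple of [v] for every [t]. *)
Lemma wedderburn_basis : exists (a : nat) (g : {rmorphism W -> 'M[k]_a}),
  [/\ (0 < a)%N, forall c, g (scalar W c) = c%:M & bijective g].
Proof.
have [v v0 vmin] := exists_minimal_lideal.
have /choice[tau tauE] w := minimal_lideal_rank1 w v0 vmin.
have [n [p [q pq1]]] := rank1_unit v0.
pose V := lideal v; pose a := \dim V; pose X := vbasis V.
pose f (i : 'I_a) : W := phi X`_i.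
pose kap (i : 'I_a) (y : W) : k := coord X i (psi y).
have kapD i y y' : kap i (y + y') = kap i y + kap i y' by rewrite /kap wpsiD linearD.
have kapZ i c y : kap i (scalar W c * y) = c * kap i y by rewrite /kap wpsiZ linearZ.
have kap0 i : kap i 0 = 0 by rewrite /kap wpsi0 linear0.
have kap_sum i m (F : 'I_m -> W) : kap i (\sum_j F j) = \sum_j kap i (F j).
  by elim/big_rec2: _ => [|j x y _ <-]; rewrite ?kap0 ?kapD.
have kapE w : w * v = \sum_i scalar W (kap i (w * v)) * f i.
  have /coord_vbasis E : psi (w * v) \in V by apply/lidealP; exists w.
  rewrite -{1}[w * v]psiK {1}E linear_sum; apply: eq_bigr => i _.
  by rewrite linearZ.
have /choice[t fE] i : exists t, f i = t * v.
  apply/lidealP; rewrite phiK; apply: vbasis_mem; apply: mem_nth.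
  by rewrite size_tuple.
have kapf i j : kap i (f j) = (i == j)%:R.
  by rewrite /kap phiK coord_free ?(basis_free (vbasisP V)) // eq_sym.
pose g (u : W) : 'M[k]_a := \matrix_(i, j) kap i (u * f j).
have gD : {morph g : x y / x + y}.
  by move=> x y; apply/matrixP => i j; rewrite !mxE mulrDl kapD.
have gM : {morph g : x y / x * y}.
  move=> x y; apply/matrixP => i j; rewrite !mxE [in LHS]fE -mulrA (mulrA y) (kapE (y * t j)).
  rewrite mulr_sumr kap_sum; apply: eq_bigr => m _.
  by rewrite !mxE mulrA -scalar_central -mulrA kapZ mulrC !fE !mulrA.
have g1 : g 1 = 1 by apply/matrixP => i j; rewrite !mxE mul1r kapf.
have [G GE] := exists_rmorphism g1 gD gM.
have act0 u : (forall i, u * f i = 0) -> u = 0.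
  move=> uf; rewrite -[u]mulr1 -pq1 mulr_sumr big1 // => i _.
  rewrite kapE mulrA mulr_sumr big1 ?mul0r // => j _.
  by rewrite mulrA -scalar_central -mulrA uf mulr0.
have Ginj : injective G.
  move=> x y xy; apply/eqP; rewrite -subr_eq0; apply/eqP/act0 => j.
  have Gxy : g (x - y) = 0 by rewrite -GE rmorphB xy subrr.
  rewrite fE mulrA kapE big1 // => i _; rewrite -mulrA -fE.
  by have := congr1 (fun M : 'M[k]_a => M i j) Gxy; rewrite !mxE => ->; rewrite rmorph0 mul0r.
have /choice[H HK] M : exists u, G u = M.
  pose s j := \sum_(i < a) \sum_(m < a) scalar W (M i m * kap m (p j * v)) * t i.
  have sE i j : kap i (s j * v) = \sum_m M i m * kap m (p j * v).
    rewrite mulr_suml kap_sum (bigD1 i) //= [X in _ + X]big1 => [|i' ii'].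
      rewrite addr0 mulr_suml kap_sum; apply: eq_bigr => m _.
      by rewrite -mulrA -fE kapZ kapf eqxx mulr1.
    rewrite mulr_suml kap_sum big1 // => m _.
    by rewrite -mulrA -fE kapZ kapf eq_sym (negbTE ii') mulr0.
  exists (\sum_j s j * v * q j); rewrite GE; apply/matrixP => i m0; rewrite mxE.
  have E y : v * q y * t m0 * v = scalar W (tau (q y * t m0)) * v.
    by rewrite -(mulrA v) tauE.
  transitivity (kap i (\sum_j scalar W (tau (q j * t m0)) * (s j * v))).
    congr (kap i _); rewrite mulr_suml; apply: eq_bigr => j _.
    by rewrite fE !mulrA -3!(mulrA (s j)) E mulrA -scalar_central.
  rewrite kap_sum; under eq_bigr => j _ do rewrite kapZ sE mulr_sumr.
  rewrite exchange_big; transitivity (\sum_m M i m * kap m (f m0)).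
    apply: eq_bigr => m _.
    have -> : f m0 = \sum_j scalar W (tau (q j * t m0)) * (p j * v).
      rewrite -[f m0]mul1r -pq1 mulr_suml; apply: eq_bigr => j _.
      by rewrite fE !mulrA -3!(mulrA (p j)) E mulrA -scalar_central.
    rewrite kap_sum mulr_sumr; apply: eq_bigr => j _.
    by rewrite kapZ mulrCA.
  rewrite (bigD1 m0) //= kapf eqxx mulr1 big1 ?addr0 // => m mm0.
  by rewrite kapf (negbTE mm0) mulr0.
exists a, G; split.
- rewrite lt0n; apply/eqP => a0; apply/negP: (wedderburn_one_neq0).
  by apply/negPn/eqP/act0 => i; have := ltn_ord i; rewrite {2}a0.
- by move=> c; apply/matrixP => i j; rewrite GE !mxE kapZ kapf mulr_natr.
- by exists H => // x; apply: Ginj.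
Qed.

End Wedderburn.

Lemma wedderburn (k : closedFieldType) (W : algebra k) : azumaya W ->
  exists (a : nat) (g : {rmorphism W -> 'M[k]_a}),
  [/\ (0 < a)%N, forall c, g (scalar W c) = c%:M & bijective g].
Proof.
move=> azW; have [fgW _ _] := azW.
have [r [phi [psi phiK psiK]]] := fg_projective_field_free fgW.
exact: (wedderburn_basis azW phiK psiK).
Qed.

Definition free_basis (C : comPzRingType) (A : algebra C) (I : finType)
    (x : I -> A) (l : I -> A -> C) : Prop :=
  dual_basis x l /\ forall i j, l j (x i) = (i == j)%:R.

Lemma bc_free_basis (C D : comPzRingType) (s : {rmorphism C -> D}) (A : algebra C)
    (I : finType) (x : I -> A) (l : I -> A -> C) : free_basis x l ->
  exists L : I -> base_change s A -> D, free_basis (fun i => bcj s A (x i)) L /\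
    forall i a, L i (bcj s A a) = s (l i a).
Proof.
move=> [xl lx]; have [L [xL LE]] := bc_dual_basis s xl; exists L; split=> //.
by split=> // i j; rewrite LE lx rmorph_nat.
Qed.

Lemma free_basis_trace (C : comPzRingType) (A : algebra C) (I : finType)
    (x : I -> A) (l : I -> A -> C) : free_basis x l -> trace x l = #|I|%:R.
Proof.
by move=> [_ lx]; rewrite /trace; under eq_bigr => i _ do rewrite lx eqxx;
  rewrite sumr_const.
Qed.

(** * Freeness and degree near a point *)

Section Local.
Variables (k : numClosedFieldType) (D : commalg k) (e : {rmorphism D -> k}).
Hypothesis ep : rational_point e.

(* With [M] the idempotent matrix of a dual basis and [M0] its value at [e],   *)
(* extended as a constant matrix, [M M0 + (1 - M)(1 - M0)] conjugates [M] into *)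
(* [M0] wherever it is invertible, and it is the identity at [e].              *)
Lemma free_near_point (A : algebra D) : azumaya A ->
  exists c (L : commalg k) (l : commalg_hom D L) r
    (x : 'I_r -> base_change l A) (m : 'I_r -> base_change l A -> L),
  [/\ e c != 0, localization_away l c & free_basis x m].
Proof.
move=> azA; have [N [x [l [_ [[lin xl] _ _ _ _]]]]] := azumaya_dataP azA.
pose s := commalg_scalar D.
pose M : 'M[D]_N := \matrix_(i, j) l j (x i).
have lrow a j : l j a = \sum_i l i a * M i j.
  rewrite {1}(xl a) (alinear_sum _ _ _ (lin j)); apply: eq_bigr => i _.
  by rewrite mxE; have [_ ->] := lin j.
have MM : M *m M = M.
  by apply/matrixP => i j; rewrite mxE [RHS]mxE lrow; apply: eq_bigr => m _; rewrite !mxE.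
have [|r [P [Q [PQ QP]]]] := @idempotent_mx_factor k N (map_mx e M).
  by rewrite -map_mxM MM.
pose M0 := map_mx s (map_mx e M).
have M0M0 : M0 *m M0 = M0 by rewrite -map_mxM -map_mxM MM.
pose u := M *m M0 + (1%:M - M) *m (1%:M - M0).
have Mu : M *m u = u *m M0.
  rewrite mulmxDr !mulmxA MM (mulmxBr M) mulmx1 MM subrr mul0mx addr0.
  by rewrite mulmxDl -!mulmxA M0M0 (mulmxBl _ _ M0) mul1mx M0M0 subrr mulmx0 addr0.
have es : map_mx e M0 = map_mx e M.
  by apply/matrixP => i j; rewrite !mxE; apply: ep.
have eu : e (\det u) = 1.
  rewrite -det_map_mx (_ : map_mx e u = 1%:M) ?det1 //.
  have eM : map_mx e M *m map_mx e M = map_mx e M by rewrite -PQ mulmxA -(mulmxA P) QP mulmx1.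
  rewrite map_mxD !map_mxM !map_mxB !map_mx1 es eM.
  rewrite mulmxBr mulmx1 mulmxBl mul1mx eM subrr subr0.
  by rewrite addrC subrK.
have [L [h hL]] := exists_localization (\det u) (point_neq0 e).
have [[d dE] _ _] := hL.
pose M' := map_mx h M; pose u' := map_mx h u; pose M0' := map_mx h M0.
pose W := d *: \adj u'.
have Wu : W *m u' = 1%:M.
  by rewrite -scalemxAl mul_adj_mx det_map_mx scale_scalar_mx dE.
have uW : u' *m W = 1%:M.
  by rewrite -scalemxAr mul_mx_adj det_map_mx scale_scalar_mx dE.
have Mu' : M' *m u' = u' *m M0' by rewrite -!map_mxM Mu.
pose P' := map_mx h (map_mx s P); pose Q' := map_mx h (map_mx s Q).
have PQ' : P' *m Q' = M0' by rewrite -!map_mxM PQ.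
have QP' : Q' *m P' = 1%:M by rewrite -!map_mxM QP !map_mx1.
have [ll [[llin xll] llE]] := bc_dual_basis h (conj lin xl).
set x' := fun i => bcj h A (x i) in xll.
pose ro a : 'rV[L]_N := \row_j ll j a.
have roD a b : ro (a + b) = ro a + ro b.
  by apply/rowP => j; rewrite !mxE; case: (llin j).
have roZ c a : ro (scalar _ c * a) = c *: ro a.
  by apply/rowP => j; rewrite !mxE; case: (llin j).
have ro0 : ro 0 = 0 by apply/rowP => j; rewrite !mxE (alinear0 (llin j)).
have rox i : ro (x' i) = row i M' by apply/rowP => j; rewrite !mxE llE.
have ro_sum (v : 'rV[L]_N) : ro (\sum_i scalar _ (v 0 i) * x' i) = v *m M'.
  rewrite mulmx_sum_row; elim/big_rec2: _ => [|i a b _ <-]; first by rewrite ro0.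
  by rewrite roD roZ rox.
have roM a : ro a *m M' = ro a.
  rewrite -ro_sum; congr ro; rewrite [RHS]xll; apply: eq_bigr => i _; by rewrite mxE.
pose y s := \sum_i scalar (base_change h A) ((Q' *m W) s i) * x' i.
pose m s a := (ro a *m u' *m P') 0 s.
exists (\det u), L, h, r, y, m; split=> //; first by rewrite eu oner_neq0.
split; first split=> [t|a].
- split=> [a b|c a]; rewrite /m; first by rewrite roD !mulmxDl mxE.
  by rewrite roZ -!scalemxAl mxE.
- have -> : \sum_i scalar _ (m i a) * y i =
      \sum_i scalar _ ((ro a *m u' *m P' *m (Q' *m W)) 0 i) * x' i.
    under eq_bigr => i _ do rewrite mulr_sumr.
    rewrite exchange_big; apply: eq_bigr => j _.
    rewrite [in RHS]mxE rmorph_sum mulr_suml; apply: eq_bigr => i _.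
    by rewrite rmorphM mulrA.
  rewrite -mulmxA (mulmxA P') PQ' -!mulmxA (mulmxA u') -Mu' -mulmxA uW mulmx1 roM.
  by rewrite {1}(xll a); apply: eq_bigr => i _; rewrite mxE.
- move=> i j; rewrite /m.
  have -> : ro (y i) = row i (Q' *m W) *m M'.
    rewrite -ro_sum; congr ro; apply: eq_bigr => t _; by rewrite [in RHS]mxE.
  have -> : row i (Q' *m W) *m M' *m u' *m P' = row i 1%:M.
    rewrite -!row_mul; congr (row i _).
    rewrite -(mulmxA (Q' *m W)) Mu' mulmxA -(mulmxA Q' W) Wu mulmx1.
    by rewrite -PQ' mulmxA QP' mul1mx QP'.
  by rewrite !mxE.
Qed.

(** The fiber is a matrix algebra by [wedderburn], and since [e] is a rational point [A] itself maps
    onto it. *)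
Lemma point_fiber (A : algebra D) : azumaya A ->
  exists (a : nat) (g : {rmorphism A -> 'M[k]_a}),
  [/\ (0 < a)%N, forall d, g (scalar A d) = (e d)%:M, forall M, exists u, g u = M,
      forall (I : finType) (x : I -> A) l, dual_basis x l -> e (trace x l) = (a ^ 2)%:R &
      forall (I : finType) (x : I -> A) l, free_basis x l ->
        forall c : I -> k, \sum_i c i *: g (x i) = 0 -> forall i, c i = 0].
Proof.
move=> azA; have azW := base_change_azumaya e azA.
have [a [th [a0 thE [th' thK th'K]]]] := wedderburn azW.
pose g : {rmorphism A -> 'M[k]_a} := th \o bcj e A.
have gE d : g (scalar A d) = (e d)%:M by rewrite /= bcj_scalar thE.
have scE c (M : 'M[k]_a) : c%:M * M = c *: M by apply: mul_scalar_mx.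
exists a, g; split=> //.
- move=> M; rewrite -(th'K M); elim/bc_ind: (th' M) => [|d b|x y [u gu] [v gv]].
  + by exists 0; rewrite !rmorph0.
  + exists (scalar A (commalg_scalar D d) * b).
    by rewrite rmorphM gE ep (rmorphM th) thE.
  + by exists (u + v); rewrite rmorphD gu gv (rmorphD th).
- move=> I x l xl; have [L [xL LE]] := bc_dual_basis e xl.
  have [lM dM] := mat_dual_basis k a.
  have ym : dual_basis (fun p : 'I_a * 'I_a => th' (delta_mx p.1 p.2))
      (fun p z => th z p.1 p.2).
    split=> [p|z]; first split=> [z t|c z].
    + by rewrite rmorphD mxE.
    + by rewrite rmorphM thE scE mxE.
    rewrite -{1}(thK z); apply: (can_inj thK); rewrite th'K {1}(dM (th z)) rmorph_sum.
    by apply: eq_bigr => p _; rewrite rmorphM thE th'K.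
  transitivity (trace (fun i => bcj e A (x i)) L).
    by rewrite rmorph_sum; apply: eq_bigr => i _; rewrite LE.
  rewrite (trace_unique xL ym) /trace.
  under eq_bigr => p _ do rewrite th'K mxE !eqxx.
  by rewrite sumr_const card_prod card_ord mulnn.
- move=> I x l /(bc_free_basis e)[L [[[Llin _] Lx] LE]] c c0 i.
  have : \sum_j scalar (base_change e A) (c j) * bcj e A (x j) = 0.
    apply: (can_inj thK); rewrite rmorph0 -c0 rmorph_sum; apply: eq_bigr => j _.
    by rewrite rmorphM thE scE.
  move=> /(congr1 (L i)); rewrite (alinear0 (Llin i)) (alinear_sum _ _ _ (Llin i)).
  rewrite (bigD1 i) //= [X in _ + X]big1 => [|j ji]; have [_ LZ] := Llin i.
    by rewrite LZ Lx eqxx mulr1 addr0.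
  by rewrite LZ Lx (negbTE ji) mulr0.
Qed.

Lemma degree_near_point (A : algebra D) : azumaya A ->
  exists a c (L : commalg k) (l : commalg_hom D L),
  [/\ (0 < a)%N, e c != 0, localization_away l c & constant_degree (base_change l A) a].
Proof.
move=> azA; have [N [x [m [_ [xm _ _ _ _]]]]] := azumaya_dataP azA.
have [a [g [a0 _ _ ga _]]] := point_fiber azA.
have [c [L [l [r [y [n [ec lc yn]]]]]]] := free_near_point azA.
exists a, c, L, l; split=> //.
have [e' [ep' e'E]] := point_extend ep lc ec.
have [M [xM ME]] := bc_dual_basis l xm.
(* Both numbers are the trace at the point. *)
have ra : r = (a ^ 2)%N.
  have tE : e' (trace y n) = r%:R by rewrite (free_basis_trace yn) card_ord rmorph_nat.
  apply/eqP; rewrite -(@eqr_nat k) -(ga _ _ _ xm) -e'E -tE -(trace_unique xM yn.1).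
  apply/eqP; congr (e' _); rewrite rmorph_sum.
  by apply: eq_bigr => i _; rewrite ME.
apply/(constant_degreeP (commalg_scalar L) yn.1) => F f.
by rewrite (free_basis_trace yn) card_ord ra rmorph_nat.
Qed.

End Local.

(** * Etale splitting *)

Lemma delta_mul_delta (R : comPzRingType) n (M : 'M[R]_n) i j s t :
  delta_mx i j *m M *m delta_mx s t = M j s *: delta_mx i t :> 'M[R]_n.
Proof.
rewrite -(mul_delta_mx (0 : 'I_1) i j) -(mul_delta_mx (0 : 'I_1) s t) !mulmxA.
rewrite -(mulmxA _ _ M) -rowE -(mulmxA _ (row j M)) -colE [col s _]mx11_scalar !mxE.
by rewrite mul_mx_scalar -scalemxAl mul_delta_mx.
Qed.

Section FreeBases.
Variables (C : comPzRingType) (A : algebra C).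

Lemma free_basis_inj (I : finType) (x : I -> A) (l : I -> A -> C) (c d : I -> C) :
  free_basis x l -> \sum_i scalar A (c i) * x i = \sum_i scalar A (d i) * x i -> c =1 d.
Proof.
move=> [[lin _] lx] cd i.
have E (b : I -> C) : l i (\sum_j scalar A (b j) * x j) = b i.
  rewrite (alinear_sum _ _ _ (lin i)) (bigD1 i) //= big1 => [|j ji]; have [_ lZ] := lin i.
    by rewrite lZ lx eqxx mulr1 addr0.
  by rewrite lZ lx (negbTE ji) mulr0.
by rewrite -(E c) cd E.
Qed.

Lemma free_basis_change N (x : 'I_N -> A) (l : 'I_N -> A -> C) (I : finType)
    (y : I -> A) (en : I -> 'I_N) (ne : 'I_N -> I) (V : 'M[C]_N) :
  free_basis x l -> cancel en ne -> cancel ne en ->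
  (\matrix_(i, j) l j (y (ne i))) *m V = 1%:M -> V *m (\matrix_(i, j) l j (y (ne i))) = 1%:M ->
  exists m, free_basis y m.
Proof.
move=> [[lin xl] lx] enK neK WV VW; set W := \matrix_(i, j) _ in WV VW.
pose ro a : 'rV[C]_N := \row_j l j a.
exists (fun i a => (ro a *m V) 0 (en i)); split; first split=> [i|a].
- split=> [a b|c a].
    have -> : ro (a + b) = ro a + ro b.
      by apply/rowP => j; rewrite !mxE; case: (lin j).
    by rewrite mulmxDl mxE.
  have -> : ro (scalar A c * a) = c *: ro a.
    by apply/rowP => j; rewrite !mxE; case: (lin j).
  by rewrite -scalemxAl mxE.
- rewrite (reindex ne) /=; last by exists en => i _.
  have yE i : y (ne i) = \sum_j scalar A (W i j) * x j.
    by rewrite {1}(xl (y _)); apply: eq_bigr => j _; rewrite mxE.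
  under eq_bigr => i _ do rewrite neK yE mulr_sumr.
  rewrite exchange_big {1}(xl a); apply: eq_bigr => j _.
  under eq_bigr => i _ do rewrite mulrA -rmorphM.
  rewrite -mulr_suml -rmorph_sum; congr (scalar A _ * _).
  transitivity ((ro a *m V *m W) 0 j); last by rewrite mxE.
  by rewrite -mulmxA VW mulmx1 mxE.
- move=> i j.
  have -> : ro (y i) = row (en i) W by apply/rowP => t; rewrite !mxE enK.
  by rewrite -row_mul WV !mxE (can_eq enK).
Qed.

(* In the basis [p l * v * q m] multiplication reads [M, M' |-> M G M'], where *)
(* [G] is inverse to the coordinate matrix of 1.                               *)
Lemma rank1_split (a : nat) (p q : 'I_a -> A) (v : A) (tau : A -> C)
    (m : 'I_a * 'I_a -> A -> C) :
  (forall y, v * y * v = scalar A (tau y) * v) ->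
  free_basis (fun i => p i.1 * v * q i.2) m ->
  exists g : {rmorphism A -> 'M[C]_a}, forall c, g (scalar A c) = c%:M.
Proof.
move=> vv [[lin xm] mx].
pose co u : 'M[C]_a := \matrix_(i, j) m (i, j) u.
pose G : 'M[C]_a := \matrix_(i, j) tau (q i * p j).
have coD u w : co (u + w) = co u + co w.
  by apply/matrixP => i j; rewrite !mxE; case: (lin (i, j)).
have coZ c u : co (scalar A c * u) = c *: co u.
  by apply/matrixP => i j; rewrite !mxE; case: (lin (i, j)).
have co0 : co 0 = 0 by apply/matrixP => i j; rewrite !mxE (alinear0 (lin _)).
have co_sum (T : finType) (F : T -> A) : co (\sum_i F i) = \sum_i co (F i).
  by elim/big_rec2: _ => [|i x y _ <-]; rewrite ?co0 ?coD.
have cob i j : co (p i * v * q j) = delta_mx i j.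
  apply/matrixP => s t; rewrite !mxE (mx (i, j) (s, t)) xpair_eqE.
  by rewrite eq_sym [j == t]eq_sym.
have xm' u : u = \sum_i \sum_j scalar A (co u i j) * (p i * v * q j).
  rewrite {1}(xm u) pair_big /=; apply: eq_bigr => i _; rewrite mxE.
  by case: i.
have coM u w : co (u * w) = co u * G * co w.
  rewrite {1}(xm' u) {1}(xm' w) mulr_suml co_sum.
  under eq_bigr => i _ do rewrite mulr_suml co_sum.
  rewrite [X in _ = X * _ * _](matrix_sum_delta (co u)) !mulr_suml.
  apply: eq_bigr => i _; rewrite !mulr_suml; apply: eq_bigr => j _.
  rewrite mulr_sumr co_sum [X in _ = _ * X](matrix_sum_delta (co w)) mulr_sumr.
  apply: eq_bigr => s _; rewrite mulr_sumr co_sum mulr_sumr; apply: eq_bigr => t _.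
  have -> : scalar A (co u i j) * (p i * v * q j) * (scalar A (co w s t) * (p s * v * q t))
      = scalar A (co u i j * co w s t * tau (q j * p s)) * (p i * v * q t).
    have E : p i * v * q j * (p s * v * q t) = scalar A (tau (q j * p s)) * (p i * v * q t).
      transitivity (p i * (v * (q j * p s) * v) * q t); first by rewrite !mulrA.
      by rewrite vv !mulrA -scalar_central.
    rewrite -mulrA (mulrA (p i * v * q j)) -scalar_central -mulrA E.
    by rewrite !rmorphM !mulrA.
  rewrite coZ cob.
  rewrite -[RHS]/((co u i j *: delta_mx i j) *m G *m (co w s t *: delta_mx s t)).
  rewrite -!scalemxAl -scalemxAr delta_mul_delta !scalerA [G j s]mxE //.
have [u0 u0E] : exists u, co u = 1.
  exists (\sum_i p i * v * q i); rewrite co_sum.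
  under eq_bigr => i _ do rewrite cob.
  exact/esym/mx1_sum_delta.
have cG : co 1 * G = 1.
  have := coM 1 u0; rewrite mul1r u0E mulr1 => <- //.
have g1 : (fun u => co u * G) 1 = 1 by [].
have [||g gE] := @exists_rmorphism A 'M[C]_a (fun u => co u * G) g1.
- by move=> x y; rewrite coD mulrDl.
- by move=> x y; rewrite coM mulrA.
exists g => c; rewrite gE -[scalar A c]mulr1 coZ.
have -> : c *: co 1 = c%:M * co 1 by apply/esym/mul_scalar_mx.
by rewrite -mulrA cG mulr1.
Qed.

End FreeBases.

(* U is free on the orbit [w] of an element under the operator [y |-> X y + y Z], *)
(* and [chi] is the characteristic polynomial of this operator.  Over a ring in *)
(* which [chi] acquires a root [t], the element [v] generates the eigenspace of *)
(* [t]; the eigenspace is stable under [y |-> v y v], so v has rank one.        *)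
Section Cyclic.
Variables (D : comNzRingType) (U : algebra D) (X Z : U) (N' : nat).
Local Notation N := N'.+1.
Variables (w : nat -> U) (m : 'I_N -> U -> D).
Hypotheses (wS : forall n, w n.+1 = X * w n + w n * Z)
  (wm : free_basis (fun n : 'I_N => w n) m).

Definition cyc_poly : {poly D} := 'X^N - \poly_(n < N) (if insub n is Some i then m i (w N) else 0).
Local Notation chi := cyc_poly.

Lemma size_cyc : size chi = N.+1.
Proof.
rewrite /chi size_polyDl ?size_polyXn // size_polyN.
exact: leq_ltn_trans (size_poly _ _) (ltnSn _).
Qed.

Lemma cyc_monic : chi \is monic.
Proof.
apply/monicP; rewrite lead_coefE size_cyc /= coefB coefXn eqxx coef_poly ltnn.
exact: subr0.
Qed.

Lemma cyc_coef (n : 'I_N) : chi`_n = - m n (w N).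
Proof.
rewrite coefB coefXn coef_poly ltn_ord ltn_eqF // sub0r; congr (- _).
by rewrite insubT //= => lt; congr (m _ _); apply: val_inj.
Qed.

Lemma cyc_last : w N = - \sum_(n < N) scalar U chi`_n * w n.
Proof.
rewrite {1}(wm.1.2 (w N)) -sumrN; apply: eq_bigr => n _.
by rewrite cyc_coef rmorphN mulNr opprK.
Qed.

Variables (a : nat) (en : 'I_a * 'I_a -> 'I_N) (ne : 'I_N -> 'I_a * 'I_a).
Hypotheses (enK : cancel en ne) (neK : cancel ne en).
Variables (p q : 'I_a -> U).

(** The coordinates of the products [p_i v q_j] in the basis [w], before the root [t] is substituted
    for the indeterminate. *)
Definition cyc_mx : 'M[{poly D}]_N :=
  \matrix_(i, n) \sum_(j < N) drop_poly j.+1 chi * (m n (p (ne i).1 * w j * q (ne i).2))%:P.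

Variables (E : comPzRingType) (u : {rmorphism D -> E}) (t : E).
Hypothesis chit : peval u t chi = 0.

Let UE := base_change u U.
Let j := bcj u U.
Let K n := peval u t (drop_poly n chi).
(** The coefficients are those of [chi / (X - t)] in Horner's scheme, so this quotient is evaluated
    at the operator and applied to [w 0]. *)
Definition cyc_vec : UE := \sum_(n < N) scalar UE (K n.+1) * j (w n).
Local Notation v := cyc_vec.

Let K0 : K 0 = 0.
Proof. by rewrite /K drop_poly0l. Qed.

Lemma cyc_coef_last : peval u t (drop_poly N chi) = 1.
Proof.
have -> : drop_poly N chi = 1.
  apply/polyP => i; rewrite coef_drop_poly coef1.
  case: i => [|i]; last by rewrite nth_default // size_cyc addSn ltnS leq_addl.
  by rewrite add0n; move/monicP: cyc_monic; rewrite lead_coefE size_cyc.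
exact: (rmorph1 (peval u t)).
Qed.

Let KN : K N = 1.
Proof. exact: cyc_coef_last. Qed.

Let KS n : K n = K n.+1 * t + u chi`_n.
Proof.
rewrite -(pevalC u t) -pevalMX -pevalD; congr (peval u t _); apply/polyP => i.
rewrite coefD coefMX coefC !coef_drop_poly; case: i => [|i] /=; first by rewrite add0r.
by rewrite addr0 addnS addSn.
Qed.

Let phi (y : UE) : UE := j X * y + y * j Z.

Let shift (b : nat -> E) (n : nat) : E := if n is n'.+1 then b n' else 0.

Let phi_shift (b : nat -> E) :
  phi (\sum_(n < N) scalar UE (b n) * j (w n)) =
  \sum_(n < N) scalar UE (shift b n - b N' * u chi`_n) * j (w n).
Proof.
have phiD (T : finType) (F : T -> UE) : phi (\sum_i F i) = \sum_i phi (F i).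
  by rewrite /phi mulr_sumr mulr_suml -big_split.
have phiZ c y : phi (scalar UE c * y) = scalar UE c * phi y.
  by rewrite /phi mulrDr !mulrA -scalar_central.
have phiw n : phi (j (w n)) = j (w n.+1) by rewrite wS rmorphD !rmorphM.
rewrite phiD; under eq_bigr => n _ do rewrite phiZ phiw.
under [RHS]eq_bigr => n _ do rewrite rmorphB mulrBl.
rewrite sumrB big_ord_recr [in RHS]big_ord_recl rmorph0 mul0r add0r; congr (_ + _).
rewrite cyc_last rmorphN mulrN rmorph_sum mulr_sumr; congr (- _).
by apply: eq_bigr => n _; rewrite !rmorphM bcj_scalar mulrA.
Qed.

Lemma cyc_vec_eigen : phi v = scalar UE t * v.
Proof.
rewrite /v (phi_shift (fun n => K n.+1)) mulr_sumr; apply: eq_bigr => n _.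
rewrite mulrA -rmorphM KN mul1r; congr (scalar UE _ * _).
case: n => [[|n] /= nN]; apply/eqP; rewrite subr_eq mulrC -KS ?K0 //.
Qed.

(** In the basis [w] the eigenvalue equation is a descending recursion, governed by the last
    coordinate [b N']. *)
Let phi_eigen y : phi y = scalar UE t * y -> exists c, y = scalar UE c * v.
Proof.
have [M [WM ME]] := bc_free_basis u wm.
pose b n := if insub n is Some i then M i y else 0.
have bE (i : 'I_N) : b i = M i y.
  by rewrite /b insubT //= => lt; congr (M _ _); apply: val_inj.
have yE : y = \sum_(n < N) scalar UE (b n) * j (w n).
  by rewrite {1}(WM.1.2 y); apply: eq_bigr => n _; rewrite bE.
move=> phiy; rewrite {1}yE phi_shift {1}yE mulr_sumr in phiy.
have bS n : (n < N)%N -> shift b n - b N' * u chi`_n = t * b n.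
  move=> nN; apply: (free_basis_inj (c := fun n : 'I_N => shift b n - b N' * u chi`_n)
    (d := fun n : 'I_N => t * b n) WM _ (Ordinal nN)).
  by rewrite -[LHS]/(\sum_(n < N) _) phiy; apply: eq_bigr => i _; rewrite rmorphM mulrA.
have bK d n : (n + d)%N = N' -> b n = b N' * K n.+1.
  elim: d n => [|d IH] n; first by rewrite addn0 => ->; rewrite KN mulr1.
  rewrite addnS -addSn => nd; have nN : (n.+1 < N)%N by rewrite ltnS -nd leq_addr.
  have /eqP := bS _ nN; rewrite /= subr_eq (IH _ nd) => /eqP ->.
  by rewrite [in RHS]KS mulrDr mulrCA (mulrC t).
exists (b N'); rewrite {1}yE /v mulr_sumr; apply: eq_bigr => n _.
by rewrite (bK (N' - n)%N) ?rmorphM ?mulrA // subnKC // -ltnS.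
Qed.

(** The operator commutes with left multiplication by [X] and right multiplication by [Z], so
    [X v = al v] and [v Z = be v], with [(al + be) v = t v]. Hence [v y v] is an eigenvector too. *)
Let v_rank1 y : exists c, v * y * v = scalar UE c * v.
Proof.
have phiX z : phi (j X * z) = j X * phi z by rewrite /phi mulrDr !mulrA.
have phiZ z : phi (z * j Z) = phi z * j Z by rewrite /phi mulrDl !mulrA.
have [al Xv] : exists c, j X * v = scalar UE c * v.
  by apply: phi_eigen; rewrite phiX cyc_vec_eigen !mulrA scalar_central.
have [be vZ] : exists c, v * j Z = scalar UE c * v.
  by apply: phi_eigen; rewrite phiZ cyc_vec_eigen !mulrA.
apply: phi_eigen; rewrite /phi !mulrA Xv -[_ * v * j Z]mulrA vZ.
have -> : v * y * (scalar UE be * v) = scalar UE be * v * y * v.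
  by rewrite !mulrA -scalar_central !mulrA.
rewrite -!(mulrA _ y v) -mulrDl; congr (_ * _).
by rewrite -Xv -vZ -cyc_vec_eigen.
Qed.

Lemma cyclic_split d : d * peval u t (\det cyc_mx) = 1 ->
  exists g : {rmorphism U -> 'M[E]_a}, forall c, g (scalar U c) = (u c)%:M.
Proof.
move=> dE; have [M [WM ME]] := bc_free_basis u wm.
have [tau tauE] := choice v_rank1.
pose b (i : 'I_a * 'I_a) : UE := j (p i.1) * v * j (q i.2).
pose Dl : 'M[E]_N := \matrix_(i, n) M n (b (ne i)).
have DlE : Dl = map_mx (peval u t) cyc_mx.
  apply/matrixP => i n; rewrite !mxE /b /v mulr_sumr mulr_suml.
  rewrite (alinear_sum _ _ _ (WM.1.1 n)) rmorph_sum; apply: eq_bigr => l _.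
  rewrite /= pevalM pevalC -/(K _) -ME !rmorphM.
  have -> : j (p (ne i).1) * (scalar UE (K l.+1) * j (w l)) * j (q (ne i).2) =
     scalar UE (K l.+1) * (j (p (ne i).1) * j (w l) * j (q (ne i).2)).
    by rewrite !mulrA -scalar_central.
  by have [_ ->] := WM.1.1 n.
have dl : d * \det Dl = 1 by rewrite DlE det_map_mx.
pose V := d *: \adj Dl.
have VD : V *m Dl = 1%:M by rewrite -scalemxAl mul_adj_mx scale_scalar_mx dl.
have DV : Dl *m V = 1%:M by rewrite -scalemxAr mul_mx_adj scale_scalar_mx dl.
have [L bL] := free_basis_change WM enK neK DV VD.
have [g gE] := rank1_split (p := fun i => j (p i)) (q := fun i => j (q i)) tauE bL.
pose g' : {rmorphism U -> 'M[E]_a} := g \o j.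
by exists g' => c; rewrite /= bcj_scalar gE.
Qed.

End Cyclic.

(* Adding a large multiple of [chi] to [h] makes both polynomials monic, so that *)
(* their resultant commutes with the specialization [e].                       *)
Lemma coprime_lift (D : comNzRingType) (k : fieldType) (e : {rmorphism D -> k})
    (chi h : {poly D}) :
  chi \is monic -> (1 < size chi)%N -> coprimep (map_poly e chi) (map_poly e h) ->
  exists (c : D) (s b : {poly D}), e c != 0 /\ s * h + b * chi = c%:P.
Proof.
move=> chim chis cop; pose K := size h; pose h' := h + chi * 'X^K.
have chi0 : chi != 0 by apply: monic_neq0.
have szX : size (chi * 'X^K) = (K + size chi)%N.
  by rewrite size_Mmonic ?monicXn // size_polyXn addnS /= addnC.
have hlt : (size h < size (chi * 'X^K)%R)%N.
  by rewrite szX -addn1 leq_add2l (ltnW chis).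
have h'm : h' \is monic.
  by rewrite monicE /h' addrC lead_coefDl // -monicE monicMl ?monicXn.
have h's : (1 < size h')%N.
  by rewrite /h' addrC size_polyDl // szX (leq_trans chis) // leq_addl.
pose ev0 : {rmorphism {poly D} -> D} := horner_eval 0.
pose f : {rmorphism {poly D} -> k} := e \o ev0.
have fE (p : {poly D}) : map_poly f p^:P = map_poly e p.
  by apply/polyP => i; rewrite !coef_map /= /horner_eval hornerC.
have evE (p : {poly D}) : map_poly ev0 p^:P = p.
  by apply/polyP => i; rewrite !coef_map /= /horner_eval hornerC.
have lead_f (p : {poly D}) : p \is monic -> f (lead_coef p^:P) != 0.
  move=> pm; rewrite lead_coef_map_inj ?(monicP pm) ?rmorph1 ?oner_neq0 //.
  exact: polyC_inj.
pose res := resultant chi^:P h'^:P.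
have [|| [U V] /= _ E] := @resultant_in_ideal _ chi^:P h'^:P; rewrite ?size_map_polyC //.
exists (ev0 res), (map_poly ev0 V), (map_poly ev0 U + map_poly ev0 V * 'X^K); split.
  rewrite -[e _]/(f res) map_resultant ?lead_f // !fE resultant_eq0 -leqNgt.
  have : coprimep (map_poly e chi) (map_poly e h').
    by rewrite /h' rmorphD rmorphM /= addrC [X in X + _]mulrC coprimep_addl_mul.
  by rewrite /coprimep => /eqP ->.
have := congr1 (map_poly ev0) E; rewrite map_polyC /= => ->.
rewrite rmorphD !rmorphM /= !evE /h'; ring.
Qed.

Section Shift.
Variables (k : fieldType) (a' : nat).
Local Notation a := a'.+1.

Definition shift_mx (l : 'I_a) : 'M[k]_a := \matrix_(i, j) (i == j + l)%:R.

Lemma shift_mx_delta l s i j :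
  shift_mx l *m delta_mx i j *m shift_mx s = delta_mx (i + l) (j - s).
Proof.
have -> : shift_mx l *m delta_mx i j = delta_mx (i + l) j.
  apply/matrixP => x y; rewrite !mxE (bigD1 i) //= big1 ?addr0 => [|z zi].
    by rewrite !mxE eqxx -natrM mulnb.
  by rewrite !mxE (negbTE zi) mulr0.
apply/matrixP => x y; rewrite !mxE (bigD1 j) //= big1 ?addr0 => [|z zj].
  by rewrite !mxE eqxx andbT -natrM mulnb eq_sym [y == _]eq_sym subr_eq.
by rewrite !mxE (negbTE zj) andbF mul0r.
Qed.

(** For fixed [i] and [j] the shifts on both sides carry [e_ij] to every matrix unit exactly
    once. *)
Lemma shift_mx_indep (c : 'I_a -> 'I_a -> k) i j :
  \sum_l \sum_s c l s *: (shift_mx l *m delta_mx i j *m shift_mx s) = 0 ->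
  forall l s, c l s = 0.
Proof.
move=> c0 l0 s0; have := congr1 (fun M : 'M[k]_a => M (i + l0) (j - s0)) c0.
rewrite mxE summxE (bigD1 l0) //= summxE (bigD1 s0) //=.
rewrite shift_mx_delta !mxE !eqxx mulr1 big1 => [|s ss]; last first.
  rewrite shift_mx_delta !mxE eqxx (inj_eq (addrI _)) eqr_opp eq_sym (negbTE ss).
  by rewrite mulr0.
rewrite addr0 big1 ?addr0 // => l ll; rewrite summxE big1 // => s _.
by rewrite shift_mx_delta !mxE (inj_eq (addrI _)) eq_sym (negbTE ll) mulr0.
Qed.

End Shift.

Lemma peval_horner (D : comNzRingType) (k : fieldType) (e : {rmorphism D -> k}) (s : k)
    (p : {poly D}) : peval e s p = (map_poly e p).[s].
Proof.
rewrite (horner_coef_wide _ (size_poly _ _)) /peval.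
by apply: eq_bigr => i _; rewrite coef_map.
Qed.

Section CyclicFiber.
Variables (k : numClosedFieldType) (D : comNzRingType) (e : {rmorphism D -> k}).
Variables (U : algebra D) (a' : nat).
Local Notation a := a'.+1.
Variables (g : {rmorphism U -> 'M[k]_a}).
Hypothesis gs : forall d, g (scalar U d) = (e d)%:M.
Variables (X Z : U) (N' : nat).
Local Notation N := N'.+1.
Hypothesis Na : N = (a * a)%N.
Variables (w : nat -> U) (m : 'I_N -> U -> D).
Hypotheses (wS : forall n, w n.+1 = X * w n + w n * Z)
  (wm : free_basis (fun n : 'I_N => w n) m).
Variables (en : 'I_a * 'I_a -> 'I_N) (ne : 'I_N -> 'I_a * 'I_a).
Hypotheses (enK : cancel en ne) (neK : cancel ne en).
Variables (p q : 'I_a -> U).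
Hypotheses (gX : g X = diag_mx (\row_i i%:R)) (gZ : g Z = diag_mx (\row_i (a * i)%:R))
  (gw0 : forall i j, g (w 0%N) i j = 1)
  (gp : forall l, g (p l) = shift_mx k l) (gq : forall l, g (q l) = shift_mx k l)
  (gw_indep : forall c : 'I_N -> k, \sum_n c n *: g (w n) = 0 -> forall n, c n = 0).

Local Notation chi := (cyc_poly w m).
(** The eigenvalues on the fiber; as numbers in base [a] they are pairwise distinct. *)
Let ev (i j : 'I_a) : k := (i + a * j)%:R.

Let gscale d y : g (scalar U d * y) = e d *: g y.
Proof. by rewrite rmorphM gs; apply: mul_scalar_mx. Qed.

Let g_coords y : g y = \sum_n e (m n y) *: g (w n).
Proof. by rewrite {1}(wm.1.2 y) rmorph_sum; apply: eq_bigr => n _; rewrite gscale. Qed.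

Let phi_entry (V : 'M[k]_a) i j : (g X * V + V * g Z) i j = ev i j * V i j.
Proof.
rewrite gX gZ mxE -[_ * V]/(_ *m V) -[V * _]/(V *m _) mul_diag_mx mul_mx_diag !mxE.
by rewrite /ev natrD mulrDl; congr (_ + _); rewrite mulrC.
Qed.

Let gw n i j : g (w n) i j = ev i j ^+ n.
Proof.
elim: n => [|n IH]; first by rewrite gw0.
by rewrite wS rmorphD !rmorphM phi_entry IH exprS.
Qed.

Let ev_root i j : root (map_poly e chi) (ev i j).
Proof.
rewrite rootE (horner_coef_wide _ (n := N.+1)); last first.
  by rewrite (leq_trans (size_poly _ _)) // size_cyc.
rewrite big_ord_recr /= coef_map /=.
have -> : chi`_N = 1.
  by have /monicP := cyc_monic w m; rewrite lead_coefE size_cyc.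
rewrite rmorph1 mul1r -gw (cyc_last wm) rmorphN mxE rmorph_sum summxE -sumrB.
by rewrite big1 // => n _; rewrite gscale mxE gw coef_map subrr.
Qed.

Let rs : seq k := [seq n%:R | n <- iota 0 N].

Let rs_ev s : s \in rs -> exists i j, s = ev i j.
Proof.
case/mapP => n; rewrite mem_iota add0n Na => /andP[_ nN] ->.
have ni : (n %% a < a)%N by rewrite ltn_mod.
have nj : (n %/ a < a)%N by rewrite ltn_divLR.
by exists (Ordinal ni), (Ordinal nj); rewrite /ev /= addnC mulnC -divn_eq.
Qed.

Let rs_uniq : uniq rs.
Proof. by rewrite map_inj_uniq ?iota_uniq // => x y /eqP; rewrite eqr_nat => /eqP. Qed.

Let chi_prod : map_poly e chi = \prod_(z <- rs) ('X - z%:P).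
Proof.
have chim := cyc_monic w m.
have lc : e (lead_coef chi) != 0 by rewrite (monicP chim) rmorph1 oner_neq0.
rewrite [LHS](@all_roots_prod_XsubC _ _ rs).
- by rewrite lead_coef_map_id0 ?rmorph0 // (monicP chim) rmorph1 scale1r.
- by rewrite size_map_poly_id0 // size_cyc size_map size_iota.
- by apply/allP => s /rs_ev[i [j ->]].
- by rewrite uniq_rootsE rs_uniq.
Qed.

Let ev_inj i j i' j' : ev i j = ev i' j' -> i = i' /\ j = j'.
Proof.
move=> /eqP; rewrite eqr_nat => /eqP E; split; apply: val_inj => /=.
  have := congr1 (modn^~ a) E; rewrite ![(a * _)%N]mulnC !(addnC (nat_of_ord _)) !modnMDl.
  by rewrite !modn_small.
have := congr1 (divn^~ a) E; rewrite ![(a * _)%N]mulnC !(addnC (nat_of_ord _)) !divnMDl //.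
by rewrite !divn_small // !addn0.
Qed.

(** At this root the eigenvector specializes to a nonzero multiple of one matrix unit, and the
    shifts carry that unit to all the others, so the products [p_i v q_j] are independent. *)
Let det_neq0 i0 j0 : peval e (ev i0 j0) (\det (cyc_mx w m ne p q)) != 0.
Proof.
set s := ev i0 j0; have chit : peval e s chi = 0.
  by rewrite peval_horner; apply/eqP; apply: ev_root.
have [h [hs hj]] := @bc_map D k e U k (mat_alg k a) g idfun gs.
pose K n := peval e s (drop_poly n chi).
pose v := cyc_vec w m e s; pose V : 'M[k]_a := h v.
have VE : V = \sum_(n < N) K n.+1 *: g (w n).
  rewrite /V /v /cyc_vec rmorph_sum; apply: eq_bigr => n _.
  by rewrite rmorphM hs hj; apply: mul_scalar_mx.
have Veig : g X * V + V * g Z = s *: V.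
  rewrite -!hj -!(rmorphM h) -(rmorphD h) (cyc_vec_eigen wS wm chit) rmorphM hs.
  exact: mul_scalar_mx.
have V0 i j : (i != i0) || (j != j0) -> V i j = 0.
  move=> ij; have /eqP := congr1 (fun M : 'M[k]_a => M i j) Veig.
  rewrite phi_entry mxE -subr_eq0 -mulrBl mulf_eq0 subr_eq0 => /orP[/eqP|/eqP//].
  by move=> /ev_inj[ii jj]; rewrite ii jj !eqxx in ij.
pose ga := V i0 j0.
have Vd : V = ga *: delta_mx i0 j0.
  apply/matrixP => i j; rewrite [RHS]mxE [delta_mx _ _ _ _]mxE.
  case: (eqVneq i i0) => [->|ii]; last by rewrite mulr0 V0 ?ii.
  by case: (eqVneq j j0) => [->|jj]; rewrite ?mulr1 // mulr0 V0 // jj orbT.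
(* The coordinate of [V] on the last [g (w n)] is 1. *)
have ga0 : ga != 0.
  apply/eqP => ga0; rewrite ga0 scale0r VE in Vd.
  have := gw_indep Vd ord_max; rewrite /K (cyc_coef_last w m e s).
  by move/eqP; rewrite oner_eq0.
rewrite -det_map_mx; apply/det0P => -[c c0 cD].
move/eqP: c0; apply.
have SVS i : shift_mx k (ne i).1 *m V *m shift_mx k (ne i).2 =
    \sum_n (map_mx (peval e s) (cyc_mx w m ne p q)) i n *: g (w n).
  rewrite VE mulmx_sumr mulmx_suml.
  under eq_bigr => l _.
    rewrite -scalemxAr -scalemxAl -gp -gq.
    rewrite -[_ *m _ *m _]/(g _ * g _ * g _) -!rmorphM g_coords scaler_sumr.
    over.
  rewrite exchange_big; apply: eq_bigr => n _.
  rewrite !mxE rmorph_sum scaler_suml; apply: eq_bigr => l _.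
  by rewrite scalerA /= pevalM pevalC.
have SdS l t : ga *: (shift_mx k l *m delta_mx i0 j0 *m shift_mx k t) =
    shift_mx k l *m V *m shift_mx k t by rewrite Vd -scalemxAr -scalemxAl.
have C0 := @shift_mx_indep k a' (fun l t => c 0 (en (l, t)) * ga) i0 j0.
have {}C0 l t : c 0 (en (l, t)) * ga = 0.
  apply: C0; rewrite pair_big /= (reindex ne) /=; last by exists en => i _.
  under eq_bigr => i _ do rewrite -surjective_pairing neK -scalerA SdS SVS.
  transitivity (\sum_n (c *m map_mx (peval e s) (cyc_mx w m ne p q)) 0 n *: g (w n)).
    under [RHS]eq_bigr => n _ do rewrite mxE scaler_suml.
    rewrite exchange_big; apply: eq_bigr => i _; rewrite scaler_sumr.
    by apply: eq_bigr => n _; rewrite scalerA.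
  by rewrite cD big1 // => n _; rewrite mxE scale0r.
apply/rowP => i; rewrite mxE; apply: (mulIf ga0); rewrite mul0r.
by have := C0 (ne i).1 (ne i).2; rewrite -surjective_pairing neK.
Qed.

(** On the fiber [chi] has distinct roots, and the determinant vanishes at none of them; so [chi] is
    prime to the product there, and [coprime_lift] gives a Bezout identity up to an element
    invertible near [e]. *)
Lemma cyclic_near : exists (c : D) (s b : {poly D}),
  e c != 0 /\ s * (chi^`() * \det (cyc_mx w m ne p q)) + b * chi = c%:P.
Proof.
apply: coprime_lift; [exact: cyc_monic | by rewrite size_cyc |].
apply/contraT => /closed_rootP[s]; rewrite root_gcd => /andP[sr].
have /rs_ev[i [j sE]] : s \in rs by move: sr; rewrite chi_prod root_prod_XsubC.
have sep : separable_poly (map_poly e chi) by rewrite chi_prod separable_prod_XsubC.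
rewrite separable_poly.unlock in sep.
rewrite rmorphM /= rootM rootE -deriv_map => /orP[].
  by rewrite (negbTE (coprimep_root sep sr)).
by rewrite rootE -peval_horner sE (negbTE (det_neq0 i j)).
Qed.

End CyclicFiber.

(** * Etale covers over which Azumaya algebras split *)

Section Splitting.
Variable k : numClosedFieldType.
Local Notation cat := (commalg_cat k).

Lemma commalg_nonzero (L : commalg k) : (1 : L) != 0 ->
  exists (R : comNzRingType) (s : {rmorphism k -> R}) (fp : finitely_presented s),
    L = Commalg fp.
Proof.
case: L => L s fp /= L1; have [R E] := comNzRing_of L1.
by case: _ / E s fp {L1} => s fp; exists R, s, fp.
Qed.

(** A root of [chi] is adjoined to [L]. As [c] is invertible there, the Bezout identity makes both
    [chi'] and [dd] units modulo [chi]: the former makes the extension etale, the latter provides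
    [d]. *)
Lemma etale_root (D : comNzRingType) (L : commalg k) (l : {rmorphism D -> L})
    (chi s b dd : {poly D}) (c : D) (c' : L) : (1 : L) != 0 ->
  chi \is monic -> (1 < size chi)%N -> s * (chi^`() * dd) + b * chi = c%:P ->
  c' * l c = 1 ->
  exists (E : commalg k) (eps : commalg_hom L E) (t d : E),
    [/\ formally_etale eps, spec_surjective eps, peval (eps \o l) t chi = 0 &
        d * peval (eps \o l) t dd = 1].
Proof.
move=> L1; have [R [sL [fp EL]]] := commalg_nonzero L1; subst L.
rewrite /= in l c' L1 * => chim chis E cl.
pose chi' : {poly R} := map_poly l chi.
have chi'm : chi' \is monic by apply: monic_map.
have chi's : (1 < size chi')%N.
  by rewrite size_map_poly_id0 // (monicP chim) rmorph1 oner_neq0.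
have E' : (c'%:P * map_poly l (s * dd)) * chi'^`() + (c'%:P * map_poly l b) * chi' = 1.
  rewrite -polyC1 -cl polyCM -map_polyC /= -E rmorphD !rmorphM /= deriv_map.
  by ring.
exists (Commalg (pquot_fp chi' fp)).
pose eps := @CommalgHom k (Commalg fp) (Commalg (pquot_fp chi' fp)) (pquotC chi') (fun _ => erefl).
have pE f : peval (eps \o l) (to_pquot chi' 'X) f = to_pquot chi' (map_poly l f).
  symmetry; apply: (@peval_unique D _ (eps \o l) _ (to_pquot chi' \o map_poly l)) => [d|] /=.
    by rewrite map_polyC.
  by rewrite map_polyX.
have chi0 : to_pquot chi' chi' = 0 by apply/to_pquot_eq0; exists 1; rewrite mul1r.
exists eps, (to_pquot chi' 'X), (to_pquot chi' (c'%:P * map_poly l s * chi'^`())); split.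
- exact: pquot_formally_etale E'.
- exact: pquot_spec_surjective.
- by rewrite pE.
- rewrite pE -rmorphM -[RHS](rmorph1 (to_pquot chi')) -E' rmorphD.
  rewrite [X in _ = _ + X](rmorphM (to_pquot chi')) chi0 mulr0 addr0.
  by congr (to_pquot _ _); rewrite rmorphM /=; ring.
Qed.

Section SplitSieve.
Variables (D : commalg k) (U : algebra D) (a : nat).

Definition splits (E : commalg k) (f : commalg_hom D E) : Prop :=
  exists g : {rmorphism U -> 'M[E]_a}, forall c, g (scalar U c) = (f c)%:M.

Lemma splits_closed (E E' : cat) (h : hom E E') (f : @hom cat D E) :
  splits f -> @splits E' (comp h f).
Proof.
move=> [g gE].
have [|||g' g'E] := @exists_rmorphism U 'M[E']_a (fun y => map_mx (h : commalg_hom E E') (g y)).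
- by rewrite rmorph1 map_mx1.
- by move=> y z; rewrite rmorphD map_mxD.
- by move=> y z; rewrite rmorphM; apply: map_mxM.
by exists g' => c; rewrite g'E gE map_scalar_mx.
Qed.

Definition split_sieve : @sieve cat D := @Sieve cat D splits splits_closed.

Lemma base_change_splits (L E : commalg k) (l : commalg_hom D L) (f : commalg_hom L E)
    (g : {rmorphism base_change l U -> 'M[E]_a}) :
  (forall c, g (scalar _ c) = (f c)%:M) -> splits (commalg_comp f l).
Proof.
move=> gE; exists (g \o bcj l U) => c.
by rewrite /= bcj_scalar gE.
Qed.

End SplitSieve.

Variables (J : coverage cat) (hJ : grothendieck_topology J)
  (Jet : finer J (@etale_topology k)).
Hypothesis k_uncountable : forall F : nat -> seq k, exists x, forall n, x \notin F n.

Lemma covering_id (D : commalg k) (S : @sieve cat D) : S D (commalg_id D) -> J S.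
Proof.
move=> SD; have := covering_mem hJ SD.
by congr (J _); apply: sieve_ext => E f /=; rewrite commalg_compc1.
Qed.

(* The lifts to U of a diagonal pair with distinct sums of eigenvalues, of the *)
(* all-ones matrix and of the cyclic shifts make [cyclic_near] applicable.     *)
Lemma free_split_covering (D : commalg k) (U : algebra D) (a N : nat)
    (x : 'I_N -> U) (l : 'I_N -> U -> D) :
  azumaya U -> free_basis x l -> constant_degree U a -> J (split_sieve U a).
Proof.
move=> azU xl Ua; apply: (covering_near_points hJ (finer_etale_zariski Jet)) => // e ep.
have [a1 [g [a10 gs gsurj gtr gind]]] := point_fiber ep azU.
have ea : a1 = a.
  apply/eqP; rewrite -(@eqn_exp2r _ _ 2) // -(@eqr_nat k) -(gtr _ _ _ xl.1).
  by move/(constant_degreeP (commalg_scalar D) xl.1): Ua => ->.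
have NA : N = (a1 * a1)%N.
  apply/eqP; rewrite mulnn -(@eqr_nat k) -(gtr _ _ _ xl.1) (free_basis_trace xl).
  by rewrite card_ord rmorph_nat.
subst a; case: a1 a10 g gs gsurj gtr gind Ua NA => // a' _ g gs gsurj gtr gind Ua NA.
case: N x l xl NA => [|N'] x l xl NA; first by rewrite mulSn in NA.
have [X gX] := gsurj (diag_mx (\row_i i%:R)).
have [Z gZ] := gsurj (diag_mx (\row_i (a'.+1 * i)%:R)).
have [Y gY] := gsurj (const_mx 1).
have /choice[p gp] i := gsurj (shift_mx k i).
pose w n := iter n (fun y => X * y + y * Z) Y.
have wS n : w n.+1 = X * w n + w n * Z by [].
pose ev (i j : 'I_a'.+1) : k := (i + a'.+1 * j)%:R.
have gw n i j : g (w n) i j = ev i j ^+ n.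
  elim: n => [|n IH]; first by rewrite gY mxE.
  rewrite wS rmorphD !rmorphM gX gZ mxE.
  rewrite -[diag_mx _ * _]/(_ *m _) -[_ * diag_mx _]/(_ *m _).
  rewrite mul_diag_mx mul_mx_diag !mxE IH exprS.
  by rewrite [X in X + _]mulrC -mulrDr -natrD mulrC.
have gy y : g y = \sum_i e (l i y) *: g (x i).
  rewrite {1}(xl.1.2 y) rmorph_sum; apply: eq_bigr => i _.
  by rewrite rmorphM gs; apply: mul_scalar_mx.
pose W : 'M[D]_N'.+1 := \matrix_(n, i) l i (w n).
(* A nontrivial relation would be a nonzero polynomial of degree at most [N'] vanishing at [N'.+1]
   distinct eigenvalues. *)
have gw_indep (c : 'I_N'.+1 -> k) : \sum_n c n *: g (w n) = 0 -> forall n, c n = 0.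
  move=> c0; pose P : {poly k} := \poly_(n < N'.+1) c (inord n).
  suff P0 : P = 0.
    by move=> n; have := congr1 (fun f : {poly k} => f`_n) P0;
      rewrite coef_poly ltn_ord inord_val coef0.
  apply: contraTeq isT => P0.
  pose rs : seq k := [seq n%:R | n <- iota 0 N'.+1].
  have : (size rs < size P)%N.
    apply: max_poly_roots => //; last first.
      by rewrite map_inj_uniq ?iota_uniq // => i j /eqP; rewrite eqr_nat => /eqP.
    apply/allP => _ /mapP[n nN ->]; rewrite mem_iota add0n NA in nN.
    have ni : (n %% a'.+1 < a'.+1)%N by rewrite ltn_mod.
    have nj : (n %/ a'.+1 < a'.+1)%N by rewrite ltn_divLR //; case/andP: nN.
    have := congr1 (fun M : 'M[k]_a'.+1 => M (Ordinal ni) (Ordinal nj)) c0.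
    rewrite mxE summxE rootE (horner_coef_wide _ (size_poly _ _)) => E.
    rewrite -[X in _ == X]E; apply/eqP/eq_bigr => i _.
    rewrite coef_poly ltn_ord inord_val mxE gw; congr (_ * _ ^+ _).
    by rewrite /ev /= addnC mulnC -divn_eq.
  by rewrite size_map size_iota ltnNge size_poly.
(* Once this determinant is inverted, the orbit [w] becomes a basis. *)
have ec2 : e (\det W) != 0.
  rewrite -det_map_mx; apply/det0P => -[c c0 cW]; move/eqP: c0; apply.
  apply/rowP => n; rewrite mxE; apply: gw_indep n.
  under eq_bigr => n _ do rewrite gy scaler_sumr.
  rewrite exchange_big big1 // => i _.
  transitivity ((c *m map_mx e W) 0 i *: g (x i)); last by rewrite cW mxE scale0r.
  rewrite mxE scaler_suml; apply: eq_bigr => n _.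
  by rewrite scalerA !mxE.
have [L2 [l2 l2c]] := exists_localization (\det W) (point_neq0 e).
have [e2 [ep2 e2E]] := point_extend ep l2c ec2.
have [R [s2 [fp2 EL]]] := commalg_nonzero (point_neq0 e2); subst L2.
have [[d dE] lfrac _] := l2c.
pose U2 := base_change l2 U.
have [m2 [xm2 mE2]] := bc_free_basis l2 xl.
pose w2 n : U2 := bcj l2 U (w n).
have WE : \matrix_(i, j) m2 j (w2 (id i)) = map_mx l2 W.
  by apply/matrixP => i j; rewrite !mxE mE2.
have [||m wm] := @free_basis_change _ U2 _ _ _ _ (fun n : 'I_N'.+1 => w2 n) id id
  (d *: \adj (map_mx l2 W)) xm2 (fun _ => erefl) (fun _ => erefl).
- by rewrite WE -scalemxAr mul_mx_adj det_map_mx scale_scalar_mx dE.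
- by rewrite WE -scalemxAl mul_adj_mx det_map_mx scale_scalar_mx dE.
have [g2 [g2s g2j]] := @bc_map D R l2 U k (mat_alg k a'.+1) g e2
  (fun c => etrans (gs c) (congr1 (fun z => z%:M) (esym (e2E c)))).
have wS2 n : w2 n.+1 = bcj l2 U X * w2 n + w2 n * bcj l2 U Z.
  by rewrite /w2 wS rmorphD !rmorphM.
have card_eq : #|{: 'I_a'.+1 * 'I_a'.+1}| = N'.+1 by rewrite card_prod card_ord NA.
pose en (i : 'I_a'.+1 * 'I_a'.+1) : 'I_N'.+1 := cast_ord card_eq (enum_rank i).
pose ne (n : 'I_N'.+1) : 'I_a'.+1 * 'I_a'.+1 := enum_val (cast_ord (esym card_eq) n).
have enK : cancel en ne by move=> i; rewrite /ne /en cast_ordK enum_rankK.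
have neK : cancel ne en by move=> i; rewrite /ne /en enum_valK cast_ordKV.
pose p2 i := bcj l2 U (p i).
have [||||||c [s [b [ec E]]]] := @cyclic_near k R e2 U2 a' g2 g2s _ _ N' NA w2 m wS2 wm en ne enK
  neK p2 p2.
- by rewrite g2j gX.
- by rewrite g2j gZ.
- by move=> i j; rewrite g2j gY mxE.
- by move=> i; rewrite g2j gp.
- by move=> i; rewrite g2j gp.
- by move=> c c0; apply: gw_indep; rewrite -[RHS]c0; apply: eq_bigr => n _; rewrite g2j.
have [L3 [l3 l3c]] := exists_localization (D := Commalg fp2) c (point_neq0 e2).
have [e3 [ep3 e3E]] := point_extend ep2 l3c ec.
have [[c' c'E] _ _] := l3c.
have chis : (1 < size (cyc_poly w2 m))%N by rewrite size_cyc.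
have [E3 [eps [t [d3 [eet esurj chit d3E]]]]] := @etale_root R L3 l3 _ _ _ _ _ c' (point_neq0 e3)
  (cyc_monic w2 m) chis E c'E.
have [g3 g3E] := @cyclic_split R U2 _ _ N' w2 m wS2 wm _ en ne enK neK p2 p2 E3
  (eps \o l3) t chit d3 d3E.
(* With [a2] a numerator of [c], the two localizations together invert [\det W * a2]. *)
have [a2 [n dn]] := lfrac c.
exists (\det W * a2), L3, (commalg_comp l3 l2); split.
- rewrite rmorphM mulf_neq0 // -e2E -dn rmorphM rmorphXn e2E mulf_neq0 //.
  exact: expf_neq0.
- exact: (localization_trans l2c l3c dn).
apply: (covering_etale hJ Jet eet esurj); apply: covering_id.
rewrite /= commalg_comp1c commalg_compcA.
by apply: (@base_change_splits D U _ _ E3 l2 (commalg_comp eps l3) g3) => c0; rewrite g3E.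
Qed.

Lemma azumaya_split_covering (D : commalg k) (U : algebra D) (a : nat) :
  azumaya U -> constant_degree U a -> J (split_sieve U a).
Proof.
move=> azU Ua; apply: (covering_near_points hJ (finer_etale_zariski Jet)) => // e ep.
have [c [L [l [r [x [m [ec lc xm]]]]]]] := free_near_point ep azU.
exists c, L, l; split=> //.
have azL := base_change_azumaya l azU.
have La := base_change_degree (commalg_scalar D) l azU Ua.
apply: covering_sub hJ _ _ _ (free_split_covering azL xm La) _ => E f [g gE].
exact: base_change_splits gE.
Qed.

End Splitting.

(** * The topology on Azumaya algebras *)

Lemma mat_embed (E : comPzRingType) (a b : nat) : (a %| b)%N -> (0 < a)%N ->
  exists F : {rmorphism 'M[E]_a -> 'M[E]_b}, forall c, F c%:M = c%:M.
Proof.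
move=> /dvdnP[d ->] a0.
have card_eq : #|{: 'I_a * 'I_d}| = (d * a)%N by rewrite card_prod !card_ord mulnC.
pose ne (n : 'I_(d * a)) : 'I_a * 'I_d := enum_val (cast_ord (esym card_eq) n).
pose en (i : 'I_a * 'I_d) : 'I_(d * a) := cast_ord card_eq (enum_rank i).
have enK : cancel en ne by move=> i; rewrite /ne /en cast_ordK enum_rankK.
have neK : cancel ne en by move=> i; rewrite /ne /en enum_valK cast_ordKV.
(* The Kronecker product of [M] with the identity matrix of size [d]. *)
pose F (M : 'M[E]_a) : 'M[E]_(d * a) :=
  \matrix_(x, y) (if (ne x).2 == (ne y).2 then M (ne x).1 (ne y).1 else 0).
have FC c : F c%:M = c%:M.
  apply/matrixP => x y; rewrite !mxE -(can_eq neK).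
  case: (ne x) (ne y) => i s [j t] /=; rewrite xpair_eqE.
  by case: (s == t); rewrite ?andbT ?andbF.
have [|x y|x y|G GE] := @exists_rmorphism 'M[E]_a 'M[E]_(d * a) F.
- exact: FC.
- by apply/matrixP => i j; rewrite !mxE; case: ifP; rewrite ?addr0.
- apply/matrixP => i j; rewrite !mxE (reindex en) /=; last by exists ne => s _.
  transitivity (\sum_s \sum_t F x i (en (s, t)) * F y (en (s, t)) j); last first.
    by rewrite pair_bigA; apply: eq_bigr => -[].
  rewrite exchange_big /=.
  rewrite (bigD1 (ne i).2) //= [X in _ + X]big1 => [|t ti]; last first.
    by rewrite big1 // => s _; rewrite !mxE enK /= eq_sym (negbTE ti) mul0r.
  rewrite addr0; case: eqP => ij; last first.
    by rewrite big1 // => s _; rewrite !mxE enK /=; rewrite (introF eqP ij) mulr0.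
  by apply: eq_bigr => s _; rewrite !mxE enK /= eqxx ij eqxx.
by exists G => c; rewrite GE FC.
Qed.

Section Topology.
Variables (k : numClosedFieldType) (J : coverage (commalg_cat k)) (K : coverage div_cat).
Local Notation cat := (commalg_cat k).
Hypothesis k_uncountable : forall F : nat -> seq k, exists x, forall n, x \notin F n.
Hypotheses (hJ : grothendieck_topology J) (hK : grothendieck_topology K).
Hypothesis Jzar : coarse_zariski J.

Lemma exists_azumaya_hom (A B : azumaya_alg k) (f : commalg_hom (az_center A) (az_center B))
    (g : {rmorphism A -> B}) : (forall c, g (scalar A c) = scalar B (f c)) ->
  exists h : azumaya_hom A B, forall a, h a = g a.
Proof.
move=> gf.
have gs a : g (az_scalar A a) = az_scalar B a.
  by rewrite /az_scalar gf commalg_map_scalar.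
have gc z : central z -> central (g z).
  move=> /(azumaya_center (@az_azumaya k A))[c ->] b.
  by rewrite gf scalar_central.
by exists (AzumayaHom gs gc).
Qed.

Lemma exists_center_map (A B : azumaya_alg k) (g : azumaya_hom A B) :
  exists f : commalg_hom (az_center A) (az_center B),
    forall c, g (scalar A c) = scalar B (f c).
Proof.
have inj := azumaya_scalar_inj (@az_azumaya k B).
have /choice[f fE] c : exists d, g (scalar A c) = scalar B d.
  apply: (azumaya_center (@az_azumaya k B)); apply: az_map_central => a.
  exact: scalar_central.
have [|||f' f'E] := @exists_rmorphism (az_center A) (az_center B) f.
- by apply: inj; rewrite -fE !rmorph1.
- by move=> x y; apply: inj; rewrite -fE !rmorphD !fE.
- by move=> x y; apply: inj; rewrite -fE !rmorphM !fE.
have f's a : f' (commalg_scalar (az_center A) a) = commalg_scalar (az_center B) a.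
  by apply: inj; rewrite f'E -fE; apply: (az_map_scalar g a).
by exists (CommalgHom f's) => c; rewrite fE /= f'E.
Qed.

(* An algebra map from the base change of A along [f] to B is a ring map       *)
(* [A -> B] over [f]; this avoids mentioning the base change.                  *)
Definition rep (A : azumaya_alg k) (L : @sieve (azumaya_cat k) A) (D : commalg k)
    (f : commalg_hom (az_center A) D) (m : nat) : Prop :=
  exists (B : algebra D) (hB : azumaya B), constant_degree B m /\
    exists g : azumaya_hom A (AzumayaAlg hB),
      (forall c, g (scalar A c) = scalar B (f c)) /\ L (AzumayaAlg hB) g.

Lemma representedE (A : azumaya_alg k) (L : @sieve (azumaya_cat k) A) (D : commalg k)
    (f : commalg_hom (az_center A) D) (m : posN) :
  represented L f m <-> rep L f (val m).
Proof.
split=> [[B [hB [Bm [phi [phiE [g [gE Lg]]]]]]]|[B [hB [Bm [g [gE Lg]]]]]].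
  exists B, hB; split=> //; exists g; split=> // c.
  by rewrite gE -phiE; congr (phi _); apply: bcj_scalar.
have [phi [phis phij]] := @bc_map _ _ f A D B (az_map g) idfun gE.
exists B, hB; split=> //; exists phi; split=> //; exists g; split=> // a.
exact/esym/phij.
Qed.

Section Represented.
Variables (A : azumaya_alg k) (L : @sieve (azumaya_cat k) A).
Let azA : azumaya A := @az_azumaya k A.

Lemma rep_push (D E : commalg k) (f : commalg_hom (az_center A) D) (w : commalg_hom D E)
    (B : algebra D) (hB : azumaya B) (g : azumaya_hom A (AzumayaAlg hB)) (Q : algebra E)
    (h : {rmorphism B -> Q}) m :
  (forall c, g (scalar A c) = scalar B (f c)) -> L (AzumayaAlg hB) g ->
  azumaya Q -> constant_degree Q m -> (forall c, h (scalar B c) = scalar Q (w c)) ->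
  rep L (commalg_comp w f) m.
Proof.
move=> gf Lg azQ Qm hw; exists Q, azQ; split=> //.
have [h' h'E] := @exists_azumaya_hom (AzumayaAlg hB) (AzumayaAlg azQ) w h hw.
exists (azumaya_comp h' g); split=> [c|]; last exact: (sieve_closed (s := L)).
by rewrite /= gf h'E hw.
Qed.

Lemma rep_comp (D E : commalg k) (f : commalg_hom (az_center A) D) (w : commalg_hom D E) m :
  rep L f m -> rep L (commalg_comp w f) m.
Proof.
move=> [B [hB [Bm [g [gE Lg]]]]].
apply: (rep_push (Q := base_change w B) (h := bcj w B) gE Lg).
- exact: base_change_azumaya.
- exact: (base_change_degree (commalg_scalar D)).
- exact: bcj_scalar.
Qed.

Lemma rep_dvd (D : commalg k) (f : commalg_hom (az_center A) D) m n :
  rep L f m -> (m %| n)%N -> (0 < n)%N -> rep L f n.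
Proof.
move=> [B [hB [Bm [g [gE Lg]]]]] /dvdnP[q ->]; rewrite muln_gt0 => /andP[q0 _].
have := @rep_push D D f (commalg_id D) B hB g (tens_alg B (mat_alg D q)) (tinl _ _) (m * q) gE Lg.
rewrite commalg_comp1c mulnC; apply.
- by apply: tens_azumaya => //; apply: mat_azumaya.
- rewrite mulnC; apply: (tens_degree (commalg_scalar D)) => //; first exact: mat_azumaya.
  exact: (mat_degree (commalg_scalar D)).
- by move=> c.
Qed.

Lemma rep_zero (D : commalg k) (f : commalg_hom (az_center A) D) m n :
  (1 : D) = 0 -> rep L f m -> rep L f n.
Proof.
move=> D0 [B [hB [_ [g [gE Lg]]]]]; exists B, hB; split; first exact: zero_degree.
by exists g.
Qed.

(** Degrees over varying [D] are all read from one trace in the center of [A], which avoids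
    comparing iterated base changes. *)
Lemma bc_degreeP (D : commalg k) (f : commalg_hom (az_center A) D) (I : finType)
    (x : I -> A) l n : dual_basis x l ->
  constant_degree (base_change f A) n <->
  forall (F : fieldType) (h : {rmorphism D -> F}), h (f (trace x l)) = (n ^ 2)%:R.
Proof.
move=> xl; have [M [xM ME]] := bc_dual_basis f xl.
have -> : f (trace x l) = trace (fun i => bcj f A (x i)) M.
  by rewrite rmorph_sum; apply: eq_bigr => i _; rewrite ME.
exact: (constant_degreeP (commalg_scalar D) xM).
Qed.

Lemma bc_degree_comp (D E : commalg k) (f : commalg_hom (az_center A) D)
    (w : commalg_hom D E) n :
  constant_degree (base_change f A) n -> constant_degree (base_change (commalg_comp w f) A) n.
Proof.
have [N [x [l [_ [xl _ _ _ _]]]]] := azumaya_dataP azA.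
move=> /(bc_degreeP f n xl) An; apply/(bc_degreeP _ n xl) => F h.
by rewrite -(An F (h \o w)).
Qed.

Lemma bc_degree_unique (D : commalg k) (f : commalg_hom (az_center A) D) m n :
  (1 : D) != 0 -> constant_degree (base_change f A) m ->
  constant_degree (base_change f A) n -> m = n.
Proof.
move=> D1; have [e _] := exists_point k_uncountable D1.
have [N [x [l [_ [xl _ _ _ _]]]]] := azumaya_dataP azA.
move=> /(bc_degreeP f m xl)/(_ _ e) Em /(bc_degreeP f n xl)/(_ _ e) En.
by apply/eqP; rewrite -(@eqn_exp2r _ _ 2) // -(@eqr_nat k) -Em -En.
Qed.

Lemma bc_hom (D : commalg k) (f : commalg_hom (az_center A) D) (B : algebra D)
    (g : {rmorphism A -> B}) : (forall c, g (scalar A c) = scalar B (f c)) ->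
  exists h : {rmorphism base_change f A -> B},
    (forall d, h (scalar (base_change f A) d) = scalar B d) /\
    forall a, h (bcj f A a) = g a.
Proof. exact: (@bc_map _ _ f A D B g idfun). Qed.

Lemma rep_degree_dvd (D : commalg k) (f : commalg_hom (az_center A) D) m n :
  (1 : D) != 0 -> constant_degree (base_change f A) n -> rep L f m -> (n %| m)%N.
Proof.
move=> D1 An [B [hB [Bm [g [gE _]]]]]; have [e _] := exists_point k_uncountable D1.
have [h [hs _]] := bc_hom gE.
exact: (degree_dvd (commalg_scalar D) hs (base_change_azumaya f azA) hB e An Bm).
Qed.

Lemma represented_closed (D : commalg k) (f : commalg_hom (az_center A) D) (n m p : div_cat)
    (mp : hom m p) (_ : hom n m) : represented L f m -> represented L f p.
Proof.
move=> /representedE mr; apply/representedE.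
by apply: (rep_dvd mr) => //; apply: (valP p).
Qed.

Definition represented_sieve (D : commalg k) (f : commalg_hom (az_center A) D) (n : div_cat) :
  sieve n := @Sieve div_cat n (fun m _ => represented L f m)
    (fun m p mp nm => @represented_closed D f n m p mp nm).

(** For nonzero [D] the represented numbers form a sieve on [n], covering as soon as it contains a
    covering one. For [D = 0] either every number is represented, and [n = 1] with the maximal sieve
    serves, or none is, and [S] is already exact. *)
Lemma centrally_coveredP (D : commalg k) (f : commalg_hom (az_center A) D) :
  centrally_covered K L f <->
  exists n : posN, constant_degree (base_change f A) (val n) /\
    exists S : @sieve div_cat n, K S /\ forall m nm, S m nm -> represented L f m.
Proof.
split=> [[n [An [S [KS SE]]]]|[n [An [S [KS SE]]]]].
  by exists n; split=> //; exists S; split=> // m nm Sm; apply/SE; exists nm.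
have [D0|D1] := eqVneq (1 : D) 0.
  have [[m0 m0r]|nr] := pselect (exists m, represented L f m).
    exists (exist _ 1%N isT); split; first exact: zero_degree.
    exists (max_sieve _); split; first by case: hK.
    move=> m; split=> [_|_]; first by exists (dvd1n _).
    move/representedE: m0r => m0r; apply/representedE; exact: rep_zero m0r.
  exists n; split=> //; exists S; split=> // m; split=> [mr|[nm /SE //]].
  by case: nr; exists m.
exists n; split=> //; exists (represented_sieve f n); split.
  exact: covering_sub hK _ _ _ KS _.
move=> m; split=> [mr|[]//]; suff nm : (val n %| val m)%N by exists nm.
by apply: rep_degree_dvd An _ => //; apply/representedE.
Qed.

Lemma piK_closed (D E : cat) (w : hom D E) (f : @hom cat (az_center A) D) :
  centrally_covered K L f -> centrally_covered K L (comp w f : commalg_hom _ _).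
Proof.
move=> /centrally_coveredP[n [An [S [KS SE]]]]; apply/centrally_coveredP.
exists n; split; first exact: bc_degree_comp.
exists S; split=> // m nm /SE/representedE mr; apply/representedE.
exact: rep_comp.
Qed.

Definition piK : @sieve cat (az_center A) :=
  @Sieve cat (az_center A) (fun D f => centrally_covered K L f) piK_closed.

Lemma JKE : JK J K L <-> J piK.
Proof.
split=> [[S [JS SE]]|JP]; last by exists piK.
by have <- : S = piK by apply: sieve_ext => D f; rewrite SE.
Qed.

End Represented.

Lemma JK_max (A : azumaya_alg k) : JK J K (max_sieve (A : azumaya_cat k)).
Proof.
apply/JKE; apply: (covering_near_points hJ Jzar k_uncountable) => e ep.
have azA := @az_azumaya k A.
have [a [c [D [l [a0 ec lc Da]]]]] := degree_near_point ep azA.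
exists c, D, l; split=> //; apply: (covering_mem hJ).
apply/centrally_coveredP; exists (exist _ a a0); split=> //.
exists (max_sieve _); split=> [|m nm _]; first by case: hK.
apply/representedE; apply: (@rep_dvd _ _ _ _ a) => //; last exact: (valP m).
have azD := base_change_azumaya l azA.
have [g gE] := @exists_azumaya_hom A (AzumayaAlg azD) l (bcj l A) (bcj_scalar l A).
exists (base_change l A), azD; split=> //; exists g; split=> // d.
by rewrite gE bcj_scalar.
Qed.

(** To represent a number for the pulled back sieve, complete [h] and a member [j] of [L] to a
    commutative square with corner [Q]. *)
Lemma rep_pullback (A B : azumaya_alg k) (h : azumaya_hom A B) (L : @sieve (azumaya_cat k) A)
    (D E : commalg k) (u : commalg_hom D E) (w : commalg_hom (az_center B) E)
    (A' : algebra D) (azA' : azumaya A') (j : azumaya_hom A (AzumayaAlg azA'))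
    (Q : algebra E) (kA : {rmorphism A' -> Q}) (kB : {rmorphism B -> Q}) m :
  L (AzumayaAlg azA') j -> azumaya Q -> constant_degree Q m ->
  (forall d, kA (scalar A' d) = scalar Q (u d)) ->
  (forall c, kB (scalar B c) = scalar Q (w c)) ->
  (forall a, kB (h a) = kA (j a)) -> rep (@pullback (azumaya_cat k) A B h L) w m.
Proof.
move=> Lj azQ Qm kAs kBs kAB; exists Q, azQ; split=> //.
have [gA gAE] := @exists_azumaya_hom (AzumayaAlg azA') (AzumayaAlg azQ) u kA kAs.
have [gB gBE] := @exists_azumaya_hom B (AzumayaAlg azQ) w kB kBs.
exists gB; split=> [c|]; first by rewrite gBE.
suff E' : azumaya_comp gB h = azumaya_comp gA j.
  by rewrite /pullback /= E'; apply: (sieve_closed (s := L)).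
by apply: azumaya_hom_ext => a /=; rewrite gBE kAB gAE.
Qed.

Lemma bc_center_map (A B : azumaya_alg k) (h : azumaya_hom A B)
    (f : commalg_hom (az_center A) (az_center B)) (E : commalg k)
    (g : commalg_hom (az_center B) E) n n' :
  (forall c, h (scalar A c) = scalar B (f c)) -> (1 : E) != 0 -> (0 < n)%N -> (0 < n')%N ->
  constant_degree (base_change (commalg_comp g f) A) n ->
  constant_degree (base_change g B) n' ->
  exists q (phi : {rmorphism base_change (commalg_comp g f) A -> base_change g B}),
  [/\ forall c, phi (scalar _ c) = scalar _ c, forall a, phi (bcj _ A a) = bcj g B (h a),
      (0 < q)%N, n' = (n * q)%N & azumaya (cent_alg phi) /\ constant_degree (cent_alg phi) q].
Proof.
move=> hf E1 n0 n'0 An Bn'; have [e _] := exists_point k_uncountable E1.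
have hs c : (bcj g B \o h) (scalar A c) = scalar (base_change g B) (commalg_comp g f c).
  by rewrite /= hf; apply: bcj_scalar.
have azA := base_change_azumaya (commalg_comp g f) (@az_azumaya k A).
have azB := base_change_azumaya g (@az_azumaya k B).
have [phi [phis phij]] := bc_hom hs.
have := degree_dvd (commalg_scalar E) phis azA azB e An Bn'.
move=> /dvdnP[q]; rewrite mulnC => n'E; exists q, phi; split=> //.
  by move: n'0; rewrite n'E muln_gt0 => /andP[].
split; first exact: (centralizer_azumaya phis).
by apply: (centralizer_degree (commalg_scalar E) phis azA azB n0 An); rewrite -n'E.
Qed.

(* The two algebras [Y = X (x) U] and [Y' = X (x) U'] are amalgamated over [X]  *)
(* in [Y' (x) U].                                                              *)
Lemma tensor_amalgam (E : commalg k) (X Y Y' : algebra E) (phi : {rmorphism X -> Y})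
    (phi' : {rmorphism X -> Y'}) :
  (forall c, phi (scalar X c) = scalar Y c) -> (forall c, phi' (scalar X c) = scalar Y' c) ->
  azumaya X -> exists T : {rmorphism Y -> tens_alg Y' (cent_alg phi)},
    (forall c, T (scalar Y c) = scalar _ c) /\ forall x, T (phi x) = tinl _ _ (phi' x).
Proof.
move=> phis phis' azX.
have [|||T [TX _ TY]] := centralizer_map phis azX (E := E) (u := idfun)
    (Q := tens_alg Y' (cent_alg phi)) (g := tinl _ _ \o phi') (h := tinr _ _).
- by move=> c /=; rewrite phis'.
- exact: tinr_scalar.
- by move=> a v; apply: tin_comm.
by exists T.
Qed.

(** Here [Y = X (x) V], and splitting [V] maps it into [X (x) M_b] compatibly with [X]. The target
    depends only on [X] and [b], so two algebras over [X] can be amalgamated in it. *)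
Lemma split_map (E E' : commalg k) (u : commalg_hom E E') (X Y : algebra E)
    (phi : {rmorphism X -> Y}) a b :
  (forall c, phi (scalar X c) = scalar Y c) -> azumaya X -> (a %| b)%N -> (0 < a)%N ->
  splits (cent_alg phi) a u ->
  exists T : {rmorphism Y -> tens_alg (base_change u X) (mat_alg E' b)},
    (forall c, T (scalar Y c) = scalar _ (u c)) /\
    forall x, T (phi x) = tinl _ _ (bcj u X x).
Proof.
move=> phis azX ab a0 [s sE]; have [F FE] := mat_embed E' ab a0.
have [|||T [TX _ TY]] := centralizer_map phis azX (E := E') (u := u)
    (Q := tens_alg (base_change u X) (mat_alg E' b))
    (g := tinl _ (mat_alg E' b) \o bcj u X)
    (h := tinr (base_change u X) (mat_alg E' b) \o (F \o s)).
- by move=> c; apply: (congr1 (tinl _ (mat_alg E' b)) (bcj_scalar u X c)).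
- move=> c; apply: etrans (tinr_scalar (base_change u X) (mat_alg E' b) (u c)).
  exact: congr1 (etrans (congr1 F (sE c)) (FE _)).
- by move=> x v; apply: tin_comm.
by exists T.
Qed.

(** * Numbers represented after pullback, and the three axioms *)

Section Pullback.
Variables (A B : azumaya_alg k) (h : azumaya_hom A B) (L : @sieve (azumaya_cat k) A).
Variables (f : commalg_hom (az_center A) (az_center B)).
Hypothesis hf : forall c, h (scalar A c) = scalar B (f c).
Variables (E : commalg k) (g : commalg_hom (az_center B) E) (n n' : posN).
Hypotheses (E1 : (1 : E) != 0)
  (An : constant_degree (base_change (commalg_comp g f) A) (val n))
  (Bn' : constant_degree (base_change g B) (val n')).
Let hL : @sieve (azumaya_cat k) B := @pullback (azumaya_cat k) A B h L.

Lemma rep_pullback_mul q m : (val n' = val n * q)%N ->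
  rep L (commalg_comp g f) m -> rep hL g (m * q).
Proof.
move=> n'E [Y [azY [Ym [j [jE Lj]]]]].
have azA := base_change_azumaya (commalg_comp g f) (@az_azumaya k A).
have [q' [phi [phis phij _ n'E' [azV Vq]]]] := bc_center_map hf E1 (valP n) (valP n') An Bn'.
have {}Vq : constant_degree (cent_alg phi) q.
  move: n'E'; rewrite n'E => /eqP; rewrite eqn_pmul2l ?(valP n) // => /eqP qE.
  by rewrite qE.
have [psi [psis psij]] := bc_hom jE.
have [T [Ts TE]] := tensor_amalgam phis psis azA.
apply: (@rep_pullback A B h L E E (commalg_id E) g Y azY j (tens_alg Y (cent_alg phi))
  (tinl _ _) (T \o bcj g B)) => //.
- exact: tens_azumaya.
- exact: (tens_degree (commalg_scalar E)).
- by move=> c; apply: etrans (congr1 T (bcj_scalar g B c)) (Ts _).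
- by move=> a; apply: etrans (congr1 T (esym (phij a))) _; rewrite TE psij.
Qed.

Lemma split_pullback_covering m : finer J (@etale_topology k) -> (0 < m)%N ->
  rep L (commalg_comp g f) m ->
  exists S : @sieve (commalg_cat k) E, J S /\
    forall (E' : commalg k) (u : commalg_hom E E'), S E' u ->
      rep hL (commalg_comp u g) (lcmn m (val n')).
Proof.
move=> Jet m0 [Y [azY [Ym [j [jE Lj]]]]].
have [e _] := exists_point k_uncountable E1.
have azA := base_change_azumaya (commalg_comp g f) (@az_azumaya k A).
have [q [phi [phis phij q0 n'E [azV Vq]]]] := bc_center_map hf E1 (valP n) (valP n') An Bn'.
have [psi [psis psij]] := bc_hom jE.
have := degree_dvd (commalg_scalar E) psis azA azY e An Ym => /dvdnP[r].
rewrite mulnC => mE; have r0 : (0 < r)%N by move: m0; rewrite mE muln_gt0 => /andP[].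
have azU := centralizer_azumaya psis azA azY.
have Ur : constant_degree (cent_alg psi) r.
  by apply: (centralizer_degree (commalg_scalar E) psis azA azY (valP n) An); rewrite -mE.
exists (meet_sieve (split_sieve (cent_alg phi) q) (split_sieve (cent_alg psi) r)); split.
  by apply: (covering_meet hJ); apply: azumaya_split_covering.
move=> E' u [su su']; pose b := lcmn r q.
have b0 : (0 < b)%N by rewrite lcmn_gt0 r0.
have [T [Ts TE]] := split_map phis azA (dvdn_lcmr r q) q0 su.
have [T' [Ts' TE']] := split_map psis azA (dvdn_lcml r q) r0 su'.
apply: (@rep_pullback A B h L E E' u (commalg_comp u g) Y azY j
  (tens_alg (base_change u _) (mat_alg E' b)) T' (T \o bcj g B)) => //.
- by apply: tens_azumaya; [apply: base_change_azumaya|apply: mat_azumaya].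
(* With [m = n r] and [n' = n q], the lcm of [m] and [n'] is [n] times the lcm of [r] and [q]. *)
- rewrite mE n'E -muln_lcmr.
  apply: (tens_degree (commalg_scalar E')); [exact: base_change_azumaya|exact: mat_azumaya| |].
    exact: (base_change_degree (commalg_scalar E)).
  exact: (mat_degree (commalg_scalar E')).
- by move=> c; apply: etrans (congr1 T (bcj_scalar g B c)) (Ts _).
- by move=> a; apply: etrans (congr1 T (esym (phij a))) _; rewrite TE -TE' psij.
Qed.
End Pullback.

Hypothesis hfin : finite_type K.

Lemma pullback_stable_mul (A B : azumaya_alg k) (h : azumaya_hom A B)
    (L : @sieve (azumaya_cat k) A) (f : commalg_hom (az_center A) (az_center B))
    (E : commalg k) (g : commalg_hom (az_center B) E) (n' : posN) :
  stable_under_mul K -> (forall c, h (scalar A c) = scalar B (f c)) -> (1 : E) != 0 ->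
  centrally_covered K L (commalg_comp g f) -> constant_degree (base_change g B) (val n') ->
  centrally_covered K (@pullback (azumaya_cat k) A B h L) g.
Proof.
move=> Kmul hf E1 /centrally_coveredP[n [An [S [KS SL]]]] Bn'.
have [q [_ [_ _ q0 n'E _]]] := bc_center_map hf E1 (valP n) (valP n') An Bn'.
have n'q : n' = mulp n (exist _ q q0) by apply: val_inj.
apply/centrally_coveredP; exists n'; split=> //; rewrite n'q.
(* Finite type puts the covering sieve in the form of a family, to which stability under
   multiplication by [q] applies. *)
have [l [m [nm [KF FS]]]] := hfin KS.
eexists; split; first exact: (Kmul n (exist _ q q0) _ m nm KF).
move=> p np [i [mp _]]; apply/representedE.
have : rep L (commalg_comp g f) (val (m i)).
  apply/representedE; apply: (SL _ (nm i)); apply: FS.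
  by exists i, (dvdnn _); apply: bool_irrelevance.
move/(rep_pullback_mul hf E1 An Bn' n'E)/rep_dvd; apply => //; exact: (valP p).
Qed.

Lemma pullback_etale (A B : azumaya_alg k) (h : azumaya_hom A B)
    (L : @sieve (azumaya_cat k) A) (f : commalg_hom (az_center A) (az_center B))
    (E : commalg k) (g : commalg_hom (az_center B) E) (n' : posN) :
  finer J (@etale_topology k) -> (forall c, h (scalar A c) = scalar B (f c)) ->
  (1 : E) != 0 -> centrally_covered K L (commalg_comp g f) ->
  constant_degree (base_change g B) (val n') ->
  J (@pullback cat _ _ g (piK (@pullback (azumaya_cat k) A B h L))).
Proof.
move=> Jet hf E1 /centrally_coveredP[n [An [S [KS SL]]]] Bn'.
have [q [_ [_ _ q0 n'E _]]] := bc_center_map hf E1 (valP n) (valP n') An Bn'.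
have [l [m [nm [KF FS]]]] := hfin KS.
have nn' : (val n %| val n')%N by rewrite n'E dvdn_mulr.
have /choice[T TP] i := split_pullback_covering hf E1 An Bn' Jet (valP (m i))
  (proj1 (representedE _ _ _) (SL _ (nm i) (FS _ _ (ex_intro _ i (ex_intro _ (dvdnn _)
    (bool_irrelevance _ _)))))).
(* Finitely many numbers [m i] matter, so the splitting sieves have a covering meet. *)
apply: (covering_sub hJ (covering_bigmeet hJ (fun i => (TP i).1))) => E' u Tu.
apply/centrally_coveredP; exists n'; split; first exact: bc_degree_comp.
exists (@pullback div_cat n n' nn' (family_sieve nm)); split; first exact: (covering_pull hK).
(* The number [p] is a multiple of [n'] and of some [m i], hence of their lcm, which is represented
   over [E']. *)
move=> p n'p [i [mp _]]; apply/representedE; apply: rep_dvd ((TP i).2 _ u (Tu i)) _ (valP p).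
by rewrite dvdn_lcm n'p mp.
Qed.

Lemma JK_pullback (A B : azumaya_alg k) (h : azumaya_hom A B)
    (L : @sieve (azumaya_cat k) A) :
  finer J (@etale_topology k) \/ stable_under_mul K ->
  JK J K L -> JK J K (@pullback (azumaya_cat k) A B h L).
Proof.
move=> JKcase /JKE JL; apply/JKE; have [f hf] := exists_center_map h.
(* Meeting with this sieve ensures that [B] has constant degree over the centers considered. *)
have JB : J (piK (max_sieve (B : azumaya_cat k))) by apply/JKE; apply: JK_max.
have JfL : J (@pullback cat _ _ f (piK L)) by apply: (covering_pull hJ).
apply: (covering_loc hJ (covering_meet hJ JfL JB)) => E g [cL [n' [Bn' _]]].
have [E0|E1] := eqVneq (1 : E) 0; first exact: (covering_zero hJ Jzar).
case: JKcase => [Jet|Kmul]; first exact: (pullback_etale Jet hf E1 cL Bn').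
by apply: (covering_mem hJ); apply: (pullback_stable_mul Kmul hf E1 cL Bn').
Qed.

Lemma rep_local (A : azumaya_alg k) (R : @sieve (azumaya_cat k) A) (D : commalg k)
    (f : commalg_hom (az_center A) D) (B : algebra D) (azB : azumaya B) (m : posN)
    (g : azumaya_hom A (AzumayaAlg azB)) :
  constant_degree B (val m) -> (forall c, g (scalar A c) = scalar B (f c)) ->
  JK J K (@pullback (azumaya_cat k) A (AzumayaAlg azB) g R) ->
  exists T : @sieve (commalg_cat k) D, J T /\
    forall (E : commalg k) (u : commalg_hom D E), (1 : E) != 0 -> T E u ->
      exists S : @sieve div_cat m, K S /\ forall p mp, S p mp -> rep R (commalg_comp u f) (val p).
Proof.
move=> Bm gf /JKE JR; exists (piK (@pullback (azumaya_cat k) A (AzumayaAlg azB) g R)).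
split=> // E u E1 /centrally_coveredP[m' [Bm' [S [KS SR]]]].
(* Over a nonzero [E] the degree is determined, so the [K]-covering sieve lives on the degree [m] of
   [B]. *)
have mE : m' = m.
  apply: val_inj; apply: (@bc_degree_unique (AzumayaAlg azB) E u _ _ E1 Bm').
  exact: (base_change_degree (commalg_scalar D)).
move: S KS SR; rewrite mE => S KS SR; exists S; split=> // p mp /SR/representedE.
move=> [B' [azB' [B'p [g' [g'u Rg]]]]]; exists B', azB'; split=> //.
by exists (azumaya_comp g' g); split=> // c; rewrite /= gf g'u.
Qed.

(** Finite type reduces to finitely many numbers [m i]. On the meet of the [J]-covering sieves from
    [rep_local], each [m i] carries a [K]-covering sieve of numbers represented by [R], and
    transitivity of [K] assembles these into one on [n]. *)
Lemma JK_local (A : azumaya_alg k) (L R : @sieve (azumaya_cat k) A) : JK J K L ->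
  (forall (B : azumaya_alg k) (h : azumaya_hom A B), L B h ->
    JK J K (@pullback (azumaya_cat k) A B h R)) -> JK J K R.
Proof.
move=> /JKE JL LR; apply/JKE; apply: (covering_loc hJ JL) => D f.
move=> /centrally_coveredP[n [An [S [KS SL]]]].
have [D0|D1] := eqVneq (1 : D) 0; first exact: (covering_zero hJ Jzar).
have [l [m [nm [KF FS]]]] := hfin KS.
have /choice[T TP] i : exists T : @sieve (commalg_cat k) D, J T /\
    forall (E : commalg k) (u : commalg_hom D E), (1 : E) != 0 -> T E u ->
      exists S : @sieve div_cat (m i), K S /\
        forall p mp, S p mp -> rep R (commalg_comp u f) (val p).
  have : represented L f (m i).
    apply: (SL _ (nm i)); apply: FS; exists i, (dvdnn _); exact: bool_irrelevance.
  move=> /representedE[B [azB [Bm [g [gf Lg]]]]].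
  exact: (rep_local Bm gf (LR _ _ Lg)).
apply: (covering_loc hJ (covering_bigmeet hJ (fun i => (TP i).1))) => E u Tu.
have [E0|E1] := eqVneq (1 : E) 0; first exact: (covering_zero hJ Jzar).
apply: (covering_mem hJ); apply/centrally_coveredP.
exists n; split; first exact: bc_degree_comp.
exists (represented_sieve R (commalg_comp u f) n); split=> //.
apply: (covering_loc hK KF) => p np [i [mp _]].
have [Si [KSi SiR]] := (TP i).2 E u E1 (Tu i).
apply: (covering_sub hK (covering_pull hK mp KSi)) => q pq /= /SiR Rq.
by apply/representedE.
Qed.

Lemma JK_topology : finer J (@etale_topology k) \/ stable_under_mul K ->
  grothendieck_topology (JK J K).
Proof.
move=> JKcase; split; [exact: JK_max| |exact: JK_local].
by move=> A B L h; apply: JK_pullback.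
Qed.

End Topology.

Theorem theorem4p7 (R : realType)
    (J : coverage (commalg_cat R[i])) (K : coverage div_cat)
    (hJ : grothendieck_topology J) (hK : grothendieck_topology K)
    (hfin : finite_type K)
    (hJK : finer J (@etale_topology R[i])
           \/ finer J (@zariski_topology R[i]) /\ stable_under_mul K) :
  grothendieck_topology (JK J K).
Proof.
apply: (@JK_topology _ J K (@complex_uncountable R) hJ hK _ hfin).
  by case: hJK => [/finer_etale_zariski|[/finer_zariski]].
by case: hJK => [|[_]]; [left|right].
Qed.
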